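(* Let $p>1$ and let $(Y,Z),(Y',Z')\in\mathcal S^p\times\mathcal M$ be solutions of the BSDEs $(F,\xi)$ and $(F',\xi')$, respectively. Suppose that $\mathbb P$-a.s. $F(t,y,z)\le F'(t,y,z)$ for any $(t,y,z)\in[0,T]\times\mathbb R\times\mathbb R^d$ and $\xi\le\xi'$, and that $F$ (with terminal value $\xi$) satisfies Assumption (B) of the context with this $p$. Then $\mathbb P$-a.s. $Y_t\le Y'_t$ for all $t\in[0,T]$.
   Context: Fix $0<T<\infty$ and a $d$-dimensional Brownian motion $W$ on a complete probability space $(\Omega,\mathcal F,\mathbb P)$, with $(\mathcal F_t)_{0\le t\le T}$ the filtration generated by $W$ and augmented by the $\mathbb P$-null sets. $\mathrm{Prog}$ is the progressive $\sigma$-algebra on $\Omega\times[0,T]$. $\operatorname{sgn}(x)=x/|x|$ for $x\ne0$ and $\operatorname{sgn}(0)=0$. A generator is a $\mathrm{Prog}\otimes\mathcal B(\mathbb R)\otimes\mathcal B(\mathbb R^d)$-measurable function $F:\Omega\times[0,T]\times\mathbb R\times\mathbb R^d\to\mathbb R$; a terminal value is an $\mathcal F_T$-measurable real random variable $\xi$. A solution of the BSDE $(F,\xi)$ is a pair $(Y,Z)$ valued in $\mathbb R\times\mathbb R^d$, with $Y$ continuous adapted and $Z$ $\mathrm{Prog}$-measurable, such that $\mathbb P$-a.s. $\int_0^T|Z_s|^2ds<\infty$, $\int_0^T|F(s,Y_s,Z_s)|ds<\infty$ and, for all $t\in[0,T]$, \[Y_t=\xi+\int_t^TF(s,Y_s,Z_s)ds-\int_t^TZ_sdW_s.\]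 Notation: $Y^*=\sup_{t\in[0,T]}|Y_t|$; for a $\mathrm{Prog}$-measurable real process $H$, $|H|_t=\int_0^tH_udu$. $\mathcal S^p$ ($p\ge1$): continuous adapted processes $Y$ with $Y^*\in\mathbb L^p$. $\mathcal M$: $\mathbb R^d$-valued $\mathrm{Prog}$-measurable $Z$ with $\int_0^T|Z_s|^2ds<\infty$ $\mathbb P$-a.s. $\mathcal I$: the set of integrable functions from $\mathbb R$ to $\mathbb R$ that are bounded on every compact subset of $\mathbb R$. $f(|\cdot|)$ denotes the function $x\mapsto f(|x|)$ on $\mathbb R$. Assumption (B) on $(F,\xi)$, for a given $p>1$: there exist $\beta_1,\beta_2\in\mathbb R$, $\gamma_1,\gamma_2\ge0$, an $\mathbb R^+$-valued $\mathrm{Prog}$-measurable process $\alpha$, a continuous nondecreasing $\varphi:\mathbb R^+\to\mathbb R^+$ with $\varphi(0)=0$, a function $f$ with $f(|\cdot|)\in\mathcal I$, and $\mathrm{Prog}\otimes\mathcal B(\mathbb R)\otimes\mathcal B(\mathbb R^d)$-measurable $F_1,F_2:\Omega\times[0,T]\times\mathbb R\times\mathbb R^d\to\mathbb R$ such that $F=F_1+F_2$, $|\xi|+|\alpha|_T\in\mathbb L^p$ and $\mathbb P$-a.s.: (i) for any $t\in[0,T]$, $(y,z)\mapsto F(t,y,z)$ is continuous; (ii) for any $t\in[0,T]$, $y,y'\in\mathbb R$, $z,z'\in\mathbb R^d$: $\operatorname{sgn}(y-y')\big(F_1(t,y,z)-F_1(t,y',z)\big)\le\beta_1|y-y'|$,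 $\ |F_1(t,y,z)-F_1(t,y,z')|\le\gamma_1|z-z'|$, and $\operatorname{sgn}(y)F_2(t,y,z)\le\beta_2|y|+\gamma_2|z|+f(|y|)|z|^2$; (iii) for any $t\in[0,T]$, $(y,z)\mapsto F_2(t,y,z)$ is convex; (iv) for any $(t,y,z)\in[0,T]\times\mathbb R\times\mathbb R^d$, $|F(t,y,z)|\le\alpha_t+\varphi(|y|)+(\gamma_1+\gamma_2)|z|+f(|y|)|z|^2$. *)

(* Defs.v *)
From HB Require Import structures.
From mathcomp Require Export all_boot all_order all_algebra.
From mathcomp Require Export all_classical all_reals all_analysis.
From mathcomp Require Export measurable_realfun.
Export Order.TTheory GRing.Theory Num.Theory.
Export numFieldNormedType.Exports.

Set Implicit Arguments.
Unset Strict Implicit.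
Unset Printing Implicit Defensive.

Local Open Scope classical_set_scope.
Local Open Scope ring_scope.

(* Processes are functions [X : R -> Omega -> E] of time and scenario; only
   their values at times in [0, T] matter.  Suprema, and integrals of
   nonnegative functions, are taken in \bar R. *)

Section euclidean_space.
Context (R : realType) (d : nat).

(* The library norm on row vectors is the sup norm, whence [enorm]; the
   topologies agree. *)
Definition enorm (z : 'rV[R]_d) : R := Num.sqrt (\sum_(i < d) z ord0 i ^+ 2).

Definition dotp (x y : 'rV[R]_d) : R := \sum_(i < d) x ord0 i * y ord0 i.

Definition rV_borel := g_sigma_algebraType (@open 'rV[R]_d).

End euclidean_space.

Section processes.
Context (R : realType) (disp : measure_display) (Omega : measurableType disp).
Context (T : R) (Fil : R -> set (set Omega)).

(* [adapted] and [progressive_meas] are stated for an arbitrary measurable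
   codomain, instantiated below with R and [rV_borel R d]. *)
Definition adapted (dE : measure_display) (E : measurableType dE)
    (X : R -> Omega -> E) : Prop :=
  forall t, 0 <= t <= T ->
    measurable_fun [set: g_sigma_algebraType (Fil t)] (X t).

(* A subset of Omega x R is in [Prog] when its trace on Omega x [0, t] lies in
   Fil t (x) Borel for every t in [0, T].  What happens at times outside [0, T]
   is unconstrained: the trace of [Prog] on Omega x [0, T] is the progressive
   sigma-algebra, and measurability is only ever required on that domain. *)
Definition Prog : set (set (Omega * R)) :=
  [set A | forall t, 0 <= t <= T ->
    <<s [set B `*` C | B in Fil t & C in (measurable : set (set R))] >>
      (A `&` ([set: Omega] `*` `[0, t]))].

Definition ProgT := g_sigma_algebraType Prog.

Definition progressive_meas (dE : measure_display) (E : measurableType dE)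
    (X : R -> Omega -> E) : Prop :=
  measurable_fun ([set x | 0 <= x.2 <= T] : set ProgT) (fun x => X x.2 x.1).

(* Prog (x) B(R) (x) B(R^d)-measurability *)
Definition generator_meas (d : nat)
    (F : Omega -> R -> R -> 'rV[R]_d -> R) : Prop :=
  measurable_fun
    ([set x | 0 <= x.1.1.2 <= T] : set (ProgT * R * rV_borel R d)%type)
    (fun x => F x.1.1.1 x.1.1.2 x.1.2 x.2).

End processes.

Section brownian.
Context (R : realType) (disp : measure_display) (Omega : measurableType disp).
Context (P : probability Omega R) (d : nat) (T : R).
Context (W : R -> Omega -> 'rV[R]_d).

Definition history (t : R) : set (set Omega) :=
  [set (W u) @^-1` B | u in `[0, t] & B in (@measurable _ (rV_borel R d))].

Definition augmented_filtration (t : R) : set (set Omega) :=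
  <<s history t `|` P.-negligible >>.

(* For s < t, the increment W_t - W_s is independent of sigma(W_u, u <= s) and
   its coordinates are independent with law N(0, t - s).  The second parameter
   of [normal_prob] is the standard deviation. *)
Definition brownian_motion : Prop :=
  [/\ forall t, 0 <= t <= T ->
        measurable_fun [set: Omega] (W t : Omega -> rV_borel R d),
      {ae P, forall w, W 0 w = 0},
      {ae P, forall w, {within `[0, T], continuous (fun t => W t w)}} &
      forall s t, 0 <= s -> s < t -> t <= T ->
      forall (A : set Omega) (B : 'I_d -> set R),
        <<s history s >> A -> (forall i, measurable (B i)) ->
        P (A `&` [set w | forall i, B i (W t w ord0 i - W s w ord0 i)]) =
        (P A * \prod_(i < d) normal_prob 0 (Num.sqrt (t - s)) (B i))%E].

End brownian.

Section ito.
Context (R : realType) (disp : measure_display) (Omega : measurableType disp).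
Context (P : probability Omega R) (d : nat) (T : R).
Context (W : R -> Omega -> 'rV[R]_d).

Local Notation Fil := (augmented_filtration P W).

(* The process equal to [sp_val k] on the time interval
   ]sp_time k, sp_time k.+1] for k < sp_size, and to 0 elsewhere. *)
Record simple_process := SimpleProcess {
  sp_size : nat ;
  sp_time : nat -> R ;
  sp_val : nat -> Omega -> 'rV[R]_d }.

Definition is_simple_process (H : simple_process) : Prop :=
  [/\ 0 <= sp_time H 0 /\ sp_time H (sp_size H) <= T,
      forall k, (k < sp_size H)%N -> sp_time H k <= sp_time H k.+1,
      forall k, (k < sp_size H)%N ->
        measurable_fun [set: g_sigma_algebraType (Fil (sp_time H k))]
          (sp_val H k : _ -> rV_borel R d) &
      exists M : R, forall k w, (k < sp_size H)%N ->
        enorm (sp_val H k w) <= M].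

Definition sp_process (H : simple_process) (s : R) (w : Omega) : 'rV[R]_d :=
  \sum_(k < sp_size H)
    (if sp_time H k < s <= sp_time H k.+1 then sp_val H k w else 0).

Definition sp_integral (H : simple_process) (t : R) (w : Omega) : R :=
  \sum_(k < sp_size H)
    dotp (sp_val H k w)
      (W (Num.min (sp_time H k.+1) t) w - W (Num.min (sp_time H k) t) w).

Definition cvg_probability0 (X : nat -> Omega -> \bar R) : Prop :=
  forall e : R, 0 < e ->
    P [set w | (e%:E <= X n w)%E] @[n --> \oo] --> 0%E.

Definition continuous_adapted (Y : R -> Omega -> R) : Prop :=
  adapted T Fil Y /\
  {ae P, forall w, {within `[0, T], continuous (fun t => Y t w)}}.

Definition class_M (Z : R -> Omega -> 'rV[R]_d) : Prop :=
  progressive_meas T Fil (Z : R -> Omega -> rV_borel R d) /\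
  {ae P, forall w,
    (\int[lebesgue_measure]_(s in `[0%R, T]) (enorm (Z s w) ^+ 2)%:E < +oo)%E}.

Definition sup_process (Y : R -> Omega -> R) (w : Omega) : \bar R :=
  ereal_sup [set (`|Y t w|)%:E | t in `[0, T]].

(* I_t = \int_0^t Z_s dW_s for all t in [0, T], for Z in [class_M]: I is the
   limit, uniformly on [0, T] in probability, of the elementary integrals of
   simple processes H_n such that \int_0^T |H_n - Z|^2 ds tends to 0 in
   probability.  This determines I up to indistinguishability. *)
Definition is_ito_integral (Z : R -> Omega -> 'rV[R]_d) (I : R -> Omega -> R)
    : Prop :=
  continuous_adapted I /\
  exists H : nat -> simple_process,
    [/\ forall n, is_simple_process (H n),
        cvg_probability0 (fun n w =>
          \int[lebesgue_measure]_(s in `[0%R, T])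
            (enorm (sp_process (H n) s w - Z s w) ^+ 2)%:E)%E &
        cvg_probability0 (fun n =>
          sup_process (fun t w => sp_integral (H n) t w - I t w))].

Definition in_Lp (p : R) (X : Omega -> \bar R) : Prop :=
  measurable_fun [set: Omega] X /\ ('N[P]_(p%:E)[X] < +oo)%E.

Definition class_S (p : R) (Y : R -> Omega -> R) : Prop :=
  continuous_adapted Y /\ in_Lp p (sup_process Y).

Definition generator (F : Omega -> R -> R -> 'rV[R]_d -> R) : Prop :=
  generator_meas T Fil F.

Definition terminal_value (xi : Omega -> R) : Prop :=
  measurable_fun [set: g_sigma_algebraType (Fil T)] xi.

Definition bsde_solution (F : Omega -> R -> R -> 'rV[R]_d -> R)
    (xi : Omega -> R) (Y : R -> Omega -> R) (Z : R -> Omega -> 'rV[R]_d)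
    : Prop :=
  [/\ continuous_adapted Y,
      class_M Z,
      {ae P, forall w,
        (\int[lebesgue_measure]_(s in `[0%R, T])
           (`|F w s (Y s w) (Z s w)|)%:E < +oo)%E} &
      exists I : R -> Omega -> R, is_ito_integral Z I /\
        {ae P, forall w, forall t, 0 <= t <= T ->
          Y t w = xi w
            + \int[lebesgue_measure]_(s in `[t, T]) F w s (Y s w) (Z s w)
            - (I T w - I t w)}].

Definition class_I (f : R -> R) : Prop :=
  lebesgue_measure.-integrable [set: R] (EFin \o f) /\
  forall K : set R, compact K ->
    exists M : R, forall x, K x -> `|f x| <= M.

(* The functions [phi] and [f] on R+ are represented by functions on R whose
   values on negative numbers are irrelevant. *)
Definition assumption_B (p : R) (F : Omega -> R -> R -> 'rV[R]_d -> R)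
    (xi : Omega -> R) : Prop :=
  exists (beta1 beta2 gamma1 gamma2 : R) (alpha : R -> Omega -> R)
    (phi f : R -> R) (F1 F2 : Omega -> R -> R -> 'rV[R]_d -> R),
  [/\ 0 <= gamma1 /\ 0 <= gamma2,
      progressive_meas T Fil alpha /\
        (forall t w, 0 <= t <= T -> 0 <= alpha t w),
      [/\ {within `[0, +oo[, continuous phi},
          forall x y, 0 <= x -> x <= y -> phi x <= phi y,
          forall x, 0 <= x -> 0 <= phi x & phi 0 = 0],
      class_I (fun x => f `|x|) &
  [/\ generator F1 /\ generator F2,
      forall w t y z, 0 <= t <= T -> F w t y z = F1 w t y z + F2 w t y z,
      in_Lp p (fun w => (`|xi w|)%:E +
        \int[lebesgue_measure]_(s in `[0%R, T]) (alpha s w)%:E)%E &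
      {ae P, forall w, forall t, 0 <= t <= T ->
        [/\ continuous (fun x : R * 'rV[R]_d => F w t x.1 x.2),
            [/\ forall y y' z,
                  Num.sg (y - y') * (F1 w t y z - F1 w t y' z)
                    <= beta1 * `|y - y'|,
                forall y z z',
                  `|F1 w t y z - F1 w t y z'| <= gamma1 * enorm (z - z') &
                forall y z,
                  Num.sg y * F2 w t y z
                    <= beta2 * `|y| + gamma2 * enorm z
                       + f `|y| * enorm z ^+ 2],
            convex_function [set: (R^o * 'rV[R]_d)%type]
              (fun x => F2 w t x.1 x.2) &
            forall y z,
              `|F w t y z| <= alpha t w + phi `|y|
                 + (gamma1 + gamma2) * enorm z + f `|y| * enorm z ^+ 2]}]].

End ito.

(* Main.v *)
From HB Require Import structures.
Require Import Defs.
From mathcomp Require Import ring lra.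

Set Implicit Arguments.
Unset Strict Implicit.
Unset Printing Implicit Defensive.

Local Open Scope classical_set_scope.
Local Open Scope ring_scope.

(* Since f(|.|) is integrable, x f(x) has inferior limit 0 at infinity; convexity
   of F2 then turns its one-sided growth bound into
   F2(y1, z1) - F2(y0, z0) <= beta2 (y1 - y0) + gamma2 |z1 - z0| for y0 < y1.
   Hence, with D = Y - Y' and V = Z - Z', the difference of the drivers along the
   two solutions is at most beta D + gamma |V| wherever D > 0.

   The Ito integrals are replaced by those of simple processes on a fine grid
   along which all integrands are constant.  From the drift increments of D,
   truncated, and from these elementary integrals one rebuilds a path X of D.
   Tilting the Gaussian increments of each cell by a bounded density, a discrete
   Girsanov transform, absorbs the drift gamma |V|, so that rho h(X) - Q is a
   submartingale, where h is the Huber function (convex, zero exactly on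
   ]-oo, 0]), rho is the discount factor of the beta D term and Q accumulates the
   error of the drift bound.  The path is stopped when X leaves D or Q drops too
   low.  As D_T <= 0, this bounds E h(D_t) by small terms plus the contribution of
   stopped scenarios; their probability is small, and the densities have moments
   of every order, so Y* and Y'* in L^p control that contribution by Young's
   inequality.  Letting the errors tend to 0 gives E h(D_t) = 0. *)

(** * Convexity against an integrable growth coefficient *)

(** [Z] and [Z'] are only pathwise square integrable, so the Ito integral is a local martingale
    without moments; a simple process is bounded, and its elementary integrals have all of them. On
    the grid the tangent inequality of a convex function takes the place of Ito's formula. The Huber
    function stands in for the positive part because its derivative is 1-Lipschitz, so that
    exchanging D for the nearby X costs a small multiple of the drivers, and because its linear
    growth asks for first moments of X only. The obstacle is the bound M of the simple processes,
    over which there is no control. The tilt sees only the signs of the integrand, which keeps the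
    moments of the densities free of M. The step that stops the path may overshoot by an amount
    depending on M; it is bounded by a tolerance plus a multiple of fourth powers of increments,
    whose expectation is of the order of the mesh. Hence the order of choices: the tolerance [dl]
    and the weight [e] in Young's inequality, the admissible probability of stopping, a bound on the
    paths, the oscillation [q], the simple processes and with them M, the mesh last. *)

(** Otherwise |f| is at least c / (2n) on the block [n, 2n] for large n, and the block carries an
    integral of at least c / 2; but by dominated convergence the integrals over these blocks tend to
    0. *)
Lemma integrable_small_mulx (R : realType) (f : R -> R) (c x0 : R) :
  lebesgue_measure.-integrable setT (EFin \o f) -> 0 < c ->
  exists2 x, x0 <= x & x * `|f x| < c.
Proof.
move=> fi c0; apply: contrapT => H.
have {}H x : x0 <= x -> c <= x * `|f x|.
  by move=> x0x; rewrite leNgt; apply/negP => h; apply: H; exists x.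
pose D n : set R := `[n%:R, 2 * n%:R]%classic.
pose g n x : \bar R := (`|f x| * \1_(D n) x)%:E.
have mf : measurable_fun setT f by apply/measurable_EFinP; exact: measurable_int fi.
have mg n : measurable_fun setT (g n).
  apply/measurable_EFinP; apply: measurable_funM; first exact: measurableT_comp.
  by apply: measurable_indic; exact: measurable_itv.
have [] := @dominated_convergence _ _ R lebesgue_measure setT measurableT
   g (cst 0%E) (fun x => (`|f x|)%:E) mg.
- exact: measurable_cst.
- apply: aeW => x _; apply: cvg_near_cst.
  exists (Num.trunc `|x|).+1 => // n /= hn.
  rewrite /g indicE memNset ?mulr0//= /D/= in_itv/= => /andP[h _].
  have := truncnS_gt `|x|; have := ler_norm x.
  have : (Num.trunc `|x|).+1%:R <= n%:R :> R by rewrite ler_nat.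
  lra.
- have := integrable_abse fi; apply: eq_integrable => //.
- apply: aeW => x n _; rewrite /g /= lee_fin normrM normr_id.
  by rewrite ler_piMr// indicE; case: (_ \in _); rewrite ?normr0 ?normr1 ?ler01.
move=> _ _; rewrite integral_cst// mul0e => /fine_cvgP[_] /cvgrPdist_lt.
have c4 : 0 < c / 2 by lra.
move=> /(_ _ c4)[N _ /(_ (maxn N (Num.trunc `|x0|).+1)) /(_ (leq_maxl _ _))].
set n := maxn _ _ => /=.
have xn : x0 <= n%:R /\ 0 < n%:R :> R.
  have := truncnS_gt `|x0|; have := ler_norm x0; have := normr_ge0 x0.
  have : (Num.trunc `|x0|).+1%:R <= n%:R :> R by rewrite ler_nat leq_maxr.
  lra.
rewrite sub0r normrN ltNge => /negP; apply.
apply: le_trans (ler_norm _); rewrite -lee_fin fineK; last first.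
  apply/integrable_fin_num => //.
  apply: (@le_integrable _ (measurableTypeR R) _ _ _ measurableT _ _ (mg n) _ fi) => x _; rewrite /= lee_fin normrM normr_id.
  by rewrite ler_piMr// indicE; case: (_ \in _); rewrite ?normr0 ?normr1 ?ler01.
have -> : (c / 2)%:E = (\int[lebesgue_measure]_(x in D n) (c / (2 * n%:R))%:E)%E.
  rewrite integral_cst; last exact: measurable_itv.
  rewrite /D/= lebesgue_measure_itv/= lte_fin ifT; last by lra.
  by rewrite -EFinB -EFinM; congr EFin; field; rewrite lt0r_neq0//; lra.
rewrite [leRHS](_ : (_ = \int[lebesgue_measure]_(x in D n) (`|f x|)%:E)%E); last first.
  rewrite [RHS]integral_mkcond; apply: eq_integral => x _.
  by rewrite /g /patch indicE; case: (_ \in _); rewrite ?mulr1 ?mulr0.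
apply: ge0_le_integral => //=.
- exact: measurable_itv.
- by move=> x _; rewrite lee_fin divr_ge0//; lra.
- by apply/measurable_EFinP; apply: measurable_funTS; exact: measurableT_comp.
- move=> x; rewrite /D/= in_itv/= => /andP[h1 h2]; rewrite lee_fin ler_pdivrMr; last by lra.
  apply: (le_trans (H x _)); first by lra.
  by rewrite mulrC ler_wpM2l//; lra.
Qed.

Lemma enormZ (R : realType) (d : nat) (c : R) (z : 'rV[R]_d) :
  enorm (c *: z) = `|c| * enorm z.
Proof.
rewrite /enorm -sqrtr_sqr -sqrtrM ?sqr_ge0//; congr Num.sqrt.
by rewrite mulr_sumr; apply: eq_bigr => i _; rewrite mxE exprMn.
Qed.

Lemma enorm_ge0 (R : realType) (d : nat) (z : 'rV[R]_d) : 0 <= enorm z.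
Proof. exact: sqrtr_ge0. Qed.

Lemma sqr_enorm (R : realType) (d : nat) (z : 'rV[R]_d) :
  enorm z ^+ 2 = \sum_(i < d) z ord0 i ^+ 2.
Proof. by rewrite sqr_sqrtr// sumr_ge0// => i _; rewrite sqr_ge0. Qed.

Lemma ler_enormD (R : realType) (d : nat) (x y : 'rV[R]_d) :
  enorm (x + y) <= enorm x + enorm y.
Proof.
set s := \sum_(i < d) x ord0 i * y ord0 i.
(* Cauchy-Schwarz, from the squared norm of |y| x - |x| y. Vanishing norms are treated apart because
   the conclusion divides by |x| |y|. *)
have key : s <= enorm x * enorm y.
  have [a0|a0] := eqVneq (enorm x) 0.
    have x0 i : x ord0 i = 0.
      move: a0 => /(congr1 (fun t => t ^+ 2)); rewrite sqr_enorm expr0n/= => /psumr_eq0P.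
      move=> /(_ (fun j _ => sqr_ge0 _)) /(_ i isT) /eqP; by rewrite sqrf_eq0 => /eqP.
    by rewrite a0 mul0r /s big1// => i _; rewrite x0 mul0r.
  have ap : 0 < enorm x by rewrite lt_def a0 enorm_ge0.
  have [b0|b0] := eqVneq (enorm y) 0.
    have y0 i : y ord0 i = 0.
      move: b0 => /(congr1 (fun t => t ^+ 2)); rewrite sqr_enorm expr0n/= => /psumr_eq0P.
      move=> /(_ (fun j _ => sqr_ge0 _)) /(_ i isT) /eqP; by rewrite sqrf_eq0 => /eqP.
    by rewrite b0 mulr0 /s big1// => i _; rewrite y0 mulr0.
  have bp : 0 < enorm y by rewrite lt_def b0 enorm_ge0.
  have : 0 <= \sum_(i < d) (enorm y * x ord0 i - enorm x * y ord0 i) ^+ 2.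
    by rewrite sumr_ge0// => i _; rewrite sqr_ge0.
  have -> : \sum_(i < d) (enorm y * x ord0 i - enorm x * y ord0 i) ^+ 2
     = 2 * (enorm x * enorm y) * (enorm x * enorm y - s).
    transitivity (enorm y ^+ 2 * (\sum_(i < d) x ord0 i ^+ 2)
        - 2 * (enorm x * enorm y) * s
        + enorm x ^+ 2 * (\sum_(i < d) y ord0 i ^+ 2)); last by rewrite -!sqr_enorm; ring.
    rewrite /s !mulr_sumr.
    rewrite -sumrB -big_split/=; apply: eq_bigr => i _; ring.
  by rewrite pmulr_rge0 ?subr_ge0// mulr_gt0// mulr_gt0.
rewrite -(@ler_pXn2r _ 2)// ?nnegrE ?addr_ge0 ?enorm_ge0//.
rewrite sqrrD !sqr_enorm.
have -> : \sum_(i < d) (x + y) ord0 i ^+ 2 =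
   \sum_(i < d) x ord0 i ^+ 2 + s *+ 2 + \sum_(i < d) y ord0 i ^+ 2.
  rewrite /s -sumrMnl -!big_split/=; apply: eq_bigr => i _; rewrite mxE; ring.
by rewrite lerD2r lerD2l lerMn2r key orbT.
Qed.

Lemma enorm_le_sum (R : realType) (d : nat) (z : 'rV[R]_d) :
  enorm z <= \sum_(i < d) `|z ord0 i|.
Proof.
rewrite -(@ler_pXn2r _ 2)// ?nnegrE ?enorm_ge0 ?sumr_ge0// sqr_enorm.
rewrite expr2 mulr_suml ler_sum// => i _.
rewrite -real_normK ?num_real// expr2 ler_wpM2l//.
by rewrite (bigD1 i)//= lerDl sumr_ge0.
Qed.

Lemma normr_le_enorm (R : realType) (d : nat) (z : 'rV[R]_d) i :
  `|z ord0 i| <= enorm z.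
Proof.
rewrite -(@ler_pXn2r _ 2)// ?nnegrE ?enorm_ge0// sqr_enorm real_normK ?num_real//.
by rewrite (bigD1 i)//= lerDl sumr_ge0// => j _; rewrite sqr_ge0.
Qed.

(* Along a ray with increasing y, the slope of a convex function is at most its
   slope at infinity, and integrability of f kills the quadratic term there. *)
Lemma convex_slope_bound (R : realType) (d : nat) (G : R -> 'rV[R]_d -> R)
    (f : R -> R) (b g : R) :
  convex_function [set: (R^o * 'rV[R]_d)%type] (fun x => G x.1 x.2) ->
  lebesgue_measure.-integrable setT (EFin \o (fun x => f `|x|)) ->
  0 <= g ->
  (forall y z, 0 < y -> G y z <= b * y + g * enorm z + f y * enorm z ^+ 2) ->
  forall (y0 y1 : R) z0 z1, y0 < y1 ->
    G y1 z1 - G y0 z0 <= b * (y1 - y0) + g * enorm (z1 - z0).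
Proof.
move=> cG fi g0 GB y0 y1 z0 z1 y01.
set v := z1 - z0; set e := y1 - y0.
have e0 : 0 < e by rewrite /e subr_gt0.
apply/ler_addgt0Pr => eps eps0.
pose Q : R := `|G y0 z0| + `|b| * `|y0| + g * enorm z0.
pose c2 := 2 * enorm z0 ^+ 2; pose c3 := 2 * enorm v ^+ 2.
have Q0 : 0 <= Q by rewrite /Q !addr_ge0// mulr_ge0// enorm_ge0.
have c20 : 0 <= c2 by rewrite /c2 mulr_ge0// sqr_ge0.
have c30 : 0 <= c3 by rewrite /c3 mulr_ge0// sqr_ge0.
(* The value of [c] makes the quadratic growth term at most l * (eps / 2) in [fb]. *)
pose c : R := eps / 2 / (c2 * e + c3 * 2 / e + 1).
have S0 : 0 <= c2 * e + c3 * 2 / e.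
  have := mulr_ge0 c20 (ltW e0); have := divr_ge0 (mulr_ge0 c30 (ler0n R 2)) (ltW e0).
  by move=> h1 h2; exact: addr_ge0 h2 h1.
have c0 : 0 < c by rewrite /c !divr_gt0//; lra.
(* Beyond [x0] the parameter l below is at least 1, l * e is at most 2 * x, and the constant [Q],
   which collects what does not grow with l, is at most l * (eps / 2). *)
pose x0 : R := `|y0| + e + 2 * e * Q / eps + 1.
have [x x0x fx] := @integrable_small_mulx R _ c x0 fi c0.
have Qe : (0 : R) <= 2 * e * Q / eps by rewrite divr_ge0 ?mulr_ge0 ?(ltW e0) ?(ltW eps0).
have [[y0n y0n'] y00] := (ler_norm y0, ler_norm (- y0), normr_ge0 y0).
rewrite normrN in y0n'.
have x1 : 1 <= x by move: x0x; rewrite /x0; lra.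
have x00 : 0 < x by lra.
have fx' : x * `|f x| < c by move: fx; rewrite (ger0_norm (ltW x00)).
(* The ray from (y0, z0) through (y1, z1) reaches height x at parameter l, so (y1, z1) is the
   barycentre of the far point and of (y0, z0) with weights l^-1 and 1 - l^-1. *)
pose l := (x - y0) / e.
have le : l * e = x - y0 by rewrite /l divfK// gt_eqF.
have l1 : 1 <= l by rewrite /l ler_pdivlMr// mul1r; move: x0x; rewrite /x0; lra.
have l0 : 0 < l by lra.
have lx : l * e <= 2 * x by rewrite le; move: x0x; rewrite /x0; lra.
have il0 : 0 <= l^-1 by rewrite invr_ge0 ltW.
have il1 : l^-1 <= 1 by rewrite invf_le1.
have := cG (Itv01 il0 il1) (x, z0 + l *: v) (y0, z0).
rewrite !in_setT => /(_ isT isT).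
rewrite [X in G X _]/= [X in G _ X]/= /=.
move=> Hc.
have GP := GB x (z0 + l *: v) x00.
have Hc' : G y1 z1 <= l^-1 * G x (z0 + l *: v) + (1 - l^-1) * G y0 z0.
  apply: le_trans Hc.
  rewrite le_eqVlt; apply/orP; left; apply/eqP; congr G.
    change (y1 = l^-1 * x + (1 - l^-1) * y0).
    have -> : x = l * e + y0 by rewrite le; ring.
    by rewrite /e; field; rewrite gt_eqF.
  change (z1 = l^-1 *: (z0 + l *: v) + (1 - l^-1) *: z0).
  rewrite scalerDr scalerA mulVf ?gt_eqF// scale1r scalerBl scale1r /v.
  by rewrite addrAC [l^-1 *: z0 + _]addrC subrK addrC subrK.
have Nz : enorm (z0 + l *: v) <= enorm z0 + l * enorm v.
  by apply: (le_trans (ler_enormD _ _)); rewrite enormZ gtr0_norm.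
have Nz2 : enorm (z0 + l *: v) ^+ 2 <= c2 + c3 * l ^+ 2.
  have := enorm_ge0 (z0 + l *: v); have := enorm_ge0 z0; have := enorm_ge0 v.
  rewrite /c2 /c3; move: Nz; move: (enorm _) (enorm z0) (enorm v) => A B C.
  move=> h1 h2 h3 h4.
  have : A ^+ 2 <= (B + l * C) ^+ 2 by rewrite ler_pXn2r ?nnegrE//; lra.
  have := sqr_ge0 (B - l * C); lra.
(* The squared norm grows like l ^ 2 and l is of the order of x, so this term is l times a constant
   multiple of x * f x, which the choice of x makes small. *)
have fb : f x * enorm (z0 + l *: v) ^+ 2 <= l * (eps / 2).
  apply: (@le_trans _ _ (`|f x| * (c2 + c3 * l ^+ 2))).
    apply: (le_trans (ler_norm _)); rewrite normrM ler_wpM2l//.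
    by rewrite ger0_norm ?sqr_ge0.
  apply: (@le_trans _ _ (`|f x| * x * (l * (c2 * e + c3 * 2 / e)))).
    rewrite -mulrA ler_wpM2l//.
    have : c2 <= x * (l * (c2 * e)).
      have le1 : 1 <= x * l * e.
        rewrite -mulrA le -(mulr1 1) ler_pM//; move: x0x; rewrite /x0; lra.
      have : c2 * 1 <= c2 * (x * l * e) by rewrite ler_wpM2l.
      lra.
    have : c3 * l ^+ 2 <= x * (l * (c3 * 2 / e)).
      have le1 : l <= 2 * x / e by rewrite ler_pdivlMr.
      have : c3 * l * l <= c3 * l * (2 * x / e) by rewrite ler_wpM2l// mulr_ge0// ltW.
      lra.
    lra.
  have cc : c * (c2 * e + c3 * 2 / e + 1) = eps / 2.
    by rewrite /c divfK// gt_eqF// ltr_wpDl.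
  rewrite -cc mulrCA ler_wpM2l ?(ltW l0)//.
  apply: (@le_trans _ _ (c * (c2 * e + c3 * 2 / e))).
    by rewrite ler_wpM2r// mulrC ltW.
  by rewrite ler_wpM2l ?(ltW c0)//; lra.
have bx : b * x + g * enorm (z0 + l *: v) - G y0 z0 <=
    l * (b * e + g * enorm v) + Q.
  have -> : x = l * e + y0 by rewrite le; ring.
  have : g * enorm (z0 + l *: v) <= g * (enorm z0 + l * enorm v) by rewrite ler_wpM2l.
  have : b * y0 <= `|b| * `|y0| by rewrite -normrM ler_norm.
  have := ler_norm (- G y0 z0); rewrite normrN /Q.
  lra.
have Ql : Q <= l * (eps / 2).
  have : e * Q <= e * (l * (eps / 2)).
    rewrite mulrA [e * l]mulrC le.
    have : 2 * e * Q / eps <= x - y0 by move: x0x; rewrite /x0; lra.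
    rewrite ler_pdivrMr//; lra.
  by rewrite ler_pM2l.
have : l * (G y1 z1 - G y0 z0) <= l * (b * e + g * enorm v + eps).
  have : l * G y1 z1 <= G x (z0 + l *: v) + (l - 1) * G y0 z0.
    apply: (le_trans (ler_wpM2l (ltW l0) Hc')).
    by rewrite mulrDr !mulrA divff ?gt_eqF// mul1r mulrBr mulr1 divff ?gt_eqF.
  lra.
by rewrite ler_pM2l.
Qed.

(** * Normal increments and bounded tilts *)

Section normal_law.
Context (R : realType).
Implicit Types (s x : R) (f : R -> R) (C : set R).

Lemma ge0_integral_normal_prob s (f : R -> \bar R) :
  measurable_fun setT f -> (forall x, 0 <= f x)%E ->
  (\int[normal_prob 0%R s]_x f x =
   \int[lebesgue_measure]_x (f x * (normal_pdf 0%R s x)%:E))%E.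
Proof.
move=> mf f0.
have dom := normal_prob_dominates 0 s.
rewrite -(Radon_Nikodym_SigmaFinite.change_of_variables dom)//=.
apply: ae_eq_integral => //.
- apply: emeasurable_funM => //; apply: measurable_int.
  exact: Radon_Nikodym_SigmaFinite.f_integrable.
- apply: emeasurable_funM => //; apply/measurable_EFinP; exact: measurable_normal_pdf.
- apply: ae_eqe_mul2l; apply: integral_ae_eq => //.
  + exact: Radon_Nikodym_SigmaFinite.f_integrable.
  + by apply/measurable_EFinP; exact: measurable_normal_pdf.
  + move=> E _ mE.
    by rewrite -Radon_Nikodym_SigmaFinite.f_integral.
Qed.

Lemma normal_pdfN s x : normal_pdf 0 s (- x) = normal_pdf 0 s x \/ s = 0.
Proof.
have [->|s0] := eqVneq s 0; first by right.
by left; rewrite !normal_pdfE// /normal_fun !subr0 sqrrN.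
Qed.

Lemma normal_probN s C : s != 0 -> measurable C ->
  normal_prob 0 s (-%R @^-1` C) = normal_prob 0 s C.
Proof.
move=> s0 mC; rewrite /normal_prob.
transitivity (\int[pushforward lebesgue_measure (-%R : measurableTypeR R -> measurableTypeR R)]_(x in C) (normal_pdf 0 s x)%:E)%E.
  rewrite ge0_integral_pushforward//.
  - by apply: eq_integral => x _ /=; case: (normal_pdfN s x) => [->//|/eqP]; rewrite (negbTE s0).
  - apply: measurable_funTS; apply/measurable_EFinP; exact: measurable_normal_pdf.
  - by move=> x _; rewrite lee_fin normal_pdf_ge0.
by apply: eq_measure_integral => A mA _; exact: lebesgue_measureN.
Qed.

(** The density is at most its peak 1 / (s sqrt (2 pi)), and sqrt (2 pi) is at least 2. *)
Lemma normal_prob_small_ball s : 0 < s ->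
  (normal_prob 0%R s `[(- (s / 2))%R, (s / 2)%R] <= (2^-1)%:E)%E.
Proof.
move=> s0; rewrite /normal_prob.
apply: (@le_trans _ _ (\int[lebesgue_measure]_(x in `[(- (s / 2))%R, (s / 2)%R]) (normal_peak s)%:E)%E).
  apply: ge0_le_integral => //.
  - by move=> x _; rewrite lee_fin normal_pdf_ge0.
  - apply: measurable_funTS; apply/measurable_EFinP; exact: measurable_normal_pdf.
  - by move=> x _; rewrite lee_fin normal_pdf_ub// gt_eqF.
rewrite integral_cst//= lebesgue_measure_itv/= lte_fin ifT; last by lra.
rewrite -EFinB -EFinM lee_fin.
have -> : s / 2 - - (s / 2) = s by lra.
rewrite /normal_peak mulrC ler_pdivrMr; last first.
  by rewrite sqrtr_gt0 pmulrn_lgt0// mulr_gt0 ?pi_gt0// exprn_gt0.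
have : Num.sqrt ((2 * s) ^+ 2) <= Num.sqrt (s ^+ 2 * pi *+ 2).
  rewrite ler_sqrt; last by rewrite mulrn_wge0// mulr_ge0 ?pi_ge0// sqr_ge0.
  rewrite exprMn -mulr_natr.
  have : s ^+ 2 * 2 <= s ^+ 2 * pi by rewrite ler_wpM2l ?sqr_ge0// pi_ge2.
  lra.
rewrite sqrtr_sqr ger0_norm; lra.
Qed.

Lemma sqr_le_4expR x : 0 <= x -> x ^+ 2 <= 4 * expR x.
Proof.
move=> x0.
have h : x / 2 <= expR (x / 2) by apply: le_trans (expR_ge1Dx _); lra.
have -> : x = x / 2 + x / 2 by lra.
rewrite expRD.
have : (x / 2) ^+ 2 <= expR (x / 2) ^+ 2 by rewrite ler_pXn2r ?nnegrE ?expR_ge0//; lra.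
lra.
Qed.

(** A Gaussian of twice the deviation absorbs the polynomial; any multiple of s ^ 4 will do. With y
    = x ^ 2 / (8 s ^ 2) the constant is 64 from x ^ 4 = 64 s ^ 4 y ^ 2, times 2 from the ratio of
    the peaks, times 4 from y ^ 2 <= 4 exp y. *)
Lemma normal_pdf_moment4 s x : 0 < s ->
  x ^+ 4 * normal_pdf 0 s x <= 512 * s ^+ 4 * normal_pdf 0 (2 * s) x.
Proof.
move=> s0; rewrite !normal_pdfE ?gt_eqF ?mulr_gt0// /normal_fun !subr0.
have -> : normal_peak s = 2 * normal_peak (2 * s).
  rewrite /normal_peak exprMn.
  have -> : (2 ^+ 2 * s ^+ 2 * pi) *+ 2 = 2 ^+ 2 * (s ^+ 2 * pi *+ 2) :> R by ring.
  rewrite sqrtrM ?sqr_ge0// sqrtr_sqr ger0_norm// invfM mulrA divff ?mul1r//.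
set k := normal_peak _.
have k0 : 0 <= k by exact: normal_peak_ge0.
pose y := x ^+ 2 / (8 * s ^+ 2).
have y0 : 0 <= y by rewrite divr_ge0 ?sqr_ge0// mulr_ge0// sqr_ge0.
have sn : s != 0 by rewrite gt_eqF.
have -> : - x ^+ 2 / (s ^+ 2 *+ 2) = - (4 * y).
  by rewrite /y -[s ^+ 2 *+ 2]mulr_natr; field; rewrite sn.
have -> : - x ^+ 2 / ((2 * s) ^+ 2 *+ 2) = - y.
  by rewrite /y -[(2 * s) ^+ 2 *+ 2]mulr_natr; field; rewrite sn.
have -> : x ^+ 4 = 64 * s ^+ 4 * y ^+ 2 by rewrite /y; field; rewrite sn.
have h1 : y ^+ 2 * expR (- (4 * y)) <= 4 * expR (- y).
  apply: (@le_trans _ _ (4 * expR y * expR (- (4 * y)))).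
    by rewrite ler_wpM2r ?expR_ge0// sqr_le_4expR.
  by rewrite -mulrA -expRD ler_wpM2l// ler_expR; lra.
have -> : 64 * s ^+ 4 * y ^+ 2 * (2 * k * expR (- (4 * y))) =
   (128 * s ^+ 4 * k) * (y ^+ 2 * expR (- (4 * y))) by ring.
have -> : 512 * s ^+ 4 * (k * expR (- y)) = (128 * s ^+ 4 * k) * (4 * expR (- y)) by ring.
by rewrite ler_wpM2l// mulr_ge0// mulr_ge0// exprn_even_ge0.
Qed.

Lemma normal_prob_moment4 s : 0 < s ->
  (\int[normal_prob 0%R s]_x (x ^+ 4)%:E <= (512 * s ^+ 4)%:E)%E.
Proof.
move=> s0; rewrite ge0_integral_normal_prob//; last 2 first.
- by apply/measurable_EFinP; exact: exprn_measurable.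
- by move=> x; rewrite lee_fin exprn_even_ge0.
apply: (@le_trans _ _ (\int[lebesgue_measure]_x ((512 * s ^+ 4)%:E * (normal_pdf 0 (2 * s) x)%:E))%E).
  apply: ge0_le_integral => //.
  - by move=> x _; rewrite -EFinM lee_fin mulr_ge0 ?normal_pdf_ge0// exprn_even_ge0.
  - apply: emeasurable_funM; apply/measurable_EFinP; first exact: exprn_measurable.
    exact: measurable_normal_pdf.
  - apply: emeasurable_funM; apply/measurable_EFinP => //; exact: measurable_normal_pdf.
  - by move=> x _; rewrite -!EFinM lee_fin normal_pdf_moment4.
rewrite integralZl//; last exact: integrable_normal_pdf.
by rewrite integral_normal_pdf mule1.
Qed.

End normal_law.

(** * Expectation of a product of independent variables *)

Section expectM.
Context (disp : measure_display) (Omega : measurableType disp) (R : realType).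
Context (P : probability Omega R).

(* The joint law of two independent variables is a product measure. *)
Lemma expect_prod (S U : Omega -> R) :
  P.-integrable setT (EFin \o S) -> P.-integrable setT (EFin \o U) ->
  (forall B C, measurable B -> measurable C ->
     P (S @^-1` B `&` U @^-1` C) = (P (S @^-1` B) * P (U @^-1` C))%E) ->
  P.-integrable setT (EFin \o (S \* U)) /\
  \int[P]_w (S w * U w) = (\int[P]_w S w) * (\int[P]_w U w).
Proof.
move=> iS iU indep.
have mS : measurable_fun setT S by apply/measurable_EFinP; exact: measurable_int iS.
have mU : measurable_fun setT U by apply/measurable_EFinP; exact: measurable_int iU.
pose X : {mfun Omega >-> R} := HB.pack S (isMeasurableFun.Build _ _ _ _ _ mS).
pose V : {mfun Omega >-> R} := HB.pack U (isMeasurableFun.Build _ _ _ _ _ mU).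
pose phi w := (S w, U w).
have mphi : measurable_fun setT phi by exact: measurable_fun_pair.
pose m1 := distribution P X; pose m2 := distribution P V.
have joint A : measurable A -> (m1 \x m2)%E A = pushforward P phi A.
  apply: (@product_measure_unique _ _ _ _ _ m1 m2) => B C mB mC.
  by rewrite /pushforward/= -indep//.
pose f (z : R * R) : \bar R := (z.1 * z.2)%:E.
have mf : measurable_fun setT f.
  apply/measurable_EFinP; apply: measurable_funM; [exact: measurable_fst|exact: measurable_snd].
have law1 (g : R -> \bar R) : measurable_fun setT g -> (forall x, 0 <= g x)%E ->
    (\int[m1]_x g x = \int[P]_w g (S w))%E.
  by move=> mg g0; rewrite /m1 /distribution ge0_integral_pushforward.
have law2 (g : R -> \bar R) : measurable_fun setT g -> (forall x, 0 <= g x)%E ->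
    (\int[m2]_x g x = \int[P]_w g (U w))%E.
  by move=> mg g0; rewrite /m2 /distribution ge0_integral_pushforward.
have fS : (\int[P]_w `|(S w)%:E| < +oo)%E by case/integrableP: iS.
have fU : (\int[P]_w `|(U w)%:E| < +oo)%E by case/integrableP: iU.
have mabs : measurable_fun setT (fun x : R => `|x%:E|%E).
  by apply: measurableT_comp.
have if_ : ((m1 \x m2)%E).-integrable setT f.
  apply/integrable12ltyP => //.
  have inner x : (\int[m2]_y `|f (x, y)| = `|x|%:E * \int[m2]_y `|y|%:E)%E.
    rewrite -ge0_integralZl ?lee_fin//.
    by apply: eq_integral => y _; rewrite /f/= normrM EFinM.
  rewrite (eq_integral _ _ (fun x _ => inner x)).
  rewrite ge0_integralZr//; last by apply: integral_ge0.
  rewrite (law1 (fun x => `|x|%:E))//.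
  rewrite (law2 (fun x => `|x|%:E))//.
  by rewrite lte_mul_pinfty//; [exact: integral_ge0|rewrite ge0_fin_numE// integral_ge0].
have iSU : P.-integrable setT (EFin \o (S \* U)).
  apply/integrableP; split.
    by apply/measurable_EFinP; exact: measurable_funM.
  case/integrableP: if_ => _; rewrite (eq_measure_integral (pushforward P phi)); last first.
    by move=> A mA _; exact: joint.
  rewrite ge0_integral_pushforward//.
  exact: measurableT_comp.
split=> //.
have iX : m1.-integrable setT EFin.
  apply/integrableP; split; first exact/measurable_EFinP.
  by rewrite (law1 (fun x => `|x%:E|%E)).
have iV : m2.-integrable setT EFin.
  apply/integrableP; split; first exact/measurable_EFinP.
  by rewrite (law2 (fun x => `|x%:E|%E)).
rewrite /Rintegral -fineM; last 2 first.
- exact: integrable_fin_num.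
- exact: integrable_fin_num.
congr fine.
have -> : (\int[P]_w (S w)%:E = \int[m1]_x x%:E)%E by rewrite /m1 /distribution integral_pushforward.
have -> : (\int[P]_w (U w)%:E = \int[m2]_x x%:E)%E by rewrite /m2 /distribution integral_pushforward.
transitivity (\int[pushforward P phi]_z f z)%E.
  by rewrite integral_pushforward.
rewrite (eq_measure_integral (m1 \x m2)%E); last by move=> A mA _; exact/esym/joint.
rewrite -integral12_prod_meas1//.
have inner x : (\int[m2]_y f (x, y) = x%:E * \int[m2]_y y%:E)%E.
  by rewrite -integralZl//; apply: eq_integral => y _; rewrite /f/= EFinM.
rewrite (eq_integral _ _ (fun x _ => inner x)).
rewrite /= -[X in (\int[_]_x (_ * X))%E]fineK; last exact: integrable_fin_num.
by rewrite integralZr// fineK//; exact: integrable_fin_num.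
Qed.

End expectM.

(** * Measurability for a sub-sigma-algebra, integrability of real variables *)

Definition meas_wrt (Omega : pointedType) (FF : set (set Omega)) (R : realType)
    (S : Omega -> R) : Prop :=
  measurable_fun [set: g_sigma_algebraType FF] (S : g_sigma_algebraType FF -> R).

Section meas_wrt.
Context (disp : measure_display) (Omega : measurableType disp) (R : realType).
Context (FF : set (set Omega)).
Hypothesis subF : <<s FF>> `<=` measurable.

Lemma meas_wrt_sub (S : Omega -> R) : meas_wrt FF S -> measurable_fun setT S.
Proof. by move=> mS _ B mB; apply: subF; exact: mS. Qed.

Lemma meas_wrt_preimage (S : Omega -> R) B : meas_wrt FF S -> measurable B ->
  <<s FF>> (S @^-1` B).
Proof. by move=> mS mB; rewrite -[_ @^-1` _]setTI; exact: mS. Qed.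

End meas_wrt.

Section meas_wrt_algebra.
Context (Omega : pointedType) (FF : set (set Omega)) (R : realType).
Implicit Types S T : Omega -> R.

Lemma meas_wrt_cst (r : R) : meas_wrt FF (fun _ => r).
Proof. exact: measurable_cst. Qed.

Lemma meas_wrt_comp S (u : R -> R) :
  measurable_fun setT u -> meas_wrt FF S -> meas_wrt FF (fun w => u (S w)).
Proof. by move=> mu mS; exact: (measurableT_comp mu mS). Qed.

Lemma meas_wrtD S T : meas_wrt FF S -> meas_wrt FF T ->
  meas_wrt FF (fun w => S w + T w).
Proof. by move=> mS mT; exact: (measurable_funD mS mT). Qed.

Lemma meas_wrtB S T : meas_wrt FF S -> meas_wrt FF T ->
  meas_wrt FF (fun w => S w - T w).
Proof. by move=> mS mT; exact: (measurable_funB mS mT). Qed.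

Lemma meas_wrtM S T : meas_wrt FF S -> meas_wrt FF T ->
  meas_wrt FF (fun w => S w * T w).
Proof. by move=> mS mT; exact: (measurable_funM mS mT). Qed.

Lemma meas_wrt_sum (I : Type) (r : seq I) (S : I -> Omega -> R) :
  (forall i, meas_wrt FF (S i)) -> meas_wrt FF (fun w => \sum_(i <- r) S i w).
Proof. by move=> mS; apply: measurable_sum => i; exact: mS. Qed.

Lemma meas_wrt_mono (GG : set (set Omega)) S : <<s FF>> `<=` <<s GG>> ->
  meas_wrt FF S -> meas_wrt GG S.
Proof. by move=> FG mS _ B mB; apply: FG; exact: mS. Qed.

End meas_wrt_algebra.

Section integrable_aux.
Context (disp : measure_display) (Omega : measurableType disp) (R : realType).
Context (P : probability Omega R).
Implicit Types S T : Omega -> R.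

Lemma integrable_bndM S T M : measurable_fun setT S -> (forall w, `|S w| <= M) ->
  P.-integrable setT (EFin \o T) -> P.-integrable setT (EFin \o (S \* T)).
Proof.
move=> mS SM iT.
have mT : measurable_fun setT T by apply/measurable_EFinP; exact: measurable_int iT.
have M0 : 0 <= M by exact: le_trans (normr_ge0 _) (SM point).
apply: (le_integrable measurableT _ _ (integrableZl measurableT M iT)).
  by apply/measurable_EFinP; exact: measurable_funM.
move=> w _ /=; rewrite lee_fin !normrM (ger0_norm M0).
by rewrite ler_wpM2r.
Qed.

Lemma le_integrableR S T : measurable_fun setT S -> (forall w, `|S w| <= T w) ->
  P.-integrable setT (EFin \o T) -> P.-integrable setT (EFin \o S).
Proof.
move=> mS ST iT; apply: (le_integrable measurableT _ _ iT).
  exact/measurable_EFinP.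
by move=> w _ /=; rewrite lee_fin (le_trans (ST w))// ler_norm.
Qed.

Lemma integrable_bnd S M : measurable_fun setT S -> (forall w, `|S w| <= M) ->
  P.-integrable setT (EFin \o S).
Proof.
move=> mS SM; apply: (le_integrableR mS SM).
exact: (@finite_measure_integrable_cst _ _ _ P).
Qed.

Lemma integrable_cstR (c : R) : P.-integrable setT (EFin \o (fun _ => c)).
Proof. exact: (@finite_measure_integrable_cst _ _ _ P). Qed.

Lemma expect_cst (r : R) : \int[P]_w r = r.
Proof. by rewrite /Rintegral integral_cst//= probability_setT mule1. Qed.

Lemma integrableDR S T :
  P.-integrable setT (EFin \o S) -> P.-integrable setT (EFin \o T) ->
  P.-integrable setT (EFin \o (fun w => S w + T w)).
Proof. by move=> iS iT; exact: (integrableD measurableT iS iT). Qed.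

Lemma integrableBR S T :
  P.-integrable setT (EFin \o S) -> P.-integrable setT (EFin \o T) ->
  P.-integrable setT (EFin \o (fun w => S w - T w)).
Proof. by move=> iS iT; exact: (integrableB measurableT iS iT). Qed.

Lemma integrableZR (c : R) S : P.-integrable setT (EFin \o S) ->
  P.-integrable setT (EFin \o (fun w => c * S w)).
Proof. by move=> iS; exact: (integrableZl measurableT c iS). Qed.

Lemma integrable_meas S : P.-integrable setT (EFin \o S) -> measurable_fun setT S.
Proof. by move=> iS; apply/measurable_EFinP; exact: measurable_int iS. Qed.

Lemma integrable_sumR (I : finType) (S : I -> Omega -> R) :
  (forall i, P.-integrable setT (EFin \o S i)) ->
  P.-integrable setT (EFin \o (fun w => \sum_i S i w)).
Proof.
move=> iS.
have -> : (EFin \o (fun w => \sum_i S i w)) = (fun w => (\sum_i (S i w)%:E)%E).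
  by apply/funext => w /=; rewrite sumEFin.
by apply: integrable_sum => // i _; exact: iS.
Qed.

Lemma expect_sum (I : finType) (S : I -> Omega -> R) :
  (forall i, P.-integrable setT (EFin \o S i)) ->
  \int[P]_w (\sum_i S i w) = \sum_i \int[P]_w S i w.
Proof.
move=> iS; rewrite /Rintegral.
under eq_integral do rewrite -sumEFin.
rewrite integral_sum//= sum_fine// => i _.
exact: integrable_fin_num (iS i).
Qed.

End integrable_aux.

Lemma measurable_sg (R : realType) (D : set R) : measurable_fun D (Num.sg : R -> R).
Proof.
have -> : (Num.sg : R -> R) = (fun x => \1_[set y : R | 0 < y] x - \1_[set y : R | y < 0] x).
  apply/funext => x; rewrite !indicE; case: sgrP => [->|x0|x0].
  - by rewrite !memNset//= ?ltxx ?subrr//; apply/negP; rewrite ltxx.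
  - rewrite mem_set//= memNset ?subr0//=; apply/negP; rewrite -leNgt ltW//.
  - rewrite memNset ?mem_set//= ?sub0r//; apply/negP; rewrite -leNgt ltW//.
apply: measurable_funTS; apply: measurable_funB; apply: measurable_indic.
- by rewrite -set_itvoy; exact: measurable_itv.
- by rewrite -set_itvNyo; exact: measurable_itv.
Qed.

(** * One Gaussian step and its tilt *)

Section gaussian_step.
Context (disp : measure_display) (Omega : measurableType disp) (R : realType).
Context (P : probability Omega R) (FF : set (set Omega)) (d : nat) (dt : R).
Context (U : 'I_d -> Omega -> R).
Hypothesis subF : <<s FF>> `<=` measurable.
Hypothesis dt0 : 0 < dt.
Hypothesis mU : forall i, measurable_fun setT (U i).
Hypothesis indU : forall (A : set Omega) (B : 'I_d -> set R),
  <<s FF>> A -> (forall i, measurable (B i)) ->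
  P (A `&` [set w | forall i, B i (U i w)]) =
  (P A * \prod_(i < d) normal_prob 0%R (Num.sqrt dt) (B i))%E.

Let sd := Num.sqrt dt.
Let sd0 : 0 < sd. Proof. by rewrite sqrtr_gt0. Qed.
Let N := normal_prob 0 sd.

Lemma indep_coord i A C : <<s FF>> A -> measurable C ->
  P (A `&` U i @^-1` C) = (P A * N C)%E.
Proof.
move=> FA mC; pose B j := if j == i then C else setT.
have -> : U i @^-1` C = [set w | forall j, B j (U j w)].
  apply/seteqP; split => w /=; last by move=> /(_ i); rewrite /B eqxx.
  by move=> UC j; rewrite /B; case: eqP => [->|].
rewrite indU//; last by move=> j; rewrite /B; case: eqP.
rewrite (bigD1 i)//= /B eqxx big1 ?mule1// => j /negbTE ->.
exact: probability_setT.
Qed.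

Lemma indep_coord2 i j A B C : i != j -> <<s FF>> A ->
  measurable B -> measurable C ->
  P (A `&` U i @^-1` B `&` U j @^-1` C) = (P (A `&` U i @^-1` B) * N C)%E.
Proof.
move=> ij FA mB mC; rewrite (indep_coord i FA mB).
pose D k := if k == i then B else if k == j then C else setT.
have -> : A `&` U i @^-1` B `&` U j @^-1` C = A `&` [set w | forall k, D k (U k w)].
  rewrite -setIA; congr (_ `&` _); apply/seteqP; split => w /=.
    by move=> [UB UC] k; rewrite /D; case: eqP => [->//|_]; case: eqP => [->|].
  move=> h; split; first by move: (h i); rewrite /D eqxx.
  by move: (h j); rewrite /D eq_sym (negbTE ij) eqxx.
rewrite indU//; last by move=> k; rewrite /D; case: eqP => // _; case: eqP.
rewrite (bigD1 i)//= (bigD1 j)/=; last by rewrite eq_sym.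
rewrite /D eqxx [j == i]eq_sym (negbTE ij) eqxx big1 ?mule1 ?muleA//.
by move=> k /andP[/negbTE -> /negbTE ->]; exact: probability_setT.
Qed.

Lemma law_coord i C : measurable C -> P (U i @^-1` C) = N C.
Proof.
move=> mC; rewrite -[U i @^-1` C]setTI indep_coord//.
  by rewrite probability_setT mul1e.
by have [h0 hC _] := smallest_sigma_algebra setT FF; have := hC _ h0; rewrite setD0.
Qed.

Lemma ge0_expect_coord i (f : R -> \bar R) : measurable_fun setT f ->
  (forall x, 0 <= f x)%E -> (\int[P]_w f (U i w) = \int[N]_x f x)%E.
Proof.
move=> mf f0; rewrite (eq_measure_integral (pushforward P (U i : _ -> measurableTypeR R))).
- exact: mU.
- by move=> mUi; rewrite ge0_integral_pushforward.
- by move=> mUi A mA _; apply/esym; exact: (law_coord i mA).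
Qed.

(** [U i] and its opposite have the same law, so the expectation equals its own opposite. *)
Lemma expect_odd i (u : R -> R) : measurable_fun setT u ->
  (forall x, u (- x) = - u x) -> P.-integrable setT (EFin \o (u \o U i)) ->
  \int[P]_w u (U i w) = 0.
Proof.
move=> mu uN iu.
have mNU : measurable_fun setT (fun w => - U i w) by exact: measurableT_comp.
have iuN : P.-integrable setT (EFin \o (u \o (fun w => - U i w))).
  have := integrableN iu; apply: eq_integrable => // w _ /=.
  by rewrite uN.
suff : \int[P]_w u (U i w) = \int[P]_w u (- U i w).
  have -> : \int[P]_w u (- U i w) = - \int[P]_w u (U i w).
    under eq_Rintegral do rewrite uN -mulN1r.
    by rewrite RintegralZl// mulN1r.
  lra.
rewrite /Rintegral; congr fine.
have mue : measurable_fun setT (EFin \o u) by exact/measurable_EFinP.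
transitivity (\int[pushforward P (U i : _ -> measurableTypeR R)]_x (u x)%:E)%E.
  by rewrite integral_pushforward//; exact: mU.
rewrite (eq_measure_integral (pushforward P ((fun w => - U i w) : _ -> measurableTypeR R))).
- by rewrite integral_pushforward//; exact: mNU.
- exact: mU.
move=> m A mA _; rewrite /pushforward.
have mNA : measurable (-%R @^-1` A : set R).
  by rewrite -[_ @^-1` _]setTI; exact: oppr_measurable.
transitivity (N A); first exact: (law_coord i mA).
rewrite -[LHS](normal_probN (lt0r_neq0 sd0) mA).
by apply/esym; exact: (law_coord i mNA).
Qed.

Lemma integrable_coord4 i : P.-integrable setT (EFin \o (fun w => U i w ^+ 4)).
Proof.
apply/integrableP; split.
  by apply/measurable_EFinP; exact: measurable_funX.
under eq_integral do rewrite /= ger0_norm ?exprn_even_ge0//.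
rewrite (ge0_expect_coord i (f := fun x => (x ^+ 4)%:E)).
- by apply: le_lt_trans (normal_prob_moment4 sd0) _; rewrite ltry.
- by apply/measurable_EFinP; exact: exprn_measurable.
- by move=> x; rewrite lee_fin exprn_even_ge0.
Qed.

Lemma expect_coord4 i : \int[P]_w (U i w ^+ 4) <= 512 * dt ^+ 2.
Proof.
rewrite -lee_fin /Rintegral fineK; last exact: integrable_fin_num (integrable_coord4 i).
rewrite (ge0_expect_coord i (f := fun x => (x ^+ 4)%:E)).
- apply: le_trans (normal_prob_moment4 sd0) _.
  have -> : sd ^+ 4 = dt ^+ 2 by rewrite -[4%N]/(2 * 2)%N exprM sqr_sqrtr ?ltW.
  by [].
- by apply/measurable_EFinP; exact: exprn_measurable.
- by move=> x; rewrite lee_fin exprn_even_ge0.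
Qed.

Lemma ler_norm_1D4 (x : R) : `|x| <= 1 + x ^+ 4.
Proof.
have [x1|x1] := leP `|x| 1.
  by apply: (le_trans x1); rewrite lerDl exprn_even_ge0.
rewrite -[x ^+ 4](ger0_norm (exprn_even_ge0 _ _))// normrX.
apply: (@le_trans _ _ (`|x| ^+ 4)); last by rewrite lerDr.
by rewrite -{1}[`|x|]expr1 ler_eXn2l ?ltW.
Qed.

Lemma integrable_coord i : P.-integrable setT (EFin \o U i).
Proof.
apply: (le_integrableR (mU i) (fun w => ler_norm_1D4 (U i w))).
by apply: integrableDR (integrable_coord4 i); exact: integrable_cstR.
Qed.

(** With probability at least 1/2 the increment exceeds half its standard deviation in absolute
    value. This 1/4 is the origin of the relation c = 4 gam further on. *)
Lemma expect_abs_coord i : sd / 4 <= \int[P]_w `|U i w|.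
Proof.
have iU : P.-integrable setT (EFin \o (fun w => `|U i w|)).
  exact: integrable_abse (integrable_coord i).
pose D := U i @^-1` `[- (sd / 2), sd / 2]%classic.
have mD : measurable D by rewrite -[D]setTI; apply: mU => //; exact: measurable_itv.
have PD : (P D <= (2^-1)%:E)%E.
  by rewrite /D law_coord ?normal_prob_small_ball//; exact: measurable_itv.
have PDC : (2^-1%:E <= P (~` D))%E.
  rewrite probability_setC// leeBrDr ?fin_num_measure//.
  by apply: (@le_trans _ _ (2^-1%:E + 2^-1%:E)%E); [exact: leeD|rewrite -EFinD lee_fin; lra].
rewrite -lee_fin /Rintegral fineK; last exact: integrable_fin_num iU.
apply: (@le_trans _ _ (\int[P]_(w in ~` D) `|U i w|%:E)%E); last first.
  apply: ge0_subset_integral => //; first exact: measurableC.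
  by apply/measurable_EFinP; exact: measurableT_comp.
apply: (@le_trans _ _ (\int[P]_(w in ~` D) (sd / 2)%:E)%E).
  rewrite integral_cst//=; last exact: measurableC.
  apply: (@le_trans _ _ ((sd / 2)%:E * 2^-1%:E)%E).
    by rewrite -EFinM lee_fin; lra.
  by apply: lee_wpmul2l => //; rewrite lee_fin divr_ge0// ltW.
apply: ge0_le_integral => //; first exact: measurableC.
- by move=> w _; rewrite lee_fin divr_ge0// ltW.
- by apply: measurable_funTS; apply/measurable_EFinP; exact: measurableT_comp.
- move=> w; rewrite /D/= in_itv/= lee_fin => /negP; rewrite negb_and -!ltNge.
  move=> /orP[h|h].
    by rewrite -normrN; apply: le_trans (ler_norm _); lra.
  by apply: ltW (lt_le_trans h (ler_norm _)).
Qed.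

Lemma expectM_coord i (S : Omega -> R) (u : R -> R) : meas_wrt FF S ->
  measurable_fun setT u ->
  P.-integrable setT (EFin \o S) -> P.-integrable setT (EFin \o (u \o U i)) ->
  P.-integrable setT (EFin \o (S \* (u \o U i))) /\
  \int[P]_w (S w * u (U i w)) = (\int[P]_w S w) * \int[P]_w u (U i w).
Proof.
move=> mS mu iS iu; apply: expect_prod => // B C mB mC.
have muC : measurable (u @^-1` C) by rewrite -[_ @^-1` _]setTI; exact: mu.
rewrite -[(u \o U i) @^-1` C]/(U i @^-1` (u @^-1` C)).
by rewrite indep_coord// ?law_coord//; exact: meas_wrt_preimage.
Qed.

Lemma integrable_sg_coord i : P.-integrable setT (EFin \o (Num.sg \o U i)).
Proof.
apply: (@integrable_bnd _ _ _ _ _ 1); first by apply: measurableT_comp; [exact: measurable_sg|exact: mU].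
by move=> w /=; rewrite normr_sg; case: (_ != _).
Qed.

Lemma expect_sg i (S : Omega -> R) : meas_wrt FF S ->
  P.-integrable setT (EFin \o S) -> \int[P]_w (S w * Num.sg (U i w)) = 0.
Proof.
move=> mS iS; have [_ ->] := expectM_coord mS (@measurable_sg R setT) iS (integrable_sg_coord i).
by rewrite (@expect_odd i Num.sg) ?mulr0//;
  [exact: measurable_sg|exact: sgrN|exact: integrable_sg_coord].
Qed.

Lemma expect_linear i (S : Omega -> R) : meas_wrt FF S ->
  P.-integrable setT (EFin \o S) -> \int[P]_w (S w * U i w) = 0.
Proof.
move=> mS iS; have [_ ->] := @expectM_coord i S id mS (@measurable_id _ _ _) iS (integrable_coord i).
by rewrite (@expect_odd i id) ?mulr0//; exact: integrable_coord.
Qed.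

Lemma integrable_sg_lin i j (S : Omega -> R) : meas_wrt FF S ->
  P.-integrable setT (EFin \o S) ->
  P.-integrable setT (EFin \o (fun w => S w * (Num.sg (U i w) * U j w))).
Proof.
move=> mS iS; have [+ _] := @expectM_coord j S id mS (@measurable_id _ _ _) iS (integrable_coord j).
move=> iSU.
have msgU : measurable_fun setT (Num.sg \o U i).
  by apply: measurableT_comp; [exact: measurable_sg|exact: mU].
have sgU1 w : `|(Num.sg \o U i) w| <= 1 by rewrite /= normr_sg; case: (_ != _).
have := integrable_bndM msgU sgU1 iSU; apply: eq_integrable => //.
by move=> w _ /=; rewrite mulrCA.
Qed.

(** These are the cross terms between distinct coordinates in the tilted mean of an increment; that
    they vanish leaves only the diagonal. *)
Lemma expect_sg_lin i j (S : Omega -> R) : i != j -> meas_wrt FF S ->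
  P.-integrable setT (EFin \o S) ->
  \int[P]_w (S w * (Num.sg (U i w) * U j w)) = 0.
Proof.
move=> ij mS iS; pose T w := S w * Num.sg (U i w).
have iT : P.-integrable setT (EFin \o T).
  by have [+ _] := expectM_coord mS (@measurable_sg R setT) iS (integrable_sg_coord i).
have mT : measurable_fun setT T by apply/measurable_EFinP; exact: measurable_int iT.
have [] := @expect_prod _ _ _ P T (U j) iT (integrable_coord j).
  move=> B C mB mC; rewrite law_coord//.
  (* [T] is not measurable for the past, as it involves [U i]. Cutting along the sign of [U i] turns
     each piece into a past event intersected with an event of [U i], to which [indep_coord2]
     applies. *)
  have split3 : T @^-1` B = (S @^-1` B `&` U i @^-1` [set x | 0 < x]) `|`
     ((fun w => - S w) @^-1` B `&` U i @^-1` [set x | x < 0]) `|`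
     ((cst 0 : Omega -> R) @^-1` B `&` U i @^-1` [set 0]).
    apply/seteqP; split => w /=; rewrite /T.
      case: sgrP => [->|u0|u0]; rewrite ?mulr0 ?mulr1 ?mulrN1 => h.
      - by right.
      - by left; left.
      - by left; right.
    move=> [[[h u0]|[h u0]]|[h ->]].
    - by rewrite gtr0_sg// mulr1.
    - by rewrite ltr0_sg// mulrN1.
    - by rewrite sgr0 mulr0.
  have mp : measurable [set x : R | 0 < x] by rewrite -set_itvoy; exact: measurable_itv.
  have mn : measurable [set x : R | x < 0] by rewrite -set_itvNyo; exact: measurable_itv.
  have m0 : measurable [set (0 : R)] by exact: measurable_set1.
  have F1 : <<s FF>> (S @^-1` B) by exact: meas_wrt_preimage.
  have F2 : <<s FF>> ((fun w => - S w) @^-1` B).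
    by apply: meas_wrt_preimage => //; exact: measurableT_comp.
  have F3 : <<s FF>> ((cst 0 : Omega -> R) @^-1` B).
    by apply: meas_wrt_preimage => //; exact: measurable_cst.
  have mpre D : measurable D -> measurable (U i @^-1` D).
    by move=> mD; rewrite -[_ @^-1` _]setTI; exact: mU.
  have mUC : measurable (U j @^-1` C) by rewrite -[_ @^-1` _]setTI; exact: mU.
  rewrite split3 !setIUl.
  rewrite !measureU//; do ?[apply: measurableI|apply: measurableU];
    do ?[exact: subF|exact: mpre|by []].
  - have D3 (x y z a b c n : \bar R) : (0 <= a -> 0 <= b -> 0 <= c ->
      x = a * n -> y = b * n -> z = c * n -> x + y + z = (a + b + c) * n)%E.
      by move=> ? ? ? -> -> ->; rewrite !ge0_muleDl ?adde_ge0.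
    by apply: D3 (indep_coord2 ij F1 mp mC) (indep_coord2 ij F2 mn mC) (indep_coord2 ij F3 m0 mC).
  - by apply/seteqP; split => w //= ; move=> [[_ a] [_ b]]; move: a; rewrite ltNge (ltW b).
  - by apply/seteqP; split => w //= ; move=> [[[_ a]|[_ a]] [_ b]]; move: a; rewrite b ltxx.
  - by apply/seteqP; split => w //= ; move=> [[[_ a] _] [[_ b] _]]; move: a; rewrite ltNge (ltW b).
  - by apply/seteqP; split => w //= ; move=> [[[[_ a] _]|[[_ a] _]] [[_ b] _]]; move: a; rewrite b ltxx.
move=> _; rewrite (@expect_odd j id) ?mulr0//; last exact: integrable_coord.
move=> <-; apply: eq_Rintegral => w _; by rewrite mulrA.
Qed.

Context (eta : 'I_d -> Omega -> R) (c M : R).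
Hypothesis meta : forall i, meas_wrt FF (eta i).
Hypothesis etaM : forall i w, `|eta i w| <= M.
Hypothesis c0 : 0 <= c.

(* The factor [1 + tilt w] is a bounded substitute for the one-step Girsanov
   density: weighting by it gives each increment [U i] a drift in the direction
   of the sign of [eta i]. *)
Definition tilt w : R :=
  c * Num.sqrt dt * \sum_(i < d) Num.sg (eta i w) * Num.sg (U i w).

Let mtilt : measurable_fun setT tilt.
Proof.
apply: measurable_funM => //; apply: measurable_sum => i; apply: measurable_funM.
  by apply: measurableT_comp; [exact: measurable_sg|exact: meas_wrt_sub (meta i)].
by apply: measurableT_comp; [exact: measurable_sg|exact: mU].
Qed.

Lemma tilt_bound w : `|tilt w| <= c * Num.sqrt dt * d%:R.
Proof.
rewrite /tilt normrM ger0_norm ?mulr_ge0 ?sqrtr_ge0//.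
rewrite ler_wpM2l ?mulr_ge0 ?sqrtr_ge0//.
apply: (le_trans (ler_norm_sum _ _ _)).
rewrite -[X in _ <= X%:R](card_ord d) -sumr_const ler_sum// => i _.
by rewrite normrM !normr_sg; do 2 case: (_ != _); rewrite ?mulr0 ?mul0r ?mulr1.
Qed.

Let msgeta i (S : Omega -> R) : meas_wrt FF S ->
  meas_wrt FF (fun w => S w * Num.sg (eta i w)).
Proof.
by move=> mS; apply: meas_wrtM => //; apply: meas_wrt_comp; [exact: measurable_sg|exact: meta].
Qed.

Let isgeta i (S : Omega -> R) : P.-integrable setT (EFin \o S) ->
  P.-integrable setT (EFin \o (fun w => S w * Num.sg (eta i w))).
Proof.
move=> iS.
have m1 : measurable_fun setT (Num.sg \o eta i).
  by apply: measurableT_comp; [exact: measurable_sg|exact: meas_wrt_sub (meta i)].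
have b1 w : `|(Num.sg \o eta i) w| <= 1 by rewrite /= normr_sg; case: (_ != _).
have := integrable_bndM m1 b1 iS; apply: eq_integrable => // w _ /=.
by rewrite mulrC.
Qed.

Lemma integrable_tilt (S : Omega -> R) : P.-integrable setT (EFin \o S) ->
  P.-integrable setT (EFin \o (fun w => S w * (1 + tilt w))).
Proof.
move=> iS.
have b1 w : `|1 + tilt w| <= 1 + c * Num.sqrt dt * d%:R.
  by apply: (le_trans (ler_normD _ _)); rewrite normr1 lerD2l tilt_bound.
have m1 : measurable_fun setT (fun w => 1 + tilt w) by exact: measurable_funD.
have := integrable_bndM m1 b1 iS; apply: eq_integrable => // w _ /=.
by rewrite mulrC.
Qed.

(** The sign of each [U i] is centred and independent of the past, so [1 + tilt] has conditional
    mean 1, as a one-step density must. *)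
Lemma expect_tilt (S : Omega -> R) : meas_wrt FF S ->
  P.-integrable setT (EFin \o S) ->
  \int[P]_w (S w * (1 + tilt w)) = \int[P]_w S w.
Proof.
move=> mS iS.
have iT i : P.-integrable setT (EFin \o (fun w => (S w * Num.sg (eta i w)) * Num.sg (U i w))).
  have [+ _] := expectM_coord (i := i) (msgeta i mS) (@measurable_sg R setT) (isgeta i iS)
    (integrable_sg_coord i).
  by [].
transitivity (\int[P]_w (S w + c * Num.sqrt dt *
    \sum_(i < d) (S w * Num.sg (eta i w)) * Num.sg (U i w))).
  apply: eq_Rintegral => w _; rewrite mulrDr mulr1 /tilt mulrCA; congr (_ + _ * _).
  by rewrite mulr_sumr; apply: eq_bigr => i _; rewrite mulrA.
rewrite RintegralD//; last first.
  by apply: integrableZR; exact: integrable_sumR.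
rewrite RintegralZl//; last exact: integrable_sumR.
rewrite expect_sum// big1 ?mulr0 ?addr0// => i _.
by rewrite (expect_sg )//; [exact: msgeta|exact: isgeta].
Qed.

Lemma integrable_tilt_lin (S : Omega -> R) B :
  meas_wrt FF S -> (forall w, `|S w| <= B) ->
  P.-integrable setT (EFin \o (fun w => S w * ((1 + tilt w) * \sum_(j < d) eta j w * U j w))).
Proof.
move=> mS SB.
have B0 : 0 <= B by apply: le_trans (SB point).
have M0 (i : 'I_d) : 0 <= M by apply: le_trans (etaM i point).
have iT j : P.-integrable setT (EFin \o (fun w => S w * (1 + tilt w) * eta j w * U j w)).
  apply: (@integrable_bndM _ _ _ P _ (U j) (B * (1 + c * Num.sqrt dt * d%:R) * M)).
  - apply: measurable_funM; last exact: meas_wrt_sub (meta j).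
    apply: measurable_funM; first exact: meas_wrt_sub mS.
    exact: measurable_funD.
  - move=> w; rewrite !normrM ler_pM ?mulr_ge0//.
    rewrite ler_pM//; apply: (le_trans (ler_normD _ _)).
    by rewrite normr1 lerD2l tilt_bound.
  - exact: (integrable_coord ).
have := integrable_sumR iT; apply: eq_integrable => // w _ /=; congr EFin.
rewrite mulrA mulr_sumr; apply: eq_bigr => j _; by rewrite !mulrA.
Qed.

(** Without the tilt the increment is centred. In its product with the tilt only the terms i = j
    survive, and they give |eta j| |U j|, whose conditional mean is at least |eta j| sqrt dt / 4;
    the factor c sqrt dt of the tilt completes the bound. *)
Lemma expect_tilt_lin (S : Omega -> R) B : meas_wrt FF S ->
  (forall w, 0 <= S w <= B) ->
  c / 4 * dt * \int[P]_w (S w * \sum_(i < d) `|eta i w|) <=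
  \int[P]_w (S w * ((1 + tilt w) * \sum_(j < d) eta j w * U j w)).
Proof.
move=> mS SB.
have S0 w : 0 <= S w by case/andP: (SB w).
have SB' w : `|S w| <= B by rewrite ger0_norm//; case/andP: (SB w).
have B0 : 0 <= B by apply: le_trans (SB' point).
have M0 (i : 'I_d) : 0 <= M by apply: le_trans (etaM i point).
have mSe j : meas_wrt FF (fun w => S w * eta j w).
  exact: meas_wrtM.
have iSe j : P.-integrable setT (EFin \o (fun w => S w * eta j w)).
  apply: (@integrable_bnd _ _ _ _ _ (B * M)); first exact: meas_wrt_sub (mSe j).
  by move=> w; rewrite normrM ler_pM.
have mSee i j : meas_wrt FF (fun w => S w * eta j w * Num.sg (eta i w)) by exact: msgeta.
have iSee i j : P.-integrable setT (EFin \o (fun w => S w * eta j w * Num.sg (eta i w))).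
  exact: isgeta.
have iL j : P.-integrable setT (EFin \o (fun w => S w * eta j w * U j w)).
  have [+ _] := expectM_coord (i := j) (u := id) (mSe j) (@measurable_id _ _ _) (iSe j)
    (integrable_coord  j).
  by [].
have iQ i j : P.-integrable setT (EFin \o
    (fun w => S w * eta j w * Num.sg (eta i w) * (Num.sg (U i w) * U j w))).
  exact: (integrable_sg_lin ).
have iSabs i : P.-integrable setT (EFin \o (fun w => S w * `|eta i w|)).
  apply: (@integrable_bnd _ _ _ _ _ (B * M)).
    apply: measurable_funM; first exact: meas_wrt_sub mS.
    by apply: measurableT_comp => //; exact: meas_wrt_sub (meta i).
  by move=> w; rewrite normrM normr_id ler_pM.
have -> : \int[P]_w (S w * ((1 + tilt w) * \sum_(j < d) eta j w * U j w)) =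
   \int[P]_w (\sum_(j < d) S w * eta j w * U j w + c * Num.sqrt dt *
     \sum_(j < d) \sum_(i < d) S w * eta j w * Num.sg (eta i w) * (Num.sg (U i w) * U j w)).
  apply: eq_Rintegral => w _; rewrite mulrDl mul1r mulrDr; congr (_ + _).
    by rewrite mulr_sumr; apply: eq_bigr => j _; rewrite mulrA.
  rewrite /tilt -!mulrA mulrCA; congr (c * _); rewrite mulrCA; congr (_ * _).
  rewrite mulrCA mulr_suml mulr_sumr exchange_big/=; apply: eq_bigr => i _.
  rewrite !mulr_sumr; apply: eq_bigr => j _; ring.
rewrite RintegralD//; last 2 first.
- exact: integrable_sumR.
- by apply: integrableZR; apply: integrable_sumR => j; exact: integrable_sumR.
rewrite expect_sum// big1 ?add0r => [|j _]; last first.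
  exact: (expect_linear ).
rewrite RintegralZl//; last by apply: integrable_sumR => j; exact: integrable_sumR.
rewrite expect_sum; last by move=> j; exact: integrable_sumR.
have -> : \int[P]_w (S w * \sum_(i < d) `|eta i w|) = \sum_(j < d) \int[P]_w (S w * `|eta j w|).
  rewrite -expect_sum//; by apply: eq_Rintegral => w _; rewrite mulr_sumr.
have -> : c / 4 * dt = c * Num.sqrt dt * (Num.sqrt dt / 4).
  by rewrite -{1}[dt]sqr_sqrtr ?ltW//; ring.
rewrite -mulrA ler_wpM2l ?mulr_ge0 ?sqrtr_ge0// mulr_sumr ler_sum// => j _.
rewrite expect_sum// (bigD1 j)//= [X in _ + X]big1 ?addr0 => [|i ij]; last first.
  exact: (expect_sg_lin ).
have -> : \int[P]_w (S w * eta j w * Num.sg (eta j w) * (Num.sg (U j w) * U j w)) =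
   \int[P]_w ((S w * `|eta j w|) * `|U j w|).
  by apply: eq_Rintegral => w _; rewrite !normrEsg; ring.
have iabsU : P.-integrable setT (EFin \o ((Num.norm : R -> R) \o U j)).
  exact: integrable_abse (integrable_coord  j).
have mSa : meas_wrt FF (fun w => S w * `|eta j w|).
  by apply: meas_wrtM => //; apply: meas_wrt_comp => //; exact: normr_measurable.
have [_ ->] := expectM_coord (i := j) (u := (Num.norm : R -> R)) mSa
   (@normr_measurable R setT) (iSabs j) iabsU.
rewrite mulrC ler_wpM2l//.
  by apply: Rintegral_ge0 => w _; rewrite mulr_ge0.
exact: (expect_abs_coord ).
Qed.

(** The tilt at most doubles the weight, so 1024 is twice the constant of [expect_coord4]. *)
Lemma expect_tilt4 (S : Omega -> R) : meas_wrt FF S -> (forall w, 0 <= S w) ->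
  P.-integrable setT (EFin \o S) -> c * Num.sqrt dt * d%:R <= 1 ->
  P.-integrable setT (EFin \o (fun w => S w * (1 + tilt w) * \sum_(i < d) U i w ^+ 4)) /\
  \int[P]_w (S w * (1 + tilt w) * \sum_(i < d) U i w ^+ 4) <=
  1024 * d%:R * dt ^+ 2 * \int[P]_w S w.
Proof.
move=> mS S0 iS cd.
pose u (x : R) := x ^+ 4.
have mu : measurable_fun setT u by exact: exprn_measurable.
have iu i : P.-integrable setT (EFin \o (u \o U i)) := integrable_coord4  i.
have ES i := expectM_coord (i := i) mS mu iS (iu i).
have iSU i : P.-integrable setT (EFin \o (fun w => S w * U i w ^+ 4)) by case: (ES i).
have iG : P.-integrable setT (EFin \o (fun w => 2 * \sum_(i < d) S w * U i w ^+ 4)).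
  by apply: integrableZR; exact: integrable_sumR.
have U40 w : 0 <= \sum_(i < d) U i w ^+ 4.
  by apply: sumr_ge0 => i _; exact: exprn_even_ge0.
have t2 w : 0 <= 1 + tilt w <= 2.
  by have := le_trans (tilt_bound w) cd; rewrite ler_norml => /andP[h1 h2]; lra.
have le2 w : S w * (1 + tilt w) * \sum_(i < d) U i w ^+ 4 <= 2 * \sum_(i < d) S w * U i w ^+ 4.
  rewrite -mulr_sumr [S w * _]mulrC -mulrA ler_wpM2r//; last by case/andP: (t2 w).
  by rewrite mulr_ge0.
have iE : P.-integrable setT (EFin \o (fun w => S w * (1 + tilt w) * \sum_(i < d) U i w ^+ 4)).
  apply: le_integrableR iG.
    apply: measurable_funM; last by apply: measurable_sum => i; exact: measurable_funX.
    by apply: measurable_funM; [exact: meas_wrt_sub mS|exact: measurable_funD].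
  move=> w; rewrite ger0_norm// !mulr_ge0//; by case/andP: (t2 w).
split=> //.
apply: (le_trans (le_Rintegral measurableT iE iG _)) => //.
rewrite RintegralZl//; last exact: integrable_sumR.
rewrite expect_sum//.
have -> : 1024 * d%:R * dt ^+ 2 * \int[P]_w S w = 2 * \sum_(i < d) (512 * dt ^+ 2) * \int[P]_w S w.
  by rewrite sumr_const card_ord -mulr_natl; ring.
rewrite ler_wpM2l// ler_sum// => i _.
have [_ ->] := ES i.
rewrite mulrC ler_wpM2r//; first by exact: Rintegral_ge0.
exact: (expect_coord4 ).
Qed.

End gaussian_step.

(** * The Huber function and the stopped path *)

Section huber.
Context (R : realType).
Implicit Types x y : R.

(** [hub] is the Huber function, equal to 0, x ^ 2 / 2 and x - 1/2 on the three ranges of [hubdP],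
    and [hubd] is its derivative. *)
Definition hubd x : R := Num.min 1 (Num.max 0 x).
Definition hub x : R := hubd x * x - hubd x ^+ 2 / 2.

Lemma hubdP x : [\/ x <= 0 /\ hubd x = 0, 0 <= x <= 1 /\ hubd x = x |
  1 <= x /\ hubd x = 1].
Proof.
rewrite /hubd; case: (lerP x 0) => x0.
  by apply: Or31; split=> //; rewrite min_r.
case: (lerP x 1) => x1.
  by apply: Or32; rewrite (ltW x0); split=> //; rewrite min_r.
by apply: Or33; split; rewrite ?min_l// ltW.
Qed.

Lemma hubd_ge0 x : 0 <= hubd x.
Proof. by case: (hubdP x) => -[? ->]; lra. Qed.

Lemma hubd_le1 x : hubd x <= 1.
Proof. by case: (hubdP x) => -[? ->]; lra. Qed.

Lemma hubd_le0 x : x <= 0 -> hubd x = 0.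
Proof. by move=> x0; case: (hubdP x) => -[? ->]; lra. Qed.

Lemma hubd_lip x y : `|hubd x - hubd y| <= `|x - y|.
Proof.
rewrite ler_norml; have := ler_norm (x - y); have := ler_norm (- (x - y)).
by rewrite normrN; case: (hubdP x) => -[? ->]; case: (hubdP y) => -[? ->]; lra.
Qed.

Lemma hub_ge0 x : 0 <= hub x.
Proof.
rewrite /hub; case: (hubdP x) => -[? ->]; rewrite ?expr2; last by lra.
  lra.
have : 0 <= x * x by rewrite -expr2 sqr_ge0.
lra.
Qed.

(* [hub x] is the maximum over t in [0, 1] of [t * x - t ^+ 2 / 2]. *)
Lemma hub_tangent x y : hub x + hubd x * (y - x) <= hub y.
Proof.
have -> : hub x + hubd x * (y - x) = hubd x * y - hubd x ^+ 2 / 2.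
  by rewrite /hub; ring.
rewrite /hub; have := hubd_ge0 x; have := hubd_le1 x; move: (hubd x) => t.
case: (hubdP y) => -[h ->] t1 t0; rewrite !expr2.
- have : 0 <= t * t by rewrite mulr_ge0.
  have : t * y <= 0 by rewrite mulr_ge0_le0.
  lra.
- have : 0 <= (t - y) * (t - y) by rewrite -expr2 sqr_ge0.
  lra.
- have : 0 <= (1 - t) * (y - 1) by rewrite mulr_ge0//; lra.
  have : 0 <= (t - 1) * (t - 1) by rewrite -expr2 sqr_ge0.
  lra.
Qed.

(** This converts the term beta D of the drift bound, once weighted by the derivative, into a
    multiple of [hub] itself, which a discount factor can absorb. *)
Lemma hubdM_le x : hubd x * x <= 2 * hub x.
Proof.
rewrite /hub; case: (hubdP x) => -[h ->]; rewrite ?expr2; lra.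
Qed.

Lemma hub_lip x y : hub x <= hub y + `|x - y|.
Proof.
have := hub_tangent x y; have := hubd_le1 x; have := hubd_ge0 x => h0 h1.
have : hubd x * (x - y) <= `|x - y|.
  apply: (le_trans (ler_norm _)); rewrite normrM ger0_norm//.
  by rewrite ler_piMl.
lra.
Qed.

Lemma hub_le x c : 0 <= c -> x <= c -> hub x <= c.
Proof.
move=> c0 xc; rewrite /hub; case: (hubdP x) => -[h ->]; rewrite ?expr2; first by lra.
  have : 0 <= x * (1 - x) by rewrite mulr_ge0//; lra.
  have : 0 <= x * x by rewrite mulr_ge0//; lra.
  lra.
lra.
Qed.

Lemma hub_gt0 x : 0 < x -> 0 < hub x.
Proof.
move=> x0; rewrite /hub; case: (hubdP x) => -[h ->]; rewrite ?expr2; try lra.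
have : 0 < x * x by rewrite mulr_gt0.
lra.
Qed.

Lemma measurable_hubd : measurable_fun setT hubd.
Proof.
apply: measurable_minr => //; apply: measurable_maxr => //.
Qed.

Lemma measurable_hub : measurable_fun setT hub.
Proof.
apply: measurable_funB; first by apply: measurable_funM => //; exact: measurable_hubd.
by apply: measurable_funM => //; apply: measurable_funX; exact: measurable_hubd.
Qed.

(** The drift increments, which contain increments of the Ito integral, are not known to have
    moments. Clipping makes the walk integrable and changes nothing on good paths, where they are at
    most 1. *)
Definition clip1 x : R := Num.max (-1) (Num.min 1 x).

Lemma clip1_bound x : `|clip1 x| <= 1.
Proof. by rewrite ler_norml /clip1 le_max ge_max lexx ge_min lexx !andbT/=; lra. Qed.

Lemma clip1_id x : `|x| <= 1 -> clip1 x = x.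
Proof. by rewrite ler_norml /clip1 => /andP[h1 h2]; rewrite min_r// max_r. Qed.

Lemma measurable_clip1 : measurable_fun setT clip1.
Proof. by apply: measurable_maxr => //; apply: measurable_minr. Qed.

End huber.

Section stopped_path.
Context (R : realType).
Variables (D a x n dt rho : nat -> R) (beta gam dl : R).

(* The stopped path, its accumulated drift defect, and the indicator of not
   being stopped yet. *)
Fixpoint path_st (k : nat) : R * R * R :=
  if k is j.+1 then
    let: (X, Q, chi) := path_st j in
    let X' := X + chi * (clip1 (a j) + x j) in
    let Q' := Q + chi * rho j.+1 *
      (hubd X * (clip1 (a j) + gam * n j * dt j) + 2 * beta * dt j * hub X) in
    (X', Q', chi * (((`|X' - D j.+1| <= dl) && (- dl <= Q'))%:R))
  else (D 0, 0, 1).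

Definition pX k := (path_st k).1.1.
Definition pQ k := (path_st k).1.2.
Definition pchi k := (path_st k).2.

Lemma pX0 : pX 0 = D 0. Proof. by []. Qed.
Lemma pQ0 : pQ 0 = 0. Proof. by []. Qed.

Lemma pXS k : pX k.+1 = pX k + pchi k * (clip1 (a k) + x k).
Proof. by rewrite /pX /pchi/=; case: (path_st k) => -[]. Qed.

Lemma pQS k : pQ k.+1 = pQ k + pchi k * rho k.+1 *
  (hubd (pX k) * (clip1 (a k) + gam * n k * dt k) + 2 * beta * dt k * hub (pX k)).
Proof. by rewrite /pQ /pX /pchi/=; case: (path_st k) => -[]. Qed.

Lemma pchiS k : pchi k.+1 =
  pchi k * ((`|pX k.+1 - D k.+1| <= dl) && (- dl <= pQ k.+1))%:R.
Proof. by rewrite /pQ /pX /pchi/=; case: (path_st k) => -[]. Qed.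

Lemma pchi01 k : pchi k = 0 \/ pchi k = 1.
Proof.
elim: k => [|k IH]; first by right.
by rewrite pchiS; case: IH => ->; rewrite ?mul0r ?mul1r; [left|case: (_ && _); [right|left]].
Qed.

Lemma pchi_ge0 k : 0 <= pchi k <= 1.
Proof. by case: (pchi01 k) => ->; rewrite ?lexx ?ler01. Qed.

Hypothesis dl0 : 0 <= dl.

Lemma pchi1 k : pchi k = 1 -> `|pX k - D k| <= dl /\ - dl <= pQ k.
Proof.
have dl0' := dl0.
case: k => [_|k]; first by rewrite pX0 pQ0 subrr normr0; split=> //; lra.
rewrite pchiS; case: (pchi01 k) => ->; rewrite ?mul0r ?mul1r => /eqP.
  by rewrite eq_sym oner_eq0.
by case: andP => [//|_]; rewrite eq_sym oner_eq0.
Qed.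

(** While the path runs it is within [dl] of D; the stopping step adds at most 1 from the clipped
    part and dl + o j from the walk, and then the path is frozen. Summing all the o j, though only
    one is spent, avoids naming the stopping index. *)
Lemma pX_ub K (B : R) (o : nat -> R) : 0 <= B ->
  (forall j, (j <= K)%N -> D j <= B) ->
  (forall j, (j < K)%N -> 0 <= o j /\ `|x j| <= dl + o j) ->
  forall k, (k <= K)%N -> pX k <= B + 2 * dl + 1 + \sum_(j < k) o j.
Proof.
have dl0' := dl0.
move=> B0 DB xo; elim=> [|k IH] kK.
  by rewrite big_ord0 pX0; have := DB 0 (leq0n _); lra.
have {IH} := IH (ltnW kK); have [ok xk] := xo k kK.
rewrite pXS big_ord_recr/=; case: (pchi01 k) => c1; rewrite c1.
  by rewrite mul0r; lra.
have [+ _] := pchi1 c1; rewrite ler_norml => /andP[_ h2] h3.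
have := DB k (ltnW kK); have := clip1_bound (a k); rewrite ler_norml => /andP[_ h4].
have h5 := le_trans (ler_norm _) xk.
have : 0 <= \sum_(i < k) o i by apply: sumr_ge0 => i _; case: (xo i (ltn_trans (ltn_ord i) kK)).
rewrite mul1r; lra.
Qed.

Hypothesis beta0 : 0 <= beta.
Hypothesis gam0 : 0 <= gam.

(** Before any effective step Q is at least - dl by the stopping test, and one step lowers it by at
    most r: the clipped part is at least -1, [hubd] is at most 1, and the other terms are
    nonnegative. *)
Lemma pQ_lb K (r : R) : 0 <= r ->
  (forall j, (j < K)%N -> [/\ 0 <= dt j, 0 <= n j & 0 <= rho j.+1 <= r]) ->
  forall k, (k <= K)%N -> - (dl + r) <= pQ k.
Proof.
have dl0' := dl0.
move=> r0 H; elim=> [_|k IH kK]; first by rewrite pQ0; lra.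
have {IH} := IH (ltnW kK); have [dt0 n0 /andP[rho0 rhor]] := H k kK.
rewrite pQS; case: (pchi01 k) => c1; rewrite c1; first by rewrite !mul0r addr0.
have [_ h2] := pchi1 c1; rewrite mul1r => _.
suff : - r <= rho k.+1 * (hubd (pX k) * (clip1 (a k) + gam * n k * dt k) +
    2 * beta * dt k * hub (pX k)) by lra.
have b0 : 0 <= 2 * beta * dt k * hub (pX k) by rewrite mulr_ge0 ?hub_ge0// !mulr_ge0.
have g0 : 0 <= gam * n k * dt k by rewrite !mulr_ge0.
have c0 : -1 <= clip1 (a k) by have := clip1_bound (a k); rewrite ler_norml => /andP[].
have t : -1 <= hubd (pX k) * (clip1 (a k) + gam * n k * dt k) + 2 * beta * dt k * hub (pX k).
  have := hubd_ge0 (pX k); have := hubd_le1 (pX k).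
  move: (hubd _) => t t1 t0.
  have : 0 <= t * (clip1 (a k) + 1 + gam * n k * dt k) by rewrite mulr_ge0//; lra.
  lra.
have : rho k.+1 * (-1) <= rho k.+1 * (hubd (pX k) * (clip1 (a k) + gam * n k * dt k) +
    2 * beta * dt k * hub (pX k)) by rewrite ler_wpM2l.
lra.
Qed.

(** By induction, as long as the path runs nothing is clipped and X is the plain sum, which the
    hypothesis keeps within q of D; the accumulated defect stays above minus the sum of the e j
    weighted by r, so neither test fires. *)
Lemma pchi_good K (r q : R) (e : nat -> R) : 0 <= r -> q <= dl ->
  (forall j, (j < K)%N -> [/\ `|a j| <= 1, 0 <= rho j.+1 <= r & 0 <= e j]) ->
  (forall k, (k <= K)%N -> `|D 0 + \sum_(j < k) (a j + x j) - D k| <= q) ->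
  (forall k, (k < K)%N -> forall X, `|X - D k| <= q ->
     - e k <= hubd X * (a k + gam * n k * dt k) + 2 * beta * dt k * hub X) ->
  r * \sum_(j < K) e j <= dl ->
  pchi K = 1.
Proof.
move=> r0 qdl Ha HJ HR He.
have e0 k : (k <= K)%N -> \sum_(j < k) e j <= \sum_(j < K) e j.
  move=> kK; rewrite -(subnKC kK) big_split_ord/= lerDl sumr_ge0// => i _.
  have iK : (k + i < K)%N by rewrite -ltn_subRL.
  by have [] := Ha _ iK.
suff H : forall k, (k <= K)%N -> [/\ pchi k = 1,
    pX k = D 0 + \sum_(j < k) (a j + x j) & - (r * \sum_(j < k) e j) <= pQ k].
  by have [] := H K (leqnn K).
elim=> [_|k IH kK]; first by rewrite !big_ord0 mulr0 oppr0 addr0.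
have [c1 Xk Qk] := IH (ltnW kK).
have [ak /andP[rho0 rhor] ek] := Ha k kK.
have Xk1 : pX k.+1 = D 0 + \sum_(j < k.+1) (a j + x j).
  by rewrite pXS c1 mul1r clip1_id// Xk big_ord_recr/= !addrA.
have hX : `|pX k - D k| <= q by rewrite Xk HJ// ltnW.
have Qk1 : - (r * \sum_(j < k.+1) e j) <= pQ k.+1.
  rewrite pQS c1 mul1r clip1_id// big_ord_recr/= mulrDr.
  have Rk := HR k kK _ hX.
  have : rho k.+1 * (- e k) <= rho k.+1 *
    (hubd (pX k) * (a k + gam * n k * dt k) + 2 * beta * dt k * hub (pX k)).
    by rewrite ler_wpM2l.
  have : rho k.+1 * e k <= r * e k by rewrite ler_wpM2r.
  lra.
split=> //.
rewrite pchiS c1 mul1r Xk1 (le_trans (HJ _ kK) qdl)/=.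
rewrite (_ : - dl <= _)//.
apply: le_trans Qk1; rewrite lerN2; apply: le_trans He.
by rewrite ler_wpM2l// e0.
Qed.

End stopped_path.

(** * The tilted walk *)

Section integral_ae.
Context (disp : measure_display) (Omega : measurableType disp) (R : realType).
Context (P : probability Omega R).

Lemma le_Rintegral_ae (S T : Omega -> R) :
  P.-integrable setT (EFin \o S) -> P.-integrable setT (EFin \o T) ->
  {ae P, forall w, S w <= T w} -> \int[P]_w S w <= \int[P]_w T w.
Proof.
move=> iS iT ST; have mS := integrable_meas iS; have mT := integrable_meas iT.
have iM : P.-integrable setT (EFin \o (fun w => Num.max (S w) (T w))).
  apply: (le_integrableR (T := fun w => `|S w| + `|T w|)).
  - exact: measurable_maxr.
  - move=> w; rewrite maxEle; case: ifP => _; by rewrite ?lerDl ?lerDr.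
  - by apply: integrableDR; [exact: integrable_abse iS|exact: integrable_abse iT].
apply: (@le_trans _ _ (\int[P]_w Num.max (S w) (T w))).
  by apply: le_Rintegral => // w _; rewrite le_max lexx.
rewrite le_eqVlt; apply/orP; left; apply/eqP; congr fine.
apply: ae_eq_integral => //; first exact: measurable_int iM.
  exact: measurable_int iT.
by apply: filterS ST => w ST _ /=; rewrite max_r.
Qed.

End integral_ae.

Section tilted_walk.
Context (disp : measure_display) (Omega : measurableType disp) (R : realType).
Context (P : probability Omega R) (d K : nat) (FF : nat -> set (set Omega)).
Context (dt : nat -> R) (U eta : nat -> 'I_d -> Omega -> R) (c M : R).
Hypothesis subF : forall k, (k <= K)%N -> <<s FF k>> `<=` measurable.
Hypothesis incF : forall k, (k < K)%N -> <<s FF k>> `<=` <<s FF k.+1>>.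
Hypothesis dt0 : forall k, (k < K)%N -> 0 < dt k.
Hypothesis mU : forall k i, (k < K)%N -> meas_wrt (FF k.+1) (U k i).
Hypothesis indU : forall k, (k < K)%N -> forall (A : set Omega) (B : 'I_d -> set R),
  <<s FF k>> A -> (forall i, measurable (B i)) ->
  P (A `&` [set w | forall i, B i (U k i w)]) =
  (P A * \prod_(i < d) normal_prob 0%R (Num.sqrt (dt k)) (B i))%E.
Hypothesis meta : forall k i, (k < K)%N -> meas_wrt (FF k) (eta k i).
Hypothesis etaM : forall k i w, (k < K)%N -> `|eta k i w| <= M.
Hypothesis c0 : 0 <= c.
Hypothesis cdt : forall k, (k < K)%N -> c * Num.sqrt (dt k) * d%:R <= 1.

(** The density of the discrete Girsanov transform: a discrete stochastic exponential of the
    tilts. *)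
Definition Lam k w : R := \prod_(j < k) (1 + tilt (dt j) (U j) (eta j) c w).

Let mUT k i : (k < K)%N -> measurable_fun setT (U k i).
Proof. by move=> kK; apply: meas_wrt_sub (mU i kK); exact: subF. Qed.

Lemma LamS k w : Lam k.+1 w = Lam k w * (1 + tilt (dt k) (U k) (eta k) c w).
Proof. by rewrite /Lam big_ord_recr. Qed.

Lemma tilt_range k w : (k < K)%N -> 0 <= 1 + tilt (dt k) (U k) (eta k) c w <= 2.
Proof.
move=> kK; have := le_trans (tilt_bound (dt k) (U k) (eta k) c0 w) (cdt kK).
by rewrite ler_norml => /andP[h1 h2]; lra.
Qed.

Lemma Lam_ge0 k w : (k <= K)%N -> 0 <= Lam k w.
Proof.
move=> kK; apply: prodr_ge0 => j _.
by case/andP: (tilt_range w (leq_trans (ltn_ord j) kK)).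
Qed.

(** This bound explodes with the number of cells and serves integrability only; the uniform control
    of moments is [expect_Lam_pow]. *)
Lemma Lam_bound k w : (k <= K)%N -> `|Lam k w| <= 2 ^+ k.
Proof.
move=> kK; rewrite ger0_norm ?Lam_ge0//.
have -> : 2 ^+ k = \prod_(j < k) 2 :> R by rewrite prodr_const card_ord.
rewrite /Lam ler_prod// => j _.
exact: tilt_range (leq_trans (ltn_ord j) kK).
Qed.

Lemma meas_tilt k : (k < K)%N ->
  meas_wrt (FF k.+1) (fun w => 1 + tilt (dt k) (U k) (eta k) c w).
Proof.
move=> kK; apply: meas_wrtD; first exact: meas_wrt_cst.
apply: meas_wrtM; first exact: meas_wrt_cst.
apply: meas_wrt_sum => i; apply: meas_wrtM.
  apply: meas_wrt_comp; first exact: measurable_sg.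
  by apply: meas_wrt_mono (meta i kK); exact: incF.
by apply: meas_wrt_comp; [exact: measurable_sg|exact: mU].
Qed.

Lemma meas_Lam k : (k <= K)%N -> meas_wrt (FF k) (Lam k).
Proof.
elim: k => [_|k IH kK].
  have -> : Lam 0 = (fun _ => 1) by apply/funext => w; rewrite /Lam big_ord0.
  exact: meas_wrt_cst.
have -> : Lam k.+1 = (fun w => Lam k w * (1 + tilt (dt k) (U k) (eta k) c w)).
  by apply/funext => w; rewrite LamS.
apply: meas_wrtM; last exact: meas_tilt.
by apply: meas_wrt_mono (IH (ltnW kK)); exact: incF.
Qed.

Lemma integrable_LamM k (S : Omega -> R) : (k <= K)%N ->
  P.-integrable setT (EFin \o S) ->
  P.-integrable setT (EFin \o (fun w => Lam k w * S w)).
Proof.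
move=> kK iS.
have mL : measurable_fun setT (Lam k) by apply: meas_wrt_sub (meas_Lam kK); exact: subF.
exact: (integrable_bndM mL (fun w => Lam_bound w kK) iS).
Qed.

Lemma expect_LamS k (S : Omega -> R) : (k < K)%N -> meas_wrt (FF k) S ->
  P.-integrable setT (EFin \o S) ->
  \int[P]_w (Lam k.+1 w * S w) = \int[P]_w (Lam k w * S w).
Proof.
move=> kK mS iS.
under eq_Rintegral do rewrite LamS mulrAC.
rewrite (expect_tilt (FF := FF k) _ (dt0 kK) (fun i => mUT i kK) (indU kK) c (fun i => meta i kK))//.
- by apply: subF; exact: ltnW.
- by apply: meas_wrtM => //; apply: meas_Lam; exact: ltnW.
- by apply: integrable_LamM => //; exact: ltnW.
Qed.

Lemma expect_Lam k : (k <= K)%N -> \int[P]_w Lam k w = 1.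
Proof.
elim: k => [_|k IH kK].
  under eq_Rintegral do rewrite /Lam big_ord0.
  exact: expect_cst.
rewrite -(IH (ltnW kK)).
have := @expect_LamS k (fun _ => 1) kK (meas_wrt_cst 1) (integrable_cstR P 1).
by under eq_Rintegral do rewrite mulr1; under [in RHS]eq_Rintegral do rewrite mulr1.
Qed.

(** The constant of the quadratic remainder in [tilt_pow]: multiplying 1 + m l + C l ^ 2 by 1 + l
    gives the remainder (m + C) l ^ 2 + C l ^ 3, and l ^ 3 <= l ^ 2. *)
Fixpoint tilt_cst (m : nat) : R := if m is j.+1 then j%:R + 2 * tilt_cst j else 0.

Lemma tilt_cst_ge0 m : 0 <= tilt_cst m.
Proof. by elim: m => //= m IH; rewrite addr_ge0// mulr_ge0. Qed.

Lemma tilt_pow m (l : R) : `|l| <= 1 ->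
  (1 + l) ^+ m <= 1 + m%:R * l + tilt_cst m * l ^+ 2.
Proof.
rewrite ler_norml => /andP[l1 l2]; elim: m => [|m IH] /=.
  by rewrite expr0 !mul0r; lra.
rewrite exprS.
have l3 : 0 <= 1 + l by lra.
apply: (le_trans (ler_wpM2l l3 IH)).
have := tilt_cst_ge0 m; move: (tilt_cst m) => C C0.
have : 0 <= C * l ^+ 2 * (1 - l) by rewrite mulr_ge0//; [rewrite mulr_ge0// sqr_ge0|lra].
rewrite -[m.+1%:R]natr1 expr2; lra.
Qed.

(** In [tilt_pow] the linear term is centred and the quadratic one is at most a multiple of dt, so
    each step multiplies the moment by at most 1 + q dt <= exp (q dt). The result depends on the
    total time, not on the number of cells nor on the bound of [eta]. *)
Lemma expect_Lam_pow m k : (k <= K)%N ->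
  \int[P]_w (Lam k w ^+ m) <=
  expR (tilt_cst m * c ^+ 2 * d%:R ^+ 2 * \sum_(j < k) dt j).
Proof.
elim: k => [_|k IH kK].
  under eq_Rintegral do rewrite /Lam big_ord0 expr1n.
  by rewrite expect_cst big_ord0 mulr0 expR0.
have kK' := ltnW kK.
have mLk : meas_wrt (FF k) (fun w => Lam k w ^+ m).
  by apply: (meas_wrt_comp (u := fun x => x ^+ m)); [exact: exprn_measurable|exact: meas_Lam].
have bL j w : (j <= K)%N -> `|Lam j w ^+ m| <= (2 ^+ j) ^+ m.
  by move=> jK; rewrite normrX lerXn2r ?nnegrE ?exprn_ge0//; exact: Lam_bound.
have iLk : P.-integrable setT (EFin \o (fun w => Lam k w ^+ m)).
  apply: (@integrable_bnd _ _ _ P _ ((2 ^+ k) ^+ m)); last by move=> w; exact: bL.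
  by apply: meas_wrt_sub mLk; exact: subF.
have iLk1 : P.-integrable setT (EFin \o (fun w => Lam k.+1 w ^+ m)).
  apply: (@integrable_bnd _ _ _ P _ ((2 ^+ k.+1) ^+ m)); last by move=> w; exact: bL.
  apply: (@meas_wrt_sub _ _ _ (FF k.+1)); first exact: subF.
  by apply: (meas_wrt_comp (u := fun x => x ^+ m)); [exact: exprn_measurable|exact: meas_Lam].
pose T w := tilt (dt k) (U k) (eta k) c w.
pose q : R := tilt_cst m * c ^+ 2 * d%:R ^+ 2.
have q0 : 0 <= q by rewrite /q !mulr_ge0 ?tilt_cst_ge0 ?sqr_ge0.
have iT : P.-integrable setT (EFin \o (fun w => Lam k w ^+ m * (1 + T w))).
  apply: (integrable_tilt (FF := FF k)) => //.
  - by apply: subF.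
  - by move=> i; exact: mUT.
  - by move=> i; exact: meta.
(* The bound 1 + m T + q dt is written through 1 + T, the form that [expect_tilt] integrates. *)
have iG : P.-integrable setT (EFin \o (fun w =>
    (1 - m%:R + q * dt k) * Lam k w ^+ m + m%:R * (Lam k w ^+ m * (1 + T w)))).
  by apply: integrableDR; apply: integrableZR.
have LE : \int[P]_w (Lam k.+1 w ^+ m) <= \int[P]_w
    ((1 - m%:R + q * dt k) * Lam k w ^+ m + m%:R * (Lam k w ^+ m * (1 + T w))).
  apply: le_Rintegral => // w _; rewrite LamS exprMn -/(T w).
  have TB := tilt_bound (dt k) (U k) (eta k) c0 w; rewrite -/(T w) in TB.
  have T1 : `|T w| <= 1 by apply: le_trans TB (cdt kK).
  have T2 : T w ^+ 2 <= c ^+ 2 * d%:R ^+ 2 * dt k.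
    rewrite -real_normK ?num_real//.
    have -> : c ^+ 2 * d%:R ^+ 2 * dt k = (c * Num.sqrt (dt k) * d%:R) ^+ 2.
      by rewrite !exprMn sqr_sqrtr ?ltW ?dt0//; ring.
    by rewrite lerXn2r ?nnegrE// !mulr_ge0// sqrtr_ge0.
  have L0 : 0 <= Lam k w ^+ m by rewrite exprn_ge0// Lam_ge0.
  have -> : (1 - m%:R + q * dt k) * Lam k w ^+ m + m%:R * (Lam k w ^+ m * (1 + T w)) =
     Lam k w ^+ m * (1 + m%:R * T w + q * dt k) by ring.
  rewrite ler_wpM2l//; apply: (le_trans (tilt_pow m T1)).
  rewrite lerD2l (_ : q * dt k = tilt_cst m * (c ^+ 2 * d%:R ^+ 2 * dt k)).
    by rewrite ler_wpM2l ?tilt_cst_ge0.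
  by rewrite /q !mulrA.
apply: (le_trans LE); rewrite RintegralD//; last 2 first.
- exact: integrableZR.
- exact: integrableZR.
rewrite !RintegralZl//.
rewrite (expect_tilt (FF := FF k) _ (dt0 kK) (fun i => mUT i kK) (indU kK) c (fun i => meta i kK))//; last exact: subF.
rewrite -mulrDl (_ : 1 - m%:R + q * dt k + m%:R = 1 + q * dt k); last by ring.
rewrite big_ord_recr/= mulrDr expRD [X in _ <= X]mulrC.
apply: ler_pM.
- by rewrite addr_ge0// mulr_ge0// ltW// dt0.
- by apply: Rintegral_ge0 => w _; rewrite exprn_ge0// Lam_ge0.
- exact: expR_ge1Dx.
- exact: IH.
Qed.

(** Fourth powers, since their expectations add up to the order of the sum of dt ^ 2, which vanishes
    with the mesh, while those of squares would add up to the total time. *)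
Definition fourth k w : R := \sum_(j < k) \sum_(i < d) U j i w ^+ 4.

Lemma meas_fourth k : (k <= K)%N -> meas_wrt (FF k) (fourth k).
Proof.
elim: k => [_|k IH kK].
  have -> : fourth 0 = (fun _ => 0) by apply/funext => w; rewrite /fourth big_ord0.
  exact: meas_wrt_cst.
have -> : fourth k.+1 = (fun w => fourth k w + \sum_(i < d) U k i w ^+ 4).
  by apply/funext => w; rewrite /fourth big_ord_recr.
apply: meas_wrtD; first by apply: meas_wrt_mono (IH (ltnW kK)); exact: incF.
apply: meas_wrt_sum => i; apply: (meas_wrt_comp (u := fun x => x ^+ 4)).
  exact: exprn_measurable.
exact: mU.
Qed.

Lemma integrable_fourth k : (k <= K)%N -> P.-integrable setT (EFin \o fourth k).
Proof.
move=> kK; apply: integrable_sumR => j; apply: integrable_sumR => i.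
have jK := leq_trans (ltn_ord j) kK.
exact: (integrable_coord4 (dt0 jK) (fun i => mUT i jK) (indU jK)).
Qed.

Lemma expect_Lam_fourth k : (k <= K)%N ->
  \int[P]_w (Lam k w * fourth k w) <= 1024 * d%:R * \sum_(j < k) dt j ^+ 2.
Proof.
elim: k => [_|k IH kK].
  under eq_Rintegral do rewrite /fourth big_ord0 mulr0.
  by rewrite big_ord0 mulr0 expect_cst.
have kK' := ltnW kK.
have [i4 e4] := expect_tilt4 (FF := FF k) (subF kK') (dt0 kK) (fun i => mUT i kK)
  (indU kK) (fun i => meta i kK) c0 (meas_Lam kK') (fun w => Lam_ge0 w kK')
  (integrable_bnd P (meas_wrt_sub (subF kK') (meas_Lam kK')) (fun w => Lam_bound w kK')) (cdt kK).
have -> : \int[P]_w (Lam k.+1 w * fourth k.+1 w) =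
   \int[P]_w (Lam k.+1 w * fourth k w +
     Lam k w * (1 + tilt (dt k) (U k) (eta k) c w) * \sum_(i < d) U k i w ^+ 4).
  by apply: eq_Rintegral => w _; rewrite -LamS -mulrDr /fourth big_ord_recr.
rewrite RintegralD//; last by apply: integrable_LamM => //; exact: integrable_fourth.
rewrite (expect_LamS kK (meas_fourth kK') (integrable_fourth kK')).
rewrite big_ord_recr/= mulrDr lerD//; first exact: IH.
by apply: (le_trans e4); rewrite expect_Lam// mulr1.
Qed.

Context (D a : nat -> Omega -> R) (beta gam dl : R).
Hypothesis mD : forall k, (k <= K)%N -> meas_wrt (FF k) (D k).
Hypothesis iD0 : P.-integrable setT (EFin \o D 0).
Hypothesis ma : forall k, (k < K)%N -> meas_wrt (FF k.+1) (a k).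
Hypothesis beta0 : 0 <= beta.
Hypothesis gam0 : 0 <= gam.
Hypothesis cE : c = 4 * gam.
Hypothesis bdt : forall k, (k < K)%N -> 4 * beta * dt k <= 1.

Definition walk_step k w : R := \sum_(i < d) eta k i w * U k i w.
Definition eta_norm k w : R := \sum_(i < d) `|eta k i w|.
(** The rate 4 beta is twice the rate 2 beta charged in [path_st]: with u = beta dt and 4 u <= 1 one
    has (1 + 4 u) (1 - 2 u) >= 1, which the submartingale property uses. *)
Definition rho k : R := \prod_(j < k) (1 + 4 * beta * dt j).

Definition wX k w := pX (D^~ w) (a^~ w) (walk_step^~ w) (eta_norm^~ w) dt rho beta gam dl k.
Definition wQ k w := pQ (D^~ w) (a^~ w) (walk_step^~ w) (eta_norm^~ w) dt rho beta gam dl k.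
Definition wchi k w := pchi (D^~ w) (a^~ w) (walk_step^~ w) (eta_norm^~ w) dt rho beta gam dl k.

Lemma rhoS k : rho k.+1 = rho k * (1 + 4 * beta * dt k).
Proof. by rewrite /rho big_ord_recr. Qed.

Lemma rho_ge1 k : (k <= K)%N -> 1 <= rho k.
Proof.
elim: k => [_|k IH kK]; first by rewrite /rho big_ord0.
have := IH (ltnW kK) => h; rewrite rhoS.
have : 0 <= 4 * beta * dt k by rewrite !mulr_ge0// ltW// dt0.
move: (4 * beta * dt k) (rho k) h => u v h u0.
have : 0 <= v * u by rewrite mulr_ge0//; lra.
lra.
Qed.

Lemma rho_mono k : (k <= K)%N -> rho k <= rho K.
Proof.
move=> kK; rewrite /rho -(subnKC kK) big_split_ord/=.
rewrite ler_peMr//; first by have := rho_ge1 kK; rewrite /rho; lra.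
rewrite -[leLHS](big1 (index_enum 'I_(K - k)) predT (fun=> 1 : R) (op := *%R))//.
rewrite ler_prod// => i _; rewrite ler01 lerDl !mulr_ge0// ltW// dt0//.
by rewrite -ltn_subRL.
Qed.

Lemma rho_expR k : (k <= K)%N -> rho k <= expR (4 * beta * \sum_(j < k) dt j).
Proof.
elim: k => [_|k IH kK]; first by rewrite /rho !big_ord0 mulr0 expR0.
rewrite big_ord_recr/= mulrDr expRD rhoS ler_pM//.
- by have := rho_ge1 (ltnW kK); lra.
- by rewrite addr_ge0// !mulr_ge0// ltW// dt0.
- exact: IH (ltnW kK).
- exact: expR_ge1Dx.
Qed.

Let meas_n k : (k < K)%N -> meas_wrt (FF k) (eta_norm k).
Proof.
move=> kK; apply: meas_wrt_sum => i; apply: meas_wrt_comp; last exact: meta.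
exact: normr_measurable.
Qed.

Let meas_xi k : (k < K)%N -> meas_wrt (FF k.+1) (walk_step k).
Proof.
move=> kK; apply: meas_wrt_sum => i; apply: meas_wrtM; last exact: mU.
by apply: meas_wrt_mono (meta i kK); exact: incF.
Qed.

Lemma meas_path k : (k <= K)%N ->
  [/\ meas_wrt (FF k) (wX k), meas_wrt (FF k) (wQ k) & meas_wrt (FF k) (wchi k)].
Proof.
elim: k => [_|k IH kK].
  by split; [exact: mD|exact: meas_wrt_cst|exact: meas_wrt_cst].
have [mX mQ mchi] := IH (ltnW kK).
have up S : meas_wrt (FF k) S -> meas_wrt (FF k.+1) S.
  by apply: meas_wrt_mono; exact: incF.
have mcl : meas_wrt (FF k.+1) (fun w => clip1 (a k w)).
  by apply: meas_wrt_comp; [exact: measurable_clip1|exact: ma].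
have mX1 : meas_wrt (FF k.+1) (wX k.+1).
  rewrite (_ : wX k.+1 = fun w => wX k w + wchi k w * (clip1 (a k w) + walk_step k w)).
    apply: meas_wrtD; [exact: up|apply: meas_wrtM; first exact: up].
    by apply: meas_wrtD => //; exact: meas_xi.
  by apply/funext => w; rewrite /wX pXS.
have mQ1 : meas_wrt (FF k.+1) (wQ k.+1).
  rewrite (_ : wQ k.+1 = fun w => wQ k w + wchi k w * rho k.+1 *
    (hubd (wX k w) * (clip1 (a k w) + gam * eta_norm k w * dt k) + 2 * beta * dt k * hub (wX k w))).
    apply: meas_wrtD; [exact: up|apply: meas_wrtM].
      by apply: meas_wrtM; [exact: up|exact: meas_wrt_cst].
    apply: meas_wrtD; apply: meas_wrtM.
    - by apply: meas_wrt_comp; [exact: measurable_hubd|exact: up].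
    - apply: meas_wrtD => //; apply: meas_wrtM; last exact: meas_wrt_cst.
      by apply: meas_wrtM; [exact: meas_wrt_cst|apply: up; exact: meas_n].
    - exact: meas_wrt_cst.
    - by apply: meas_wrt_comp; [exact: measurable_hub|exact: up].
  by apply/funext => w; rewrite /wQ pQS.
split=> //.
rewrite (_ : wchi k.+1 = fun w => wchi k w *
   (\1_[set x : R | x <= dl] `|wX k.+1 w - D k.+1 w| * \1_[set x : R | - dl <= x] (wQ k.+1 w))).
  apply: meas_wrtM; [exact: up|apply: meas_wrtM].
  - apply: meas_wrt_comp.
      by apply: measurable_indic; rewrite -set_itvNyc; exact: measurable_itv.
    apply: meas_wrt_comp; first exact: normr_measurable.
    by apply: meas_wrtB => //; exact: mD.
  - apply: meas_wrt_comp => //.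
    by apply: measurable_indic; rewrite -set_itvcy; exact: measurable_itv.
apply/funext => w; rewrite /wchi pchiS -/(wX k.+1 w) -/(wQ k.+1 w) !indicE.
congr (_ * _); rewrite -natrM mulnb; congr (_ && _)%:R.
  by apply/idP/idP => [h|]; [rewrite inE|rewrite inE].
by apply/idP/idP => [h|]; [rewrite inE|rewrite inE].
Qed.

Let n_bound k w : (k < K)%N -> 0 <= eta_norm k w <= d%:R * M.
Proof.
move=> kK; rewrite sumr_ge0//=.
apply: (@le_trans _ _ (\sum_(i < d) M)); first by apply: ler_sum => i _; exact: etaM.
by rewrite sumr_const card_ord mulr_natl.
Qed.

Let integrable_xi k : (k < K)%N -> P.-integrable setT (EFin \o walk_step k).
Proof.
move=> kK; apply: integrable_sumR => i.
apply: (@integrable_bndM _ _ _ P _ _ (M)).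
- by apply: meas_wrt_sub (meta i kK); exact: subF (ltnW kK).
- by move=> w; exact: etaM.
- exact: (integrable_coord (dt0 kK) (fun i => mUT i kK) (indU kK)).
Qed.

Lemma integrable_pX k : (k <= K)%N -> P.-integrable setT (EFin \o wX k).
Proof.
elim: k => [_|k IH kK]; first exact: iD0.
have [mX mQ mchi] := meas_path (ltnW kK).
rewrite (_ : wX k.+1 = fun w => wX k w + wchi k w * (clip1 (a k w) + walk_step k w)).
  apply: integrableDR; first exact: IH (ltnW kK).
  apply: (@integrable_bndM _ _ _ P _ _ (1)).
  - by apply: meas_wrt_sub mchi; exact: subF (ltnW kK).
  - move=> w; have /andP[h1 h2] := pchi_ge0 (D^~ w) (a^~ w) (walk_step^~ w) (eta_norm^~ w) dt rho beta gam dl k.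
    by rewrite ger0_norm.
  - apply: integrableDR; last exact: integrable_xi.
    apply: (@integrable_bnd _ _ _ P _ (1)); last by move=> w; exact: clip1_bound.
    apply: (@meas_wrt_sub _ _ _ (FF k.+1)); first exact: subF.
    by apply: meas_wrt_comp; [exact: measurable_clip1|exact: ma].
by apply/funext => w; rewrite /wX pXS.
Qed.

Lemma integrable_hubX k : (k <= K)%N -> P.-integrable setT (EFin \o (fun w => hub (wX k w))).
Proof.
move=> kK; have [mX _ _] := meas_path kK.
apply: (le_integrableR (T := fun w => `|wX k w|)).
- apply: (@meas_wrt_sub _ _ _ (FF k)); first exact: subF.
  by apply: meas_wrt_comp => //; exact: measurable_hub.
- by move=> w; rewrite ger0_norm ?hub_ge0// hub_le// ler_norm.
- exact: integrable_abse (integrable_pX kK).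
Qed.

Lemma integrable_pQ k : (k <= K)%N -> P.-integrable setT (EFin \o wQ k).
Proof.
elim: k => [_|k IH kK]; first exact: integrable_cstR.
have [mX mQ mchi] := meas_path (ltnW kK).
have sF := subF (ltnW kK).
rewrite (_ : wQ k.+1 = fun w => wQ k w + wchi k w * (rho k.+1 *
    (hubd (wX k w) * (clip1 (a k w) + gam * eta_norm k w * dt k) + 2 * beta * dt k * hub (wX k w)))).
  apply: integrableDR; first exact: IH (ltnW kK).
  apply: (@integrable_bndM _ _ _ P _ _ (1)).
  - exact: meas_wrt_sub mchi.
  - move=> w; have /andP[h1 h2] := pchi_ge0 (D^~ w) (a^~ w) (walk_step^~ w) (eta_norm^~ w) dt rho beta gam dl k.
    by rewrite ger0_norm.
  - apply: integrableZR; apply: integrableDR; last first.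
      by apply: integrableZR; exact: integrable_hubX (ltnW kK).
    apply: (@integrable_bndM _ _ _ P _ _ (1)).
    + by apply: meas_wrt_sub (meas_wrt_comp (@measurable_hubd R) mX).
    + by move=> w; rewrite ger0_norm ?hubd_ge0// hubd_le1.
    + apply: integrableDR.
        apply: (@integrable_bnd _ _ _ P _ (1)); last by move=> w; exact: clip1_bound.
        apply: (@meas_wrt_sub _ _ _ (FF k.+1)); first exact: subF.
        by apply: meas_wrt_comp; [exact: measurable_clip1|exact: ma].
      apply: (@integrable_bnd _ _ _ P _ (gam * (d%:R * M) * dt k)).
        apply: (meas_wrt_sub sF); apply: meas_wrtM; last exact: meas_wrt_cst.
        by apply: meas_wrtM; [exact: meas_wrt_cst|exact: meas_n].
      move=> w; have /andP[n0 nM] := n_bound w kK; have dtk := ltW (dt0 kK).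
      by rewrite ger0_norm ?mulr_ge0// ler_wpM2r// ler_wpM2l.
by apply/funext => w; rewrite /wQ pQS mulrA.
Qed.

(* [hub] is convex with derivative [hubd].  Under the tilt, [walk_step k] has
   conditional mean at least [gam * eta_norm k * dt k], since c = 4 gam and
   E|U i| >= sqrt dt / 4; the growth of [rho] pays for the beta term. *)
Lemma submartingale_step k : (k < K)%N ->
  \int[P]_w (Lam k w * (rho k * hub (wX k w) - wQ k w)) <=
  \int[P]_w (Lam k.+1 w * (rho k.+1 * hub (wX k.+1 w) - wQ k.+1 w)).
Proof.
move=> kK; have kK' := ltnW kK.
have [mX mQ mchi] := meas_path kK'.
have r1 := rho_ge1 kK'; have r2 := rho_ge1 kK.
pose T w := rho k * hub (wX k w) - wQ k w.
have mT : meas_wrt (FF k) T.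
  apply: meas_wrtB => //; apply: meas_wrtM; first exact: meas_wrt_cst.
  by apply: meas_wrt_comp => //; exact: measurable_hub.
have iT : P.-integrable setT (EFin \o T).
  by apply: integrableBR; [apply: integrableZR; exact: integrable_hubX|exact: integrable_pQ].
(* The weight that the tangent inequality puts on the walk step; it is bounded and known at step k,
   as [expect_tilt_lin] requires. *)
pose S w := Lam k w * (rho k.+1 * (wchi k w * hubd (wX k w))).
have chi01 w : 0 <= wchi k w <= 1 by exact: pchi_ge0.
have mS : meas_wrt (FF k) S.
  apply: meas_wrtM; first exact: meas_Lam.
  apply: meas_wrtM; first exact: meas_wrt_cst.
  by apply: meas_wrtM => //; apply: meas_wrt_comp => //; exact: measurable_hubd.
have SB w : 0 <= S w <= 2 ^+ k * (rho k.+1 * (1 * 1)).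
  have /andP[x0 x1] := chi01 w; have L0 := Lam_ge0 w kK'.
  have h0 := hubd_ge0 (wX k w); have h1 := hubd_le1 (wX k w).
  have rr : 0 <= rho k.+1 by lra.
  rewrite /S !mulr_ge0//=.
  apply: ler_pM => //; first by rewrite !mulr_ge0.
    by have := Lam_bound w kK'; rewrite ger0_norm.
  rewrite ler_wpM2l// ler_pM//.
have mSn : meas_wrt (FF k) (fun w => S w * eta_norm k w).
  by apply: meas_wrtM => //; exact: meas_n.
have iSn : P.-integrable setT (EFin \o (fun w => S w * eta_norm k w)).
  apply: (@integrable_bnd _ _ _ P _ (2 ^+ k * (rho k.+1 * (1 * 1)) * (d%:R * M))).
    by apply: meas_wrt_sub mSn; exact: subF.
  move=> w; have /andP[n0 n1] := n_bound w kK; have /andP[s0 s1] := SB w.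
  by rewrite normrM (ger0_norm s0) (ger0_norm n0) ler_pM.
pose L w := tilt (dt k) (U k) (eta k) c w.
have sF := subF kK'; have dtk := dt0 kK; have dtk' := ltW dtk.
have mUk i : measurable_fun setT (U k i) by exact: mUT.
have mek i : meas_wrt (FF k) (eta k i) by exact: meta.
have ebk i w : `|eta k i w| <= M by exact: etaM.
have SB' w : `|S w| <= 2 ^+ k * (rho k.+1 * (1 * 1)).
  by have /andP[s0 s1] := SB w; rewrite ger0_norm.
have iSx := integrable_tilt_lin sF dtk mUk (indU kK) mek ebk c0 mS SB'.
have iLT : P.-integrable setT (EFin \o (fun w => Lam k w * T w)) by exact: integrable_LamM.
have mLT : meas_wrt (FF k) (fun w => Lam k w * T w).
  by apply: meas_wrtM => //; exact: meas_Lam.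
have iLT1 := integrable_tilt (dt k) sF mUk mek c0 iLT.
have iSn1 := integrable_tilt (dt k) sF mUk mek c0 iSn.
(* Apply the tangent inequality at [wX k]. The clipped drift enters both [hub] and [wQ] with the
   same weight and cancels; what remains is the walk step minus its compensator gam eta_norm dt. *)
have pt w : (Lam k w * T w) * (1 + L w) + (S w * ((1 + L w) * walk_step k w) -
    gam * dt k * ((S w * eta_norm k w) * (1 + L w))) <=
    Lam k.+1 w * (rho k.+1 * hub (wX k.+1 w) - wQ k.+1 w).
  have /andP[x0 x1] := chi01 w; have L0 := Lam_ge0 w kK'.
  have /andP[t0 t1] := tilt_range w kK; rewrite -/(L w) in t0 t1.
  have bk := bdt kK.
  have hh := hub_ge0 (wX k w).
  have -> : (Lam k w * T w) * (1 + L w) + (S w * ((1 + L w) * walk_step k w) -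
      gam * dt k * ((S w * eta_norm k w) * (1 + L w))) = Lam k w * (1 + L w) *
     (T w + rho k.+1 * (wchi k w * hubd (wX k w)) * (walk_step k w - gam * eta_norm k w * dt k)).
    by rewrite /S; ring.
  rewrite LamS -/(L w) ler_wpM2l ?mulr_ge0//.
  have hX := hub_tangent (wX k w) (wX k.+1 w).
  have -> : wQ k.+1 w = wQ k w + wchi k w * rho k.+1 *
    (hubd (wX k w) * (clip1 (a k w) + gam * eta_norm k w * dt k) + 2 * beta * dt k * hub (wX k w)).
    by rewrite /wQ pQS.
  have eX : wX k.+1 w - wX k w = wchi k w * (clip1 (a k w) + walk_step k w).
    by rewrite /wX pXS; ring.
  rewrite eX in hX.
  have rr : 0 <= rho k.+1 by lra.
  have {hX} := ler_wpM2l rr hX.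
  have : rho k * hub (wX k w) <=
     rho k.+1 * hub (wX k w) * (1 - 2 * beta * dt k * wchi k w).
    have -> : rho k * hub (wX k w) = hub (wX k w) * rho k * 1 by ring.
    have -> : rho k.+1 * hub (wX k w) * (1 - 2 * beta * dt k * wchi k w) =
      hub (wX k w) * rho k * ((1 + 4 * (beta * dt k)) * (1 - 2 * (beta * dt k) * wchi k w)).
      by rewrite rhoS; ring.
    rewrite ler_wpM2l ?mulr_ge0//; first by lra.
    have b0 : 0 <= beta * dt k by rewrite mulr_ge0.
    move: bk; rewrite -mulrA; move: (beta * dt k) b0 => u u0 u1.
    have : 0 <= u * (1 - wchi k w) by rewrite mulr_ge0//; lra.
    have : 0 <= u * (1 - 4 * u * wchi k w).
      rewrite mulr_ge0//.
      have : 4 * u * wchi k w <= 4 * u * 1 by rewrite ler_wpM2l//; lra.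
      lra.
    have : 0 <= (1 + 4 * u) * (2 * u) * (1 - wchi k w).
      by rewrite mulr_ge0// ?mulr_ge0//; lra.
    have : 0 <= 2 * u * (1 - 4 * u).
      by rewrite mulr_ge0//; lra.
    lra.
  rewrite /T; lra.
have iM1 : P.-integrable setT (EFin \o (fun w =>
    Lam k.+1 w * (rho k.+1 * hub (wX k.+1 w) - wQ k.+1 w))).
  apply: integrable_LamM => //; apply: integrableBR; last exact: integrable_pQ.
  by apply: integrableZR; exact: integrable_hubX.
apply: (le_trans _ (le_Rintegral measurableT _ iM1 (fun w _ => pt w))); last first.
  by apply: integrableDR => //; apply: integrableBR => //; exact: integrableZR.
rewrite RintegralD//; last by apply: integrableBR => //; exact: integrableZR.
rewrite (expect_tilt sF dtk mUk (indU kK) c mek mLT iLT) lerDl.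
rewrite RintegralB//; last exact: integrableZR.
rewrite RintegralZl// (expect_tilt sF dtk mUk (indU kK) c mek mSn iSn) subr_ge0.
apply: le_trans (expect_tilt_lin sF dtk mUk (indU kK) mek ebk c0 mS SB).
by rewrite cE (_ : 4 * gam / 4 * dt k = gam * dt k)//; field.
Qed.

Lemma submartingale_ineq :
  \int[P]_w hub (D 0 w) <= \int[P]_w (Lam K w * (rho K * hub (wX K w) - wQ K w)).
Proof.
suff H k : (k <= K)%N ->
    \int[P]_w hub (D 0 w) <= \int[P]_w (Lam k w * (rho k * hub (wX k w) - wQ k w)).
  exact: H.
elim: k => [_|k IH kK].
  rewrite le_eqVlt; apply/orP; left; apply/eqP; apply: eq_Rintegral => w _.
  by rewrite /Lam /rho !big_ord0 /wX /wQ pX0 pQ0 !mul1r subr0.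
exact: le_trans (IH (ltnW kK)) (submartingale_step kK).
Qed.

Context (B : Omega -> R) (p e : R) (m : nat).
Hypothesis dl01 : 0 < dl <= 1.
Hypothesis e01 : 0 < e <= 1.
Hypothesis M1 : 1 <= M.
Hypothesis d0 : (0 < d)%N.
Hypothesis mp : 1 <= m%:R * (p - 1).
Hypothesis B5 : forall w, 5 <= B w.
Hypothesis iBp : P.-integrable setT (EFin \o (fun w => B w `^ p)).
Hypothesis DB : {ae P, forall w, D K w <= 0 /\ forall k, (k <= K)%N -> D k w + 5 <= B w}.

(** This is M / s ^ 3 for the threshold s = dl / (M d): d coordinates below s, with coefficients at
    most M, contribute at most dl together. *)
Definition overshoot_cst : R := M * (M * d%:R) ^+ 3 / dl ^+ 3.

Let Md0 : 0 < M * d%:R.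
Proof. by rewrite mulr_gt0 ?ltr0n// (lt_le_trans ltr01). Qed.

Lemma overshoot_cst_ge0 : 0 <= overshoot_cst.
Proof.
have [dlp _] := andP dl01; have M0 : 0 <= M by apply: le_trans M1.
by rewrite /overshoot_cst divr_ge0 ?mulr_ge0 ?exprn_ge0 ?mulr_ge0 ?(ltW dlp).
Qed.

(* [clip1] bounds the other part of a step, so this controls how far the step at
   which the path is stopped can overshoot. *)
Lemma walk_step_le_fourth k w : (k < K)%N ->
  `|walk_step k w| <= dl + overshoot_cst * \sum_(i < d) U k i w ^+ 4.
Proof.
move=> kK; have [dlp _] := andP dl01; have M0 : 0 <= M by apply: le_trans M1.
pose s := dl / (M * d%:R).
have s0 : 0 < s by rewrite divr_gt0.
(* Below the threshold |t| <= s; above it |t| = t ^ 4 / |t| ^ 3 <= t ^ 4 / s ^ 3. *)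
have key (t : R) : `|t| <= s + t ^+ 4 / s ^+ 3.
  have t4 : t ^+ 4 = `|t| ^+ 4 by rewrite -normrX ger0_norm// exprn_even_ge0.
  have [ts|ts] := leP `|t| s.
    by apply: (le_trans ts); rewrite lerDl t4 divr_ge0 ?exprn_ge0// ltW.
  apply: (@le_trans _ _ (t ^+ 4 / s ^+ 3)); last by rewrite lerDr ltW.
  rewrite t4 ler_pdivlMr ?exprn_gt0// [X in _ <= X]exprS ler_wpM2l//.
  by apply: lerXn2r; rewrite ?nnegrE ?(ltW s0) ?(ltW ts).
apply: (le_trans (ler_norm_sum _ _ _)).
apply: (@le_trans _ _ (\sum_(i < d) M * (s + U k i w ^+ 4 / s ^+ 3))).
  by apply: ler_sum => i _; rewrite normrM ler_pM// etaM.
rewrite -mulr_sumr big_split/= sumr_const card_ord -mulr_suml mulrDr -mulr_natr.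
have -> : M * (s * d%:R) = dl.
  by rewrite /s; field; rewrite lt0r_neq0 ?ltr0n// lt0r_neq0// (lt_le_trans ltr01).
have -> : M * ((\sum_(i < d) U k i w ^+ 4) / s ^+ 3) = overshoot_cst * \sum_(i < d) U k i w ^+ 4.
  rewrite /overshoot_cst /s exprMn exprVn invfM invrK; ring.
exact: lexx.
Qed.

(** Either b <= e l ^ m and the first term suffices, or l <= e^-1 b ^ (p - 1) and the second one
    does: a larger l would give e l ^ m >= b, because m (p - 1) >= 1, b >= 1 and e <= 1. The small
    factor sits on the power of the density, whose moments are uniformly bounded. *)
Lemma young_pow (l b : R) : 0 <= l -> 1 <= b ->
  l * b <= e * l ^+ m.+1 + e^-1 * b `^ p.
Proof.
move=> l0 b1; have [ep e1] := andP e01; have b0 : 0 <= b by lra.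
have bp0 : 0 <= b `^ p by exact: powR_ge0.
have [be|be] := leP b (e * l ^+ m).
  apply: (@le_trans _ _ (e * l ^+ m.+1)); last first.
    by rewrite lerDl mulr_ge0// invr_ge0 ltW.
  by rewrite exprS mulrCA ler_wpM2l.
have m0 : (0 < m)%N.
  by rewrite lt0n; apply/eqP => m0; move: mp; rewrite m0 mul0r ler10.
pose y := e^-1 * b `^ (p - 1).
have ly : l <= y.
  rewrite leNgt; apply/negP => yl; move: be; apply/negP; rewrite -leNgt.
  have e1' : 1 <= e^-1 by rewrite invf_ge1.
  have yy : y ^+ m <= l ^+ m.
    have y0 : 0 <= y by rewrite mulr_ge0 ?invr_ge0 ?powR_ge0// ltW.
    by apply: lerXn2r; rewrite ?nnegrE ?l0 ?y0 ?(ltW yl).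
  apply: (@le_trans _ _ (e * y ^+ m)); last by rewrite ler_wpM2l// ltW.
  rewrite /y exprMn -[b `^ _ ^+ m]powR_mulrn ?powR_ge0// -powRrM [_ * m%:R]mulrC.
  have h1 : e^-1 <= e^-1 ^+ m by rewrite -{1}[e^-1]expr1 ler_weXn2l.
  have h2 : b <= b `^ (m%:R * (p - 1)) by rewrite -{1}[b]powRr1// ler_powR.
  have h3 : e^-1 * b <= e^-1 ^+ m * b `^ (m%:R * (p - 1)).
    by rewrite ler_pM// invr_ge0 ltW.
  have : e * (e^-1 * b) <= e * (e^-1 ^+ m * b `^ (m%:R * (p - 1))).
    by rewrite ler_wpM2l// ltW.
  by rewrite mulrA divff ?gt_eqF// mul1r.
apply: (@le_trans _ _ (e^-1 * b `^ p)); last first.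
  by rewrite lerDr mulr_ge0 ?exprn_ge0// ltW.
have -> : b `^ p = b `^ (p - 1) * b.
  rewrite -{3}[b]powRr1// -powRD; last by apply/implyP => _; rewrite gt_eqF//; lra.
  by rewrite subrK.
by rewrite mulrA ler_wpM2r.
Qed.

(** A path never stopped ends within [dl] of D at the last node, which is at most 0, with Q at least
    - dl. For a stopped path the margin 5 between D and B absorbs the clipped step and the possible
    drop of Q by [rho K]. *)
Lemma path_bound w :
  D K w <= 0 -> (forall k, (k <= K)%N -> D k w + 5 <= B w) ->
  rho K * hub (wX K w) - wQ K w <=
  rho K * (3 * dl + B w * (1 - wchi K w) + overshoot_cst * fourth K w).
Proof.
move=> DK0 DBw; have [dlp dl1] := andP dl01; have dl0 := ltW dlp.
have r1 := rho_ge1 (leqnn K).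
have kap0 := overshoot_cst_ge0.
have f0 : 0 <= fourth K w.
  by apply: sumr_ge0 => j _; apply: sumr_ge0 => i _; exact: exprn_even_ge0.
have kf0 : 0 <= overshoot_cst * fourth K w by rewrite mulr_ge0.
have B5w := B5 w.
have rdl : dl <= rho K * dl by rewrite ler_peMl.
have rBf : 0 <= rho K * (B w * (1 - wchi K w) + overshoot_cst * fourth K w + dl).
  have /andP[x0 x1] : 0 <= wchi K w <= 1 by exact: pchi_ge0.
  rewrite mulr_ge0 ?addr_ge0//; try lra.
  by rewrite mulr_ge0//; lra.
have [c0'|c1] : wchi K w = 0 \/ wchi K w = 1 by exact: pchi01.
  rewrite c0' subr0 mulr1.
  have Xub : wX K w <= (B w - 5) + 2 * dl + 1 + overshoot_cst * fourth K w.
    apply: (le_trans (@pX_ub _ _ _ _ _ _ _ _ _ _ dl0 K (B w - 5)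
      (fun j => overshoot_cst * \sum_(i < d) U j i w ^+ 4) _ _ _ K (leqnn K))).
    - by lra.
    - by move=> j jK; have := DBw j jK; lra.
    - move=> j jK; split; last exact: walk_step_le_fourth.
      by rewrite mulr_ge0// sumr_ge0// => i _; exact: exprn_even_ge0.
    - by rewrite -mulr_sumr /fourth; lra.
  have hX : hub (wX K w) <= (B w - 5) + 2 * dl + 1 + overshoot_cst * fourth K w.
    by apply: hub_le => //; lra.
  have Qlb : - (dl + rho K) <= wQ K w.
    apply: (@pQ_lb _ _ _ _ _ _ _ _ _ _ dl0 beta0 gam0 K (rho K)) => //; first by lra.
    move=> j jK; split.
    - exact: ltW (dt0 jK).
    - by case/andP: (n_bound w jK).
    - by have := rho_ge1 jK; have := rho_mono jK; lra.
  have : rho K * hub (wX K w) <= rho K * ((B w - 5) + 2 * dl + 1 + overshoot_cst * fourth K w).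
    by rewrite ler_wpM2l//; lra.
  lra.
have [hX hQ] := pchi1 dl0 c1.
have hX' : hub (wX K w) <= dl.
  apply: hub_le => //; move: hX; rewrite ler_norml -/(wX K w) => /andP[_]; lra.
have : rho K * hub (wX K w) <= rho K * dl by rewrite ler_wpM2l//; lra.
rewrite -/(wQ K w) in hQ; move: rBf; lra.
Qed.

(** Young's inequality is applied to Lam * B only where the path was stopped, so that the large
    factor e^-1 B ^ p is charged on those scenarios alone. *)
Lemma discrete_estimate :
  \int[P]_w hub (D 0 w) <= rho K * (3 * dl +
    e * expR (tilt_cst m.+1 * c ^+ 2 * d%:R ^+ 2 * \sum_(j < K) dt j) +
    e^-1 * \int[P]_w (B w `^ p * (1 - wchi K w)) +
    overshoot_cst * (1024 * d%:R * \sum_(j < K) dt j ^+ 2)).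
Proof.
apply: (le_trans submartingale_ineq).
have [dlp dl1] := andP dl01; have [ep e1] := andP e01.
have r1 := rho_ge1 (leqnn K).
have [_ _ mchi] := meas_path (leqnn K).
have sF := subF (leqnn K).
have chi01 w : 0 <= wchi K w <= 1 by exact: pchi_ge0.
have mL : measurable_fun setT (Lam K) by apply: meas_wrt_sub (meas_Lam (leqnn K)).
have iL : P.-integrable setT (EFin \o Lam K).
  by apply: (integrable_bnd P mL) => w; exact: Lam_bound.
have iLm : P.-integrable setT (EFin \o (fun w => Lam K w ^+ m.+1)).
  apply: (@integrable_bnd _ _ _ P _ ((2 ^+ K) ^+ m.+1)); first exact: measurable_funX.
  by move=> w; rewrite normrX lerXn2r ?nnegrE ?exprn_ge0//; exact: Lam_bound.
have iBchi : P.-integrable setT (EFin \o (fun w => B w `^ p * (1 - wchi K w))).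
  have : P.-integrable setT (EFin \o (fun w => (1 - wchi K w) * B w `^ p)).
    apply: (@integrable_bndM _ _ _ P _ _ 1) => //.
      by apply: measurable_funB => //; exact: meas_wrt_sub mchi.
    by move=> w; have /andP[x0 x1] := chi01 w; rewrite ler_norml; lra.
  by apply: eq_integrable => // w _ /=; rewrite mulrC.
have i4 : P.-integrable setT (EFin \o (fun w => Lam K w * fourth K w)).
  by apply: integrable_LamM => //; exact: integrable_fourth.
have iG : P.-integrable setT (EFin \o (fun w => rho K * (3 * dl * Lam K w +
    e * Lam K w ^+ m.+1 + e^-1 * (B w `^ p * (1 - wchi K w)) +
    overshoot_cst * (Lam K w * fourth K w)))).
  by apply: integrableZR; do 3 (apply: integrableDR; last exact: integrableZR); exact: integrableZR.
have iF : P.-integrable setT (EFin \o (fun w => Lam K w * (rho K * hub (wX K w) - wQ K w))).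
  apply: integrable_LamM => //; apply: integrableBR; last exact: integrable_pQ.
  by apply: integrableZR; exact: integrable_hubX.
apply: (@le_trans _ _ (\int[P]_w (rho K * (3 * dl * Lam K w +
    e * Lam K w ^+ m.+1 + e^-1 * (B w `^ p * (1 - wchi K w)) +
    overshoot_cst * (Lam K w * fourth K w))))).
  apply: le_Rintegral_ae => //.
  apply: filterS DB => w [DK0 DBw].
  have L0 : 0 <= Lam K w by exact: Lam_ge0.
  apply: (le_trans (ler_wpM2l L0 (path_bound DK0 DBw))).
  rewrite mulrCA ler_wpM2l//; first by lra.
  have B1 : 1 <= B w by have := B5 w; lra.
  have h : Lam K w * B w * (1 - wchi K w) <=
      e * Lam K w ^+ m.+1 + e^-1 * (B w `^ p * (1 - wchi K w)).
    have [-> |->] : wchi K w = 0 \/ wchi K w = 1 by exact: pchi01.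
      by rewrite subr0 !mulr1; exact: young_pow.
    rewrite subrr !mulr0 addr0 mulr_ge0 ?exprn_ge0//; exact: ltW.
  move: h; move: (Lam K w ^+ m.+1) => u h.
  lra.
rewrite RintegralZl//; last first.
  by do 3 (apply: integrableDR; last exact: integrableZR); exact: integrableZR.
rewrite ler_wpM2l//; first by lra.
do 3 (rewrite RintegralD//; [|by do ? (apply: integrableDR; last exact: integrableZR); exact: integrableZR|exact: integrableZR]).
rewrite !RintegralZl// expect_Lam// mulr1.
apply: lerD; last first.
  by rewrite ler_wpM2l ?expect_Lam_fourth ?overshoot_cst_ge0.
rewrite lerD2r lerD2l ler_wpM2l ?(ltW ep)//.
exact: expect_Lam_pow.
Qed.

End tilted_walk.

(** * The Brownian filtration *)

Lemma measurable_rV_coord (R : realType) (d : nat) (i : 'I_d) :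
  measurable_fun [set: rV_borel R d] (fun z : rV_borel R d => (z : 'rV[R]_d) ord0 i).
Proof.
apply: (measurability _ (RGenOpens.measurableE R)).
move=> _ [_ [x [y ->]] <-]; rewrite setTI; apply: sub_sigma_algebra.
apply: open_comp; last exact: interval_open.
by move=> z _; exact: coord_continuous.
Qed.

Lemma meas_wrt_rV_coord (Omega : pointedType) (FF : set (set Omega)) (R : realType)
    (d : nat) (Z : Omega -> 'rV[R]_d) (i : 'I_d) :
  measurable_fun [set: g_sigma_algebraType FF]
    (Z : g_sigma_algebraType FF -> rV_borel R d) ->
  meas_wrt FF (fun w => Z w ord0 i).
Proof. by move=> mZ; exact: (measurableT_comp (measurable_rV_coord i) mZ). Qed.

Section filtration.
Context (R : realType) (disp : measure_display) (Omega : measurableType disp).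
Context (P : probability Omega R) (d : nat) (T : R).
Context (W : R -> Omega -> 'rV[R]_d).
Hypothesis completeP : measure_is_complete P.
Hypothesis bm : brownian_motion P T W.

Local Notation Fil := (augmented_filtration P W).

Let mW t : 0 <= t <= T ->
  measurable_fun [set: Omega] (W t : Omega -> rV_borel R d).
Proof. by move=> tT; case: bm => + _ _ _; exact. Qed.

Lemma negligible_measurable (A : set Omega) : P.-negligible A -> measurable A.
Proof. exact: completeP. Qed.

Lemma ae_measurable (Q : Omega -> Prop) : {ae P, forall w, Q w} ->
  measurable [set w | Q w] /\ P [set w | Q w] = 1%E.
Proof.
move=> aeQ; have mC : measurable (~` [set w | Q w]) by exact: completeP.
have m : measurable [set w | Q w] by rewrite -[X in measurable X]setCK; exact: measurableC.
split=> //; rewrite -[X in P X]setCK probability_setC//.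
by have /negligibleP -> := aeQ; rewrite ?sube0.
Qed.

Lemma history_measurable t : t <= T -> <<s history W t>> `<=` measurable.
Proof.
move=> tT; apply: smallest_sub; first exact: sigma_algebra_measurable.
move=> A [u + [B mB <-]]; rewrite /= in_itv/= => /andP[u0 ut].
by rewrite -[_ @^-1` _]setTI; apply: mW => //; rewrite u0 (le_trans ut).
Qed.

Lemma Fil_measurable t : t <= T -> <<s Fil t>> `<=` measurable.
Proof.
move=> tT; apply: smallest_sub; first exact: sigma_algebra_measurable.
apply: smallest_sub; first exact: sigma_algebra_measurable.
move=> A [hA|nA]; last exact: completeP.
by apply: (history_measurable tT); exact: sub_sigma_algebra.
Qed.

Lemma FilE t : <<s Fil t>> = Fil t.
Proof. by apply: sigma_algebra_id; exact: smallest_sigma_algebra. Qed.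

Lemma Fil_mono s t : s <= t -> Fil s `<=` Fil t.
Proof.
move=> st; apply: sub_sigma_algebra2 => A [[u us [B mB <-]]|nA]; last by right.
left; exists u; last by exists B.
by move: us; rewrite /= !in_itv/= => /andP[-> /le_trans ->].
Qed.

Lemma meas_wrt_Fil_mono s t (S : Omega -> R) : s <= t ->
  meas_wrt (Fil s) S -> meas_wrt (Fil t) S.
Proof. by move=> st; apply: meas_wrt_mono; rewrite !FilE; exact: Fil_mono. Qed.

Lemma meas_wrt_W t i : 0 <= t -> meas_wrt (Fil t) (fun w => W t w ord0 i).
Proof.
move=> t0; apply: meas_wrt_rV_coord => _ B mB; rewrite setTI.
apply: sub_sigma_algebra; apply: sub_sigma_algebra; left; exists t => /=.
  by rewrite in_itv/= t0 lexx.
by exists B.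
Qed.

(** The sets that agree up to a negligible set with one of the raw history form a sigma-algebra
    containing the generators. This carries the independence of increments, given for the raw
    history, over to the augmented filtration. *)
Lemma Fil_approx t (A : set Omega) : Fil t A ->
  exists2 A', <<s history W t>> A' & P.-negligible ((A `\` A') `|` (A' `\` A)).
Proof.
apply: (@smallest_sub _ _ _ [set A | exists2 A', <<s history W t>> A' &
   P.-negligible ((A `\` A') `|` (A' `\` A))]).
- split=> /=.
  + exists set0; first exact: sigma_algebra0.
    by rewrite setDv setU0; exact: negligible_set0.
  + move=> B [B' hB' nB]; exists (setT `\` B').
      by have [_ + _] := smallest_sigma_algebra setT (history W t); exact.
    apply: negligibleS nB => w /=.
    move=> [[[_ nBw] h]|[[_ nBw] h]].
    * by right; split=> //; apply: contrapT => nB'; apply: h.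
    * by left; split=> //; apply: contrapT => nB'; apply: h.
  + move=> F hF.
    have {hF} [F' hF'] : exists F', forall n, <<s history W t>> (F' n) /\
       P.-negligible ((F n `\` F' n) `|` (F' n `\` F n)).
      have := hF => /(_ _)/cid2 => h.
      by exists (fun n => s2val (h n)) => n; split; [exact: (s2valP (h n))|exact: (s2valP' (h n))].
    exists (\bigcup_n F' n); first by apply: sigma_algebra_bigcup => n; case: (hF' n).
    apply: (negligibleS _ (negligible_bigcup (fun n => (hF' n).2))).
    move=> w [[[n _ Fn] nF']|[[n _ Fn] nF']]; exists n => //.
    * by left; split=> // h; apply: nF'; exists n.
    * by right; split=> // h; apply: nF'; exists n.
- move=> B [hB|nB].
    exists B; first exact: sub_sigma_algebra.
    by rewrite setDv setU0; exact: negligible_set0.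
  exists set0; first exact: sigma_algebra0.
  by rewrite setD0 set0D setU0.
Qed.

Lemma increment_indep s t : 0 <= s -> s < t -> t <= T ->
  forall (A : set Omega) (B : 'I_d -> set R),
  <<s Fil s>> A -> (forall i, measurable (B i)) ->
  P (A `&` [set w | forall i, B i (W t w ord0 i - W s w ord0 i)]) =
  (P A * \prod_(i < d) normal_prob 0%R (Num.sqrt (t - s)) (B i))%E.
Proof.
move=> s0 st tT A B FA mB.
have FA' : Fil s A by rewrite -FilE.
have [A' hA' nAA'] := Fil_approx FA'.
have sT : s <= T by rewrite (le_trans (ltW st)).
have mA : measurable A by exact: (Fil_measurable sT).
have mA' : measurable A' by exact: (history_measurable sT).
have tin : 0 <= t <= T by rewrite tT (le_trans s0 (ltW st)).
have sin : 0 <= s <= T by rewrite s0.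
have mE : measurable [set w | forall i, B i (W t w ord0 i - W s w ord0 i)].
  have -> : [set w | forall i, B i (W t w ord0 i - W s w ord0 i)] =
     \bigcap_(i in [set: 'I_d]) ((fun w => W t w ord0 i - W s w ord0 i) @^-1` B i).
    by apply/seteqP; split => w /= h i; [move=> _; exact: h|exact: h].
  apply: fin_bigcap_measurable => // i _; rewrite -[_ @^-1` _]setTI.
  apply: measurable_funB => //.
    by apply: (measurableT_comp (measurable_rV_coord i)); exact: mW.
  by apply: (measurableT_comp (measurable_rV_coord i)); exact: mW.
have PE E : measurable E -> P (A `&` E) = P (A' `&` E).
  move=> mE'; apply/eqP; rewrite eq_le.
  have h X Y : measurable X -> measurable Y -> P.-negligible (X `\` Y) ->
      (P (X `&` E) <= P (Y `&` E))%E.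
    move=> mX mY nXY.
    have nm : measurable (X `\` Y) by exact: measurableD.
    have P0 : P (X `\` Y) = 0%E by apply/negligibleP.
    apply: (@le_trans _ _ (P ((Y `&` E) `|` (X `\` Y)))).
      apply: le_measure; rewrite ?inE; [exact: measurableI| |].
        by apply: measurableU => //; exact: measurableI.
      by move=> w [Xw Ew]; case: (pselect (Y w)) => Yw; [left|right].
    apply: (le_trans (measureU2 _ _ _)) => //; first exact: measurableI.
    by rewrite [X in (_ + X)%E](_ : _ = 0%E) ?adde0//; exact: P0.
  apply/andP; split; apply: h => //; apply: negligibleS nAA'.
    exact: subsetUl.
  exact: subsetUr.
rewrite PE//; case: bm => _ _ _ H.
rewrite (H s t s0 st tT A' B hA' mB).
by have := PE setT measurableT; rewrite !setIT => ->.
Qed.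

End filtration.

Lemma grid_range (R : realType) (s : nat -> R) (K : nat) :
  (forall k, (k < K)%N -> s k <= s k.+1) ->
  forall k, (k <= K)%N -> s 0%N <= s k <= s K.
Proof.
move=> sS; have H j k : (j + k <= K)%N -> s j <= s (j + k)%N.
  elim: k => [|k IH]; first by rewrite addn0.
  by rewrite addnS => h; apply: le_trans (IH (ltnW h)) (sS _ h).
move=> k kK; apply/andP; split; first exact: (H 0%N k).
by have := H k (K - k)%N; rewrite subnKC//; exact.
Qed.

(** The nodes are the sorted points of L in [a, b] together with both ends. With the times of simple
    processes in L, these processes are constant on every cell. *)
Lemma grid_through (R : realType) (a b : R) (L : seq R) : a < b ->
  exists (K : nat) (s : nat -> R), [/\ s 0%N = a, s K = b,
    forall k, (k < K)%N -> s k < s k.+1 &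
    forall k x, (k < K)%N -> x \in L -> s k < x -> s k.+1 <= x].
Proof.
move=> ab; pose l0 := [seq x <- a :: b :: L | a <= x <= b].
pose l := sort <=%O (undup l0).
have ll : sorted <%O l by rewrite sort_lt_sorted undup_uniq.
have inl x : (x \in l) = (a <= x <= b) && (x \in a :: b :: L).
  by rewrite mem_sort mem_undup mem_filter.
have al : a \in l by rewrite inl lexx (ltW ab) inE eqxx.
have bl : b \in l by rewrite inl lexx (ltW ab) !inE eqxx orbT.
have sl : (0 < size l)%N by case: (l) al.
pose K := (size l).-1; pose s k := nth b l k.
have KE : (K.+1 = size l) by rewrite /K prednK.
have Kl k : (k <= K)%N -> (k < size l)%N by rewrite -KE ltnS.
have mono i j : (i <= K)%N -> (j <= K)%N -> (s i < s j) = (i < j)%N.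
  by move=> iK jK; rewrite /s (lt_sorted_ltn_nth b ll) ?inE ?Kl.
have srange k : (k <= K)%N -> a <= s k <= b.
  by move=> kK; have := mem_nth b (Kl k kK); rewrite inl => /andP[].
have idx x : x \in l -> exists2 j, (j <= K)%N & s j = x.
  move=> xl; exists (index x l); last exact: nth_index.
  by rewrite -ltnS KE index_mem.
exists K, s; split.
- have [j jK sj] := idx a al.
  apply/eqP; rewrite eq_le; have /andP[-> _] := srange 0%N (leq0n _).
  by rewrite andbT -sj leNgt mono.
- have [j jK sj] := idx b bl.
  apply/eqP; rewrite eq_le; have /andP[_ ->] := srange K (leqnn _).
  by rewrite -sj leNgt mono// -leqNgt.
- by move=> k kK; rewrite mono// ltnW.
- move=> k x kK xL skx; have [xb|bx] := leP x b; last first.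
    by have /andP[_ h] := srange k.+1 kK; rewrite (le_trans h)// ltW.
  have xl : x \in l.
    rewrite inl xb !inE xL !orbT !andbT.
    by have /andP[h _] := srange k (ltnW kK); rewrite (le_trans h)// ltW.
  have [j jK sj] := idx x xl.
  rewrite -sj leNgt mono// ltnS -ltnNge -(mono k j)//; last exact: ltnW.
  by rewrite sj.
Qed.

(** An arithmetic progression of step delta is added to L; its first point after [s k] is at most
    [s k + delta]. *)
Lemma fine_grid_through (R : realType) (a b delta : R) (L : seq R) :
  a < b -> 0 < delta ->
  exists (K : nat) (s : nat -> R), [/\ s 0%N = a, s K = b,
    forall k, (k < K)%N -> s k < s k.+1 <= s k + delta &
    forall k x, (k < K)%N -> x \in L -> s k < x -> s k.+1 <= x].
Proof.
(* Two above the truncated quotient: the point of the progression after [s k] has as index the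
   truncation plus one, which must be less than n. *)
move=> ab d0; pose n := (Num.trunc ((b - a) / delta)).+2.
pose u i := a + i%:R * delta.
have [K [s [s0 sK sS sL]]] := grid_through (L ++ [seq u i | i <- iota 0 n]) ab.
exists K, s; split=> //; last by move=> k x kK xL; apply: sL => //; rewrite mem_cat xL.
have sa k : (k <= K)%N -> a <= s k.
  elim: k => [_|k IH kK]; first by rewrite s0.
  exact: le_trans (IH (ltnW kK)) (ltW (sS k kK)).
have sb k : (k <= K)%N -> s k <= b.
  move=> kK; rewrite -(subKn kK); elim: (K - k)%N => [|i IH]; first by rewrite subn0 sK.
  have [iK|Ki] := ltnP i K; last first.
    have -> : (K - i.+1 = 0)%N by apply/eqP; rewrite subn_eq0 leqW.
    by move: IH; have -> : (K - i = 0)%N by apply/eqP; rewrite subn_eq0.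
  apply: le_trans IH; rewrite (_ : (K - i = (K - i.+1).+1)%N); last by rewrite -subnSK.
  by apply/ltW/sS; rewrite ltn_subrL/= (leq_ltn_trans _ iK).
move=> k kK; rewrite sS//=.
have q0 : 0 <= (s k - a) / delta by rewrite divr_ge0 ?(ltW d0)// subr_ge0 sa// ltnW.
pose i := (Num.trunc ((s k - a) / delta)).+1.
have i1 : (s k - a) / delta < i%:R by exact: truncnS_gt.
have i2 : i%:R <= (s k - a) / delta + 1.
  by rewrite /i -natr1 lerD2r; have /andP[] := truncn_itv q0.
have iu1 : s k < u i by move: i1; rewrite ltr_pdivrMr// /u; lra.
have iu2 : u i <= s k + delta.
  have : i%:R * delta <= ((s k - a) / delta + 1) * delta by rewrite ler_wpM2r// ltW.
  by rewrite mulrDl divfK ?gt_eqF// /u; lra.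
apply: le_trans iu2; apply: sL => //.
rewrite mem_cat; apply/orP; right; apply/mapP; exists i => //.
rewrite mem_iota add0n leq0n/= /n /i !ltnS.
apply: le_truncn; rewrite ler_wpM2r ?invr_ge0 ?(ltW d0)//.
by rewrite lerD2r sb// ltnW.
Qed.

(** * Simple processes on a grid *)

Section dotp_linear.
Context (R : realType) (d : nat).
Implicit Types x y z : 'rV[R]_d.

Lemma dotp0l y : dotp 0 y = 0.
Proof. by rewrite /dotp big1// => i _; rewrite mxE mul0r. Qed.

Lemma dotpBr x y z : dotp x (y - z) = dotp x y - dotp x z.
Proof. by rewrite /dotp -sumrB; apply: eq_bigr => i _; rewrite !mxE mulrBr. Qed.

Lemma dotp_suml n (x : 'I_n -> 'rV[R]_d) y :
  dotp (\sum_(i < n) x i) y = \sum_(i < n) dotp (x i) y.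
Proof.
rewrite /dotp exchange_big/=; apply: eq_bigr => i _.
by rewrite summxE mulr_suml.
Qed.

End dotp_linear.

Section simple_on_cell.
Context (R : realType) (disp : measure_display) (Omega : measurableType disp).
Context (P : probability Omega R) (d : nat) (T : R).
Context (W : R -> Omega -> 'rV[R]_d).
Context (H : simple_process R Omega d) (u v : R).
Hypothesis sH : is_simple_process P T W H.
Hypothesis uv : u < v.
Hypothesis cell : forall j, (j <= sp_size H)%N -> u < sp_time H j -> v <= sp_time H j.

Let activeE (j : 'I_(sp_size H)) s : u < s <= v ->
  (sp_time H j < s <= sp_time H j.+1) = (sp_time H j < v <= sp_time H j.+1).
Proof.
move=> /andP[us sv]; congr (_ && _).
  have [h|h] := leP (sp_time H j) u.
    by rewrite (le_lt_trans h us) (le_lt_trans h uv).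
  have vj := cell (ltnW (ltn_ord j)) h.
  by rewrite !ltNge vj (le_trans sv vj).
have [h|h] := leP (sp_time H j.+1) u.
  by rewrite !leNgt (le_lt_trans h us) (le_lt_trans h uv).
have vj := cell (ltn_ord j) h.
by rewrite vj (le_trans sv vj).
Qed.

Lemma sp_process_cell s w : u < s <= v -> sp_process H s w = sp_process H v w.
Proof. by move=> us; apply: eq_bigr => j _; rewrite activeE. Qed.

Lemma sp_integral_cell w :
  sp_integral W H v w - sp_integral W H u w =
  dotp (sp_process H v w) (W v w - W u w).
Proof.
case: sH => _ tinc _ _.
rewrite /sp_process dotp_suml -sumrB; apply: eq_bigr => j _.
have tj := tinc j (ltn_ord j).
have [jv|vj] := ltP (sp_time H j) v; last first.
  have uj := lt_le_trans uv vj.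
  rewrite (min_r (le_trans vj tj)) (min_r (ltW (lt_le_trans uj tj))).
  by rewrite (min_r (ltW uj)) !subrr dotp0l.
have ju : sp_time H j <= u.
  by rewrite leNgt; apply/negP => /(cell (ltnW (ltn_ord j))); rewrite leNgt jv.
rewrite (min_l ju).
have [vj|jv'] := leP v (sp_time H j.+1).
  rewrite (min_r (ltW (lt_le_trans uv vj))) -!dotpBr.
  by rewrite opprB addrA subrK.
have ju' : sp_time H j.+1 <= u.
  by rewrite leNgt; apply/negP => /(cell (ltn_ord j)); rewrite leNgt jv'.
by rewrite (min_l ju') subrr dotp0l.
Qed.

(** The value is read at the right end v, but a simple process keeps on ]u, v] a value attached to a
    time at most u, so it is already known at u. *)
Lemma meas_sp_process_cell i : meas_wrt (augmented_filtration P W u)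
  (fun w => sp_process H v w ord0 i).
Proof.
rewrite (_ : (fun w => _) = fun w => \sum_(j < sp_size H)
    (if sp_time H j < v <= sp_time H j.+1 then sp_val H j w ord0 i else 0)); last first.
  apply/funext => w; rewrite /sp_process summxE; apply: eq_bigr => j _.
  by case: ifP => // _; rewrite mxE.
apply: meas_wrt_sum => j.
case: (boolP (sp_time H j < v <= sp_time H j.+1)) => [/andP[jv _]|_]; last exact: meas_wrt_cst.
have ju : sp_time H j <= u.
  by rewrite leNgt; apply/negP => /(cell (ltnW (ltn_ord j))); rewrite leNgt jv.
apply: (meas_wrt_Fil_mono ju); apply: meas_wrt_rV_coord.
by case: sH => _ _ + _; exact.
Qed.

End simple_on_cell.

Lemma sp_process_bound (R : realType) (disp : measure_display)
    (Omega : measurableType disp) (P : probability Omega R) (d : nat) (T : R)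
    (W : R -> Omega -> 'rV[R]_d) (H : simple_process R Omega d) :
  is_simple_process P T W H ->
  exists2 M, 0 <= M & forall s w i, `|sp_process H s w ord0 i| <= M.
Proof.
case=> _ _ _ [M HM]; exists ((sp_size H)%:R * `|M|); first by rewrite mulr_ge0.
move=> s w i; rewrite /sp_process summxE; apply: (le_trans (ler_norm_sum _ _ _)).
rewrite mulr_natl -[X in _ *+ X]card_ord -sumr_const; apply: ler_sum => j _.
case: ifP => _; last by rewrite mxE normr0.
apply: (le_trans (normr_le_enorm _ _)); apply: le_trans (HM j w (ltn_ord j)) _.
exact: ler_norm.
Qed.

Section integral_on_grid.
Context (R : realType).
Local Notation mu := (@lebesgue_measure R).

Lemma integrable_itv_sub (f : R -> R) (T u v : R) (b0 b1 : bool) : 0 <= u -> v <= T ->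
  mu.-integrable `[0, T] (EFin \o f) ->
  mu.-integrable [set` Interval (BSide b0 u) (BSide b1 v)] (EFin \o f).
Proof.
move=> u0 vT; apply: integrableS; [exact: measurable_itv|exact: measurable_itv|].
apply: subset_itv; first by case: b0; rewrite bnd_simp// ltW.
by case: b1; rewrite bnd_simp.
Qed.

Lemma sum_integral_cells (f : R -> R) (T : R) (K : nat) (s : nat -> R) :
  mu.-integrable `[0, T] (EFin \o f) -> 0 <= s 0%N -> s K <= T ->
  (forall k, (k < K)%N -> s k <= s k.+1) ->
  \sum_(k < K) \int[mu]_(t in `]s k, s k.+1]) f t = \int[mu]_(t in `]s 0%N, s K]) f t.
Proof.
move=> fi s0; elim: K => [|K IH] sT sS.
  by rewrite big_ord0 set_itvoc0 Rintegral_set0.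
have sKK := sS K (ltnSn K).
have s0K : s 0%N <= s K.
  by have /andP[] := grid_range (fun k h => sS k (leqW h)) (leqnn K).
have sKT : s K <= T := le_trans sKK sT.
rewrite big_ord_recr/= IH//; last by move=> k kK; apply: sS; rewrite ltnS ltnW.
rewrite -Rintegral_setU; first last.
- apply/disj_setPS => t /= -[]; rewrite !in_itv/= => /andP[_ h1] /andP[h2 _].
  by move: (lt_le_trans h2 h1); rewrite ltxx.
- rewrite -itv_bndbnd_setU ?bnd_simp ?s0K//.
  exact: integrable_itv_sub fi.
- exact: measurable_itv.
- exact: measurable_itv.
by rewrite -itv_bndbnd_setU ?bnd_simp ?s0K.
Qed.

Lemma integrable_itv_cst (u v c : R) (b0 b1 : bool) :
  mu.-integrable [set` Interval (BSide b0 u) (BSide b1 v)] (EFin \o (fun=> c)).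
Proof.
apply/integrableP; split; first exact: measurable_cst.
rewrite integral_cst//= lebesgue_measure_itv/=; case: ifP => _; rewrite ?mule0//.
by rewrite -EFinB -EFinM ltry.
Qed.

Lemma integrable_itv_sum (T : R) (d : nat) (f : 'I_d -> R -> R) :
  (forall i, mu.-integrable `[0, T] (EFin \o f i)) ->
  mu.-integrable `[0, T] (EFin \o (fun t => \sum_(i < d) f i t)).
Proof.
move=> fi.
have -> : (EFin \o (fun t => \sum_(i < d) f i t)) = (fun t => (\sum_(i < d) (f i t)%:E)%E).
  by apply/funext => w /=; rewrite sumEFin.
by apply: integrable_sum => // i _; exact: fi.
Qed.

Lemma integrable_itv_sum_norm (T : R) (d : nat) (f : 'I_d -> R -> R) :
  (forall i, mu.-integrable `[0, T] (EFin \o f i)) ->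
  mu.-integrable `[0, T] (EFin \o (fun t => \sum_(i < d) `|f i t|)).
Proof.
by move=> fi; apply: integrable_itv_sum => i; exact: integrable_abse (fi i).
Qed.

End integral_on_grid.

(** * Pathwise drift estimate on the cells *)

Section cell_estimate.
Context (R : realType) (d : nat) (T : R) (D I g : R -> R) (V Hs : R -> 'I_d -> R).
Context (beta gam q : R).
Local Notation mu := (@lebesgue_measure R).
Hypothesis ig : mu.-integrable `[0, T] (EFin \o g).
Hypothesis iV : forall i, mu.-integrable `[0, T] (EFin \o V^~ i).
Hypothesis iH : forall i, mu.-integrable `[0, T] (EFin \o Hs^~ i).
Hypothesis eqD : forall u v, 0 <= u -> u <= v -> v <= T ->
  D v - D u - (I v - I u) = - \int[mu]_(s in `[u, v]) g s.
Hypothesis dom : forall s, 0 <= s <= T -> 0 < D s ->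
  g s <= beta * D s + gam * \sum_(i < d) `|V s i|.
Hypothesis beta0 : 0 <= beta.
Hypothesis gam0 : 0 <= gam.
Hypothesis q0 : 0 <= q.

(** The error density when D t is replaced by a value within 2 q of it and V by Hs: 4 beta q comes
    from the Lipschitz constant of [hub], the last term from that of [hubd]. *)
Definition defect t : R := 4 * beta * q + gam * \sum_(i < d) `|V t i - Hs t i|
  + 2 * q * (gam * (\sum_(i < d) `|V t i|) + `|g t|).

Lemma defect_ge0 t : 0 <= defect t.
Proof.
by rewrite /defect !addr_ge0// mulr_ge0// ?mulr_ge0 ?addr_ge0 ?mulr_ge0 ?sumr_ge0.
Qed.

Let mT : measurable (`[0, T]%classic : set (measurableTypeR R)). Proof. exact: measurable_itv. Qed.

Lemma integrable_defect : mu.-integrable `[0, T] (EFin \o defect).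
Proof.
have iD (f h : R -> R) : mu.-integrable `[0, T] (EFin \o f) ->
    mu.-integrable `[0, T] (EFin \o h) -> mu.-integrable `[0, T] (EFin \o (fun t => f t + h t)).
  by move=> i1 i2; exact: (integrableD mT i1 i2).
have iZ (c : R) (f : R -> R) : mu.-integrable `[0, T] (EFin \o f) ->
    mu.-integrable `[0, T] (EFin \o (fun t => c * f t)).
  by move=> i1; exact: (integrableZl mT c i1).
apply: (iD); first apply: (iD).
- exact: integrable_itv_cst.
- apply: (iZ); apply: integrable_itv_sum => i.
  have := integrable_abse (integrableB mT (iV i) (iH i)).
  by apply: eq_integrable => //.
- apply: (iZ); apply: (iD); last exact: integrable_abse ig.
  by apply: (iZ); exact: integrable_itv_sum_norm.
Qed.

(** The drift bound is available only where D t > 0, but elsewhere [hubd] vanishes. It is therefore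
    used at D t first, with the weight [hubd (D t)], and moved to X afterwards. *)
Lemma cell_pointwise X u t (e : 'I_d -> R) : 0 <= t <= T ->
  `|X - D u| <= q -> `|D t - D u| <= q -> (forall i, Hs t i = e i) ->
  hubd X * g t <= 2 * beta * hub X + gam * (\sum_(i < d) `|e i|) * hubd X + defect t.
Proof.
move=> t0T XD Dt He; have [q0' [b0 g0]] := (q0, (beta0, gam0)).
have XDt : `|X - D t| <= 2 * q.
  have -> : X - D t = (X - D u) - (D t - D u) by ring.
  by apply: (le_trans (ler_normB _ _)); lra.
set v := \sum_(i < d) `|V t i|; set n := \sum_(i < d) `|e i|.
have v0 : 0 <= v by apply: sumr_ge0.
have ve : v <= n + \sum_(i < d) `|V t i - Hs t i|.
  rewrite /v /n -big_split/=; apply: ler_sum => i _; rewrite He.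
  by rewrite -{1}[V t i](subrK (e i)) addrC; exact: ler_normD.
have h1 : hubd (D t) * g t <= 2 * beta * hub (D t) + gam * (hubd (D t) * v).
  have [D0|D0] := leP (D t) 0.
    by rewrite hubd_le0// !mul0r mulr0 addr0 !mulr_ge0// hub_ge0.
  have := ler_wpM2l (hubd_ge0 (D t)) (dom t0T D0).
  have : beta * (hubd (D t) * D t) <= beta * (2 * hub (D t)).
    by rewrite ler_wpM2l// hubdM_le.
  rewrite -/v; lra.
have h2 : hubd X * g t <= hubd (D t) * g t + 2 * q * `|g t|.
  have : (hubd X - hubd (D t)) * g t <= 2 * q * `|g t|.
    apply: (le_trans (ler_norm _)); rewrite normrM ler_wpM2r//.
    exact: le_trans (hubd_lip _ _) XDt.
  lra.
have h3 : 2 * beta * hub (D t) <= 2 * beta * hub X + 4 * beta * q.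
  have : beta * hub (D t) <= beta * (hub X + 2 * q).
    rewrite ler_wpM2l//; apply: (le_trans (hub_lip _ X)); rewrite distrC; lra.
  lra.
have h4 : hubd (D t) * v <= hubd X * n + \sum_(i < d) `|V t i - Hs t i| + 2 * q * v.
  have : (hubd (D t) - hubd X) * v <= 2 * q * v.
    rewrite ler_wpM2r//; apply: (le_trans (ler_norm _)).
    by apply: (le_trans (hubd_lip _ _)); rewrite distrC.
  have : hubd X * v <= hubd X * (n + \sum_(i < d) `|V t i - Hs t i|).
    by rewrite ler_wpM2l// hubd_ge0.
  have : hubd X * (\sum_(i < d) `|V t i - Hs t i|) <= \sum_(i < d) `|V t i - Hs t i|.
    by rewrite ler_piMl ?hubd_le1 ?sumr_ge0.
  lra.
have h5 := ler_wpM2l g0 h4.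
rewrite /defect -/v; lra.
Qed.

Lemma cell_lower X u v (e : 'I_d -> R) : 0 <= u -> u < v -> v <= T ->
  `|X - D u| <= q -> (forall t, u < t <= v -> `|D t - D u| <= q) ->
  (forall t i, u < t <= v -> Hs t i = e i) ->
  - (\int[mu]_(t in `]u, v]) defect t) <=
  hubd X * (D v - D u - (I v - I u) + gam * (\sum_(i < d) `|e i|) * (v - u))
  + 2 * beta * (v - u) * hub X.
Proof.
move=> u0 uv vT XD Dt He.
have ii (f : R -> R) : mu.-integrable `[0, T] (EFin \o f) ->
    mu.-integrable `]u, v] (EFin \o f) by exact: integrable_itv_sub.
have iig := ii _ ig; have iid := ii _ integrable_defect.
have mI : measurable (`]u, v]%classic : set (measurableTypeR R)) by exact: measurable_itv.
rewrite eqD// ?(ltW uv)// -(Rintegral_itv_obnd_cbnd (r := u))//.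
set c := 2 * beta * hub X + gam * (\sum_(i < d) `|e i|) * hubd X.
have icst := integrable_itv_cst u v c false false.
have : \int[mu]_(t in `]u, v]) (hubd X * g t) <= \int[mu]_(t in `]u, v]) (c + defect t).
  apply: le_Rintegral => //.
  - exact: (integrableZl mI (hubd X) iig).
  - exact: (integrableD mI icst iid).
  - move=> t; rewrite /= in_itv/= => /andP[ut tv].
    apply: (cell_pointwise (u := u)) => //.
    + by rewrite (le_trans u0 (ltW ut)) (le_trans tv vT).
    + by apply: Dt; rewrite ut.
    + by move=> i; apply: He; rewrite ut.
rewrite RintegralZl// RintegralD// Rintegral_cst//= lebesgue_measure_itv/= lte_fin uv.
rewrite /= /c; lra.
Qed.

Lemma integral_defect (RV eV : R) : 0 <= T ->
  \int[mu]_(t in `[0, T]) `|g t| <= RV ->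
  \int[mu]_(t in `[0, T]) (\sum_(i < d) `|V t i|) <= RV ->
  \int[mu]_(t in `[0, T]) (\sum_(i < d) `|V t i - Hs t i|) <= eV ->
  \int[mu]_(t in `[0, T]) defect t <=
    4 * beta * q * T + gam * eV + 2 * q * (gam * RV + RV).
Proof.
move=> T0 hg hV hVH.
have iZ (c : R) (f : R -> R) : mu.-integrable `[0, T] (EFin \o f) ->
    mu.-integrable `[0, T] (EFin \o (fun t => c * f t)).
  by move=> i1; exact: (integrableZl mT c i1).
have iD (f h : R -> R) : mu.-integrable `[0, T] (EFin \o f) ->
    mu.-integrable `[0, T] (EFin \o h) -> mu.-integrable `[0, T] (EFin \o (fun t => f t + h t)).
  by move=> i1 i2; exact: (integrableD mT i1 i2).
have iabs : mu.-integrable `[0, T] (EFin \o (fun t => `|g t|)) by exact: integrable_abse ig.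
have iVs : mu.-integrable `[0, T] (EFin \o (fun t => \sum_(i < d) `|V t i|)).
  exact: integrable_itv_sum_norm.
have iVH : mu.-integrable `[0, T] (EFin \o (fun t => \sum_(i < d) `|V t i - Hs t i|)).
  apply: integrable_itv_sum => i; have := integrable_abse (integrableB mT (iV i) (iH i)).
  by apply: eq_integrable.
have icst := integrable_itv_cst 0 T (4 * beta * q) true false.
rewrite /defect RintegralD//; first last.
- by apply: (iZ); apply: (iD) => //; exact: (iZ).
- by apply: (iD) => //; exact: (iZ).
rewrite RintegralD//; last exact: (iZ).
have iVg : mu.-integrable `[0, T]
    (EFin \o (fun t => gam * (\sum_(i < d) `|V t i|) + `|g t|)).
  by apply: (iD) => //; exact: (iZ).
rewrite (RintegralZl gam mT iVH) (RintegralZl (2 * q) mT iVg).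
rewrite RintegralD//; last exact: (iZ).
rewrite (RintegralZl gam mT iVs) Rintegral_cst//= lebesgue_measure_itv/= lte_fin.
have -> : fine (if (0 < T)%R then T%:E + (- 0)%:E else 0%:E)%E = T.
  by case: ltP => [_|T0']; rewrite /= ?subr0//; apply/eqP; rewrite eq_le T0 T0'.
apply: lerD; first apply: lerD => //.
  exact: ler_wpM2l.
apply: ler_wpM2l; first by rewrite mulr_ge0.
by apply: lerD => //; exact: ler_wpM2l.
Qed.

Context (J : R -> R) (dl r : R) (K : nat) (s rho x : nat -> R) (e : nat -> 'I_d -> R).
Hypothesis s0 : 0 <= s 0.
Hypothesis sK : s K <= T.
Hypothesis sS : forall k, (k < K)%N -> s k < s k.+1.
Hypothesis qdl : q <= dl.
Hypothesis dl1 : dl <= 1.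
Hypothesis oscD : forall k t, (k < K)%N -> s k <= t <= s k.+1 -> `|D t - D (s k)| <= q / 2.
Hypothesis oscI : forall k t, (k < K)%N -> s k <= t <= s k.+1 -> `|I t - I (s k)| <= q / 2.
Hypothesis JI : forall t, 0 <= t <= T -> `|J t - I t| <= q / 2.
Hypothesis Hcell : forall k t i, (k < K)%N -> s k < t <= s k.+1 -> Hs t i = e k i.
Hypothesis xJ : forall k, (k < K)%N -> x k = J (s k.+1) - J (s k).
Hypothesis rho_r : forall j, (j < K)%N -> 0 <= rho j.+1 <= r.
Hypothesis r0 : 0 <= r.
Hypothesis small : r * \int[mu]_(t in `[0, T]) defect t <= dl.

(** The increments of D and I telescope, so the plain sum differs from D only through J - I at the
    current and the first node. Each such value is at most q / 2, whence the tolerance q required by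
    [pchi_good]. *)
Lemma pchi_grid : pchi (fun k => D (s k))
  (fun k => D (s k.+1) - D (s k) - (I (s k.+1) - I (s k))) x
  (fun k => \sum_(i < d) `|e k i|) (fun k => s k.+1 - s k) rho beta gam dl K = 1.
Proof.
have [q0' [qdl' dl1']] := (q0, (qdl, dl1)).
have dl0 : 0 <= dl by exact: le_trans q0 qdl.
have sT k : (k <= K)%N -> 0 <= s k <= T.
  move=> /(grid_range (fun k h => ltW (sS h)))/andP[h1 h2].
  by rewrite (le_trans s0 h1) (le_trans h2 sK).
have idef := integrable_defect.
apply: (pchi_good (q := q) (r := r)
   (e := fun k => \int[mu]_(t in `]s k, s k.+1]) defect t)) => //.
- move=> k kK; split; [|exact: rho_r|]; last first.
    by apply: Rintegral_ge0 => t _; exact: defect_ge0.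
  have kk : s k <= s k.+1 <= s k.+1 by rewrite lexx (ltW (sS kK)).
  have := oscD kK kk; have := oscI kK kk.
  move=> h1 h2; apply: (le_trans (ler_normB _ _)); lra.
- move=> k kK.
  have -> : D (s 0) + \sum_(j < k) (D (s j.+1) - D (s j) - (I (s j.+1) - I (s j)) + x j) - D (s k)
      = (J (s k) - I (s k)) - (J (s 0) - I (s 0)).
    elim: k kK => [|k IH] kK; first by rewrite big_ord0; ring.
    have := IH (ltnW kK); rewrite big_ord_recr/= xJ// => h; lra.
  have h1 := JI (sT k kK); have h2 := JI (sT 0 (leq0n K)).
  apply: (le_trans (ler_normB _ _)); lra.
- move=> k kK X XD.
  have [/andP[u0 _] /andP[_ vT]] := (sT k (ltnW kK), sT k.+1 kK).
  apply: (cell_lower u0 (sS kK) vT XD).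
    move=> t /andP[h1 h2]; apply: (le_trans (oscD kK _)); last by lra.
    by rewrite (ltW h1).
  by move=> t i; exact: Hcell.
- rewrite (sum_integral_cells idef s0 sK); last by move=> k kK; exact: ltW (sS kK).
  apply: le_trans small; apply: ler_wpM2l => //.
  have mI : measurable (`]s 0, s K]%classic : set (measurableTypeR R)) by exact: measurable_itv.
  rewrite /Rintegral fine_le//.
  - by apply: (integrable_fin_num mI); exact: integrable_itv_sub idef.
  - exact: (integrable_fin_num mT).
  - apply: ge0_subset_integral => //.
    + by have /integrableP[] := idef.
    + by move=> t _; rewrite lee_fin defect_ge0.
    + by apply: subset_itv; rewrite bnd_simp.
Qed.

End cell_estimate.

(** * Measurability *)

Lemma measurable_pair_dom (d0 d1 d2 : measure_display) (X : measurableType d0)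
    (X1 : measurableType d1) (X2 : measurableType d2) (D : set X)
    (f : X -> X1) (g : X -> X2) :
  measurable_fun D f -> measurable_fun D g ->
  measurable_fun D (fun x => (f x, g x)).
Proof.
move=> mf mg mD A mA.
apply: (@smallest_sub _ _ _ [set A : set (X1 * X2)%type |
  measurable (D `&` (fun x => (f x, g x)) @^-1` A)]) mA => /=.
- split=> /=.
  + by rewrite preimage_set0 setI0; exact: measurable0.
  + move=> B mB; rewrite setTD (_ : _ `&` _ = D `\` (D `&` (fun x => (f x, g x)) @^-1` B)).
      exact: measurableD.
    by apply/seteqP; split=> x /=; [move=> [h1 h2]; split=> // -[]|move=> [h1 h2]; split=> // h3; exact: h2].
  + move=> B mB; rewrite preimage_bigcup setI_bigcupr.
    by apply: bigcupT_measurable => n; exact: mB.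
- move=> _ [[B mB <-]|[B mB <-]] /=; rewrite setTI.
  + exact: mf.
  + exact: mg.
Qed.

Section progressive.
Context (R : realType) (disp : measure_display) (Omega : measurableType disp).
Context (P : probability Omega R) (d : nat) (T : R).
Context (W : R -> Omega -> 'rV[R]_d).
Hypothesis completeP : measure_is_complete P.
Hypothesis bm : brownian_motion P T W.

Local Notation Fil := (augmented_filtration P W).
Local Notation dom := ([set x | 0 <= x.2 <= T] : set (Omega * R)).

Let domE : dom = [set: Omega] `*` `[0, T].
Proof.
by apply/seteqP; split => -[w s] /=; rewrite in_itv/=; [move=> ->|move=> [_ ->]].
Qed.

Lemma measurable_dom : measurable dom.
Proof. by rewrite domE; apply: measurableX => //; exact: measurable_itv. Qed.

Lemma Prog_dom : <<s Prog T Fil>> dom.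
Proof.
apply: sub_sigma_algebra => t /andP[t0 tT].
have -> : dom `&` ([set: Omega] `*` `[0, t]) = setT `*` `[0, t].
  apply/seteqP; split => -[w s] /=; rewrite ?in_itv/=; first by case.
  by move=> [_ /andP[s0 st]]; rewrite s0 (le_trans st tT) st.
apply: sub_sigma_algebra; exists setT; last by exists `[0, t]%classic => //; exact: measurable_itv.
rewrite -FilE; have [h0 hC _] := smallest_sigma_algebra setT (Fil t).
by have := hC _ h0; rewrite setD0.
Qed.

(** Sets in [Prog] are arbitrary at times outside [0, T], so only the trace can be measurable; for
    generators it is the instance t = T of the definition. *)
Lemma Prog_measurable (A : set (Omega * R)) : 0 <= T ->
  <<s Prog T Fil>> A -> measurable (A `&` dom).
Proof.
move=> T0; apply: (@smallest_sub _ _ _ [set A | measurable (A `&` dom)]).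
- split=> /=.
  + by rewrite set0I; exact: measurable0.
  + move=> B mB; rewrite (_ : _ `&` _ = dom `\` (B `&` dom)).
      by apply: measurableD => //; exact: measurable_dom.
    apply/seteqP; split => x /=; first by move=> [[_ h1] h2]; split=> // -[].
    by move=> [h1 h2]; split=> //; split=> // h3; apply: h2.
  + by move=> B mB; rewrite setI_bigcupl; apply: bigcupT_measurable => n; exact: mB.
- move=> B /(_ T); rewrite T0 lexx => /(_ isT); rewrite -domE.
  apply: smallest_sub; first exact: sigma_algebra_measurable.
  move=> _ [C FC [E mE <-]]; apply: measurableX => //.
  by apply: (Fil_measurable completeP bm (lexx T)); rewrite FilE.
Qed.

Lemma progressive_joint (dE : measure_display) (E : measurableType dE)
    (X : R -> Omega -> E) : 0 <= T -> progressive_meas T Fil X ->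
  measurable_fun dom (fun x => X x.2 x.1).
Proof.
move=> T0 pX _ B mB.
have := pX Prog_dom B mB => /(Prog_measurable T0).
by rewrite setIAC setIid.
Qed.

Lemma Prog_section w : 0 <= T ->
  measurable_fun `[0, T] ((fun s => (w, s)) : R -> ProgT T Fil).
Proof.
move=> T0 _ A mA.
have := measurable_xsection w (Prog_measurable T0 mA).
congr measurable; apply/seteqP; split => s /=.
  by rewrite /xsection/= inE/= in_itv/= => -[].
by rewrite in_itv/= => -[h1 h2]; rewrite /xsection/= inE/=.
Qed.

Lemma progressive_section (dE : measure_display) (E : measurableType dE)
    (X : R -> Omega -> E) w : 0 <= T -> progressive_meas T Fil X ->
  measurable_fun `[0, T] (fun s => X s w).
Proof.
move=> T0 pX.
apply: (measurable_comp (F := dom : set (ProgT T Fil)) _ _ pX (Prog_section w T0)).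
- exact: Prog_dom.
- by move=> _ [s + <-]; rewrite /= in_itv.
Qed.

Lemma generator_section (F : Omega -> R -> R -> 'rV[R]_d -> R) w
    (y : R -> R) (z : R -> 'rV[R]_d) : 0 <= T -> generator P T W F ->
  measurable_fun `[0, T] y ->
  measurable_fun `[0, T] (z : R -> rV_borel R d) ->
  measurable_fun `[0, T] (fun s => F w s (y s) (z s)).
Proof.
move=> T0 gF my mz.
pose psi s : (ProgT T Fil * R * rV_borel R d)%type := ((w, s), y s, z s).
have mpsi : measurable_fun `[0, T] psi.
  apply: measurable_pair_dom => //; apply: measurable_pair_dom => //.
  exact: Prog_section.
have mE : measurable ([set x | 0 <= x.1.1.2 <= T] : set (ProgT T Fil * R * rV_borel R d)%type).
  have -> : [set x | 0 <= x.1.1.2 <= T] =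
     ((dom : set (ProgT T Fil)) `*` [set: R]) `*` [set: rV_borel R d].
    by apply/seteqP; split=> -[[x y'] z'] //= [[]].
  apply: measurableX => //; apply: measurableX => //.
  exact: Prog_dom.
apply: (measurable_comp mE _ gF mpsi).
by move=> _ [s + <-]; rewrite /= in_itv.
Qed.

Lemma measurable_integral_dom (g : Omega * R -> R) :
  measurable_fun dom g -> (forall x, 0 <= g x) ->
  measurable_fun [set: Omega]
    (fun w => \int[lebesgue_measure]_(s in `[0%R, T]) (g (w, s))%:E)%E.
Proof.
move=> mg g0.
have mr : measurable_fun [set: Omega * R] ((EFin \o g) \_ dom).
  apply: (measurable_restrictT _ measurable_dom).1.
  exact/measurable_EFinP.
have r0 x : (0 <= ((EFin \o g) \_ dom) x)%E.
  by rewrite /patch; case: ifP => // _; rewrite lee_fin.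
have := measurable_fun_fubini_tonelli_F (m2 := lebesgue_measure) ((EFin \o g) \_ dom) mr r0.
congr measurable_fun; apply/funext => w.
rewrite [RHS]integral_mkcond; apply: eq_integral => s _.
by rewrite /patch !mem_setE in_itv.
Qed.

Lemma sp_time_bounds H k : is_simple_process P T W H -> (k <= sp_size H)%N ->
  0 <= sp_time H k <= T.
Proof.
move=> [[t0 tT] inc _ _] /(grid_range inc)/andP[h1 h2].
by rewrite (le_trans t0 h1) (le_trans h2 tT).
Qed.

Lemma measurable_sp_val H k i : is_simple_process P T W H -> (k < sp_size H)%N ->
  measurable_fun [set: Omega] (fun w => sp_val H k w ord0 i).
Proof.
move=> sH kn; have /andP[_ kT] := sp_time_bounds sH (ltnW kn).
apply: (meas_wrt_sub (Fil_measurable completeP bm kT)).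
by apply: meas_wrt_rV_coord; case: sH => _ _ + _; exact.
Qed.

Lemma measurable_W_coord t i : 0 <= t <= T ->
  measurable_fun [set: Omega] (fun w => W t w ord0 i).
Proof.
move=> /andP[t0 tT]; apply: (meas_wrt_sub (Fil_measurable completeP bm tT)).
exact: meas_wrt_W.
Qed.

Lemma measurable_sp_integral H t : is_simple_process P T W H -> 0 <= t <= T ->
  measurable_fun [set: Omega] (sp_integral W H t).
Proof.
move=> sH /andP[t0 tT]; apply: measurable_sum => k.
have b j : (j <= sp_size H)%N -> 0 <= Num.min (sp_time H j) t <= T.
  by move=> /(sp_time_bounds sH)/andP[j0 jT]; rewrite le_min j0 t0 ge_min jT.
apply: measurable_sum => i; apply: measurable_funM; first exact: measurable_sp_val.
under eq_fun do rewrite !mxE.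
by apply: measurable_funB; apply: measurable_W_coord; apply: b => //; exact: ltnW.
Qed.

Lemma measurable_sp_process_dist H (Z : R -> Omega -> 'rV[R]_d) : 0 <= T ->
  is_simple_process P T W H -> progressive_meas T Fil (Z : R -> Omega -> rV_borel R d) ->
  measurable_fun [set: Omega] (fun w => \int[lebesgue_measure]_(s in `[0%R, T])
     (enorm (sp_process H s w - Z s w) ^+ 2)%:E)%E.
Proof.
move=> T0 sH pZ.
apply: (@measurable_integral_dom (fun x => enorm (sp_process H x.2 x.1 - Z x.2 x.1) ^+ 2)).
  rewrite (_ : (fun _ => _) = fun x => \sum_(i < d)
      (sp_process H x.2 x.1 ord0 i - Z x.2 x.1 ord0 i) ^+ 2); last first.
    by apply/funext => x; rewrite sqr_enorm; apply: eq_bigr => i _; rewrite !mxE.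
  apply: measurable_sum => i; apply: measurable_funX.
  apply: measurable_funB; last first.
    exact: (measurableT_comp (measurable_rV_coord i) (progressive_joint T0 pZ)).
  rewrite (_ : (fun _ => _) = fun x => \sum_(k < sp_size H)
      (if sp_time H k < x.2 <= sp_time H k.+1 then sp_val H k x.1 else 0) ord0 i); last first.
    by apply/funext => x; rewrite /sp_process summxE.
  apply: measurable_sum => k.
  rewrite (_ : (fun _ => _) = fun x => sp_val H k x.1 ord0 i *
      \1_(`]sp_time H k, sp_time H k.+1] : set (measurableTypeR R)) x.2); last first.
    apply/funext => x; rewrite indicE mem_setE in_itv/=.
    by case: ifP => _; rewrite ?mulr1// mxE mulr0.
  apply: measurable_funTS; apply: measurable_funM.
    exact: (measurableT_comp (measurable_sp_val i sH (ltn_ord k)) measurable_fst).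
  apply: (measurableT_comp _ measurable_snd).
  exact: measurable_indic.
by move=> x; exact: sqr_ge0.
Qed.

Lemma within_itv_cont (f : R -> R) t e : {within `[0, T], continuous f} ->
  0 <= t <= T -> 0 < e ->
  exists2 dd, 0 < dd & forall s, 0 <= s <= T -> `|t - s| < dd -> `|f t - f s| < e.
Proof.
move=> /subspace_continuousP cf tT e0.
have tA : `[0, T]%classic t by rewrite /= in_itv.
have /cvgrPdist_lt/(_ e e0) := cf t tA.
rewrite near_withinE => /nbhs_ballP[dd/= dd0 H]; exists dd => // s sT ts.
by apply: H => //; rewrite /= in_itv.
Qed.

(** On a continuous path the supremum may be taken over countably many times; the remaining
    scenarios form a negligible set, measurable by completeness. *)
Lemma measurable_sup_process (G : R -> Omega -> R) (e : R) : 0 <= T ->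
  (forall t, 0 <= t <= T -> measurable_fun [set: Omega] (G t)) ->
  {ae P, forall w, {within `[0, T], continuous (fun t => G t w)}} ->
  measurable [set w | (e%:E <= sup_process T G w)%E].
Proof.
move=> T0 mG cG; have [mC _] := ae_measurable completeP cG.
(* An enumeration of the rationals clamped to [0, T]; a code of no rational yields the time 0. *)
pose u n : R := Num.max 0 (Num.min T (oapp ratr 0 (unpickle n : option rat))).
have uT n : 0 <= u n <= T by rewrite /u le_max lexx ge_max T0 ge_min lexx.
pose S w := esups (fun n => `|G (u n) w|%:E) 0.
have mS : measurable_fun [set: Omega] S.
  apply: measurable_fun_esups => n; apply/measurable_EFinP.
  by apply: measurableT_comp => //; exact: mG.
set C := [set w | _] in mC.
have SE w : C w -> sup_process T G w = S w.
  move=> cw; apply/eqP; rewrite eq_le; apply/andP; split; last first.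
    apply: ge_ereal_sup => _ [n _ <-]; apply: ereal_sup_ubound.
    by exists (u n) => //; rewrite /= in_itv /= uT.
  apply: ge_ereal_sup => _ [t + <-]; rewrite /= in_itv/= => tT.
  apply/lee_addgt0Pr => eps eps0.
  have [dd dd0 H] := within_itv_cont cw tT eps0.
  have [q] := rat_in_itvoo (ltr_pwDr dd0 (lexx t)).
  rewrite in_itv/= => /andP[tq qt].
  have : `|t - u (pickle q)| < dd.
    rewrite /u pickleK/=; case/andP: tT => t0 tT.
    rewrite max_r; last by rewrite le_min T0 (le_trans t0 (ltW tq)).
    have [h|h] := leP T (ratr q); rewrite ltr_norml; apply/andP; split; lra.
  move=> /(H _ (uT _)) h.
  apply: (@le_trans _ _ (`|G (u (pickle q)) w|%:E + eps%:E)%E).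
    rewrite -EFinD lee_fin; have := ler_normD (G t w - G (u (pickle q)) w) (G (u (pickle q)) w).
    rewrite subrK; lra.
  apply: leeD2r; apply: ereal_sup_ubound.
  by exists (pickle q).
rewrite (_ : [set w | _] = ([set w | (e%:E <= S w)%E] `&` C) `|`
   ([set w | (e%:E <= sup_process T G w)%E] `&` ~` C)); last first.
  apply/seteqP; split => w /=.
    by move=> h; have [c|c] := pselect (C w); [left; rewrite -SE|right].
  by case=> -[h c] //; rewrite SE.
apply: measurableU.
  apply: measurableI => //; rewrite -[X in measurable X]setTI.
  exact: (emeasurable_fun_c_infty measurableT mS).
apply: (negligible_measurable completeP); apply: negligibleS cG.
by move=> w [].
Qed.

End progressive.

(** * Outer measure of sets of good paths *)

(** Heine's theorem, from the near-covering form of compactness with the modulus as the parameter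
    tending to 0 from the right. *)
Lemma within_itv_unif_cont (R : realType) (T : R) (f : R -> R) (e : R) :
  {within `[0, T], continuous f} -> 0 < e ->
  exists2 dd, 0 < dd & forall s t, 0 <= s <= T -> 0 <= t <= T -> `|s - t| <= dd ->
    `|f s - f t| <= e.
Proof.
move=> cf e0.
have /compact_near_coveringP/near_covering_withinP := @segment_compact R 0 T.
move=> /(_ R (at_right 0) (fun dd s => forall t, 0 <= t <= T -> `|s - t| <= dd ->
    `|f s - f t| <= e)).
case.
  move=> x; rewrite /= in_itv/= => xT.
  have e2 : 0 < e / 2 by rewrite divr_gt0.
  have [dd dd0 H] := within_itv_cont cf xT e2.
  have dd2 : 0 < dd / 2 by rewrite divr_gt0.
  near=> s r => /= sT t tT st.
  have xs : `|x - s| < dd / 2 by near: s; exact: nbhsx_ballx.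
  have rd : r < dd / 2 by near: r; exact: nbhs_right_lt.
  rewrite in_itv/= in sT.
  have xt : `|x - t| < dd.
    by have := ler_normD (x - s) (s - t); rewrite addrA subrK; lra.
  have h1 := H s sT; have h2 := H t tT xt.
  have {}h1 := h1 (lt_trans xs (ltac:(lra) : dd / 2 < dd)).
  have := ler_normB (f x - f t) (f x - f s).
  rewrite (_ : f x - f t - (f x - f s) = f s - f t); last by ring.
  lra.
move=> E /= E0 H.
exists (E / 2); first by rewrite divr_gt0.
move=> s t sT tT st.
apply: (H (E / 2) _ _ s) => //=.
- by rewrite sub0r normrN gtr0_norm ?divr_gt0//; lra.
- by rewrite divr_gt0.
Unshelve. all: by end_near.
Qed.

Section thick.
Context (disp : measure_display) (Omega : measurableType disp) (R : realType).
Context (P : probability Omega R).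

(* The outer measure of [A] exceeds [c]: the value of [P] on a non-measurable
   set is meaningless, and the sets of good paths below need not be measurable. *)
Definition thick (c : R) (A : set Omega) : Prop :=
  forall M, measurable M -> A `<=` M -> (c%:E < P M)%E.

Lemma thick_sub c (A B : set Omega) : A `<=` B -> thick c A -> thick c B.
Proof. by move=> AB tA M mM BM; apply: tA => // w /AB/BM. Qed.

(** Continuity of the outer measure along increasing sets. If all A n had measurable covers of
    probability at most c, the intersections of the covers from n on would be increasing, would
    still cover A n, and their union would have probability at most c. *)
Lemma thick_bigcup c (A : (set Omega)^nat) : {homo A : n m / (n <= m)%N >-> n `<=` m} ->
  forall c', c < c' -> thick c' (\bigcup_n A n) -> exists n, thick c (A n).
Proof.
move=> ndA c' cc' tA; apply: contrapT => /forallNP H.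
have {H} : forall n, exists M, [/\ measurable M, A n `<=` M & (P M <= c%:E)%E].
  move=> n; have /existsNP [M /not_implyP [mM /not_implyP [AM /negP]]] := H n.
  by rewrite -leNgt => h; exists M.
move=> /choice [M HM].
pose N n := \bigcap_(k in [set k | (n <= k)%N]) M k.
have mN n : measurable (N n).
  by apply: bigcap_measurable => [|k _]; [exists n => /=|have [] := HM k].
have ndN : nondecreasing_seq N.
  move=> n m nm; apply/subsetPset => w Nw k /= mk; apply: Nw; exact: leq_trans mk.
have AN n : A n `<=` N n.
  by move=> w Aw k /= nk; have [_ + _] := HM k; apply; exact: ndA Aw.
have mU : measurable (\bigcup_n N n) by exact: bigcupT_measurable.
have := tA _ mU (subset_bigcup (fun n _ => AN n)).
apply/negP; rewrite -leNgt.
apply: (@le_trans _ _ c%:E); last by rewrite lee_fin ltW.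
have := nondecreasing_cvg_mu mN mU ndN (mu := P) => cv.
rewrite -(cvg_lim _ cv)//; apply: lime_le; first by apply/cvg_ex; eexists; exact: cv.
near=> n; have [mM _ h] := HM n; apply: le_trans h.
by apply: le_measure; rewrite ?inE//; apply: bigcap_inf => /=.
Unshelve. all: by end_near.
Qed.

Lemma thick_setD c e (A E : set Omega) : thick c A -> measurable E ->
  (P E <= e%:E)%E -> thick (c - e) (A `\` E).
Proof.
move=> tA mE PE M mM AM.
have mU : measurable (M `|` E) by exact: measurableU.
have /(tA _ mU) : A `<=` M `|` E.
  by move=> w Aw; have [h|h] := pselect (E w); [right|left; apply: AM].
move=> h; have : (c%:E < P M + e%:E)%E.
  have hU : (P (M `|` E) <= P M + P E)%E by exact: measureU2.
  apply: (lt_le_trans h); apply: (le_trans hU).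
  exact: leeD2l.
by rewrite -lteBlDr// -EFinB.
Qed.

Lemma thick_ae c (Q : Omega -> Prop) : c < 1 -> measure_is_complete P ->
  {ae P, forall w, Q w} -> thick c [set w | Q w].
Proof.
move=> c1 cP aeQ M mM QM; have [mQ PQ] := ae_measurable cP aeQ.
apply: (@lt_le_trans _ _ 1%E); first by rewrite lte_fin.
by rewrite -PQ; apply: le_measure; rewrite ?inE.
Qed.

End thick.

(** * Small expectation of the Huber function *)

Lemma integrable_sp_process (R : realType) (disp : measure_display)
    (Omega : measurableType disp) (d : nat) (T : R) (H : simple_process R Omega d) w i :
  lebesgue_measure.-integrable `[0, T] (EFin \o (fun t => sp_process H t w ord0 i)).
Proof.
have mT : measurable (`[0, T]%classic : set (measurableTypeR R)) by exact: measurable_itv.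
rewrite (_ : EFin \o _ = fun t => (\sum_(k < sp_size H)
    ((sp_val H k w ord0 i * \1_(`]sp_time H k, sp_time H k.+1] : set (measurableTypeR R)) t)%:E))%E); last first.
  apply/funext => t; rewrite /= /sp_process summxE -sumEFin; apply: eq_bigr => k _.
  rewrite indicE mem_setE in_itv/=; congr EFin.
  by case: ifP => _; rewrite ?mulr1// mxE mulr0.
apply: integrable_sum => // k _.
apply: (integrableZl mT (sp_val H k w ord0 i)
  (f := EFin \o \1_(`]sp_time H k, sp_time H k.+1] : set (measurableTypeR R)))).
apply: (le_integrable mT (g := EFin \o (fun _ : R => 1 : R))).
- by apply: measurable_funTS; apply/measurable_EFinP; exact: measurable_indic.
- move=> t _; rewrite /= lee_fin normr1 indicE.
  by case: (_ \in _); rewrite ?normr1 ?normr0.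
- exact: integrable_itv_cst.
Qed.

Lemma tilted_bound_mono (R : realType) (rr r dl e C S1 T ib k dd S2 dT : R) :
  0 <= rr <= r -> 0 <= dl -> 0 <= e -> 0 <= C -> S1 <= T -> 0 <= ib -> 0 <= k ->
  0 <= dd -> 0 <= S2 <= dT ->
  rr * (3 * dl + e * expR (C * S1) + e^-1 * ib + k * (dd * S2)) <=
  r * (3 * dl + e * expR (C * T) + e^-1 * ib + k * (dd * dT)).
Proof.
move=> /andP[rr0 rr1] dl0 e0 C0 ST ib0 k0 dd0 /andP[S0 S2T].
have h1 : 0 <= e * expR (C * S1) by rewrite mulr_ge0// expR_ge0.
have h2 : 0 <= e^-1 * ib by rewrite mulr_ge0// invr_ge0.
have h3 : 0 <= k * (dd * S2) by rewrite mulr_ge0// mulr_ge0.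
have h4 : e * expR (C * S1) <= e * expR (C * T).
  by rewrite ler_wpM2l// ler_expR ler_wpM2l.
have h5 : k * (dd * S2) <= k * (dd * dT) by rewrite ler_wpM2l// ler_wpM2l.
by apply: ler_pM => //; lra.
Qed.

(** * The walk driven by Brownian increments *)

Section grid.
Context (R : realType) (disp : measure_display) (Omega : measurableType disp).
Context (P : probability Omega R) (d : nat) (T : R).
Context (W : R -> Omega -> 'rV[R]_d).
Hypothesis completeP : measure_is_complete P.
Hypothesis bm : brownian_motion P T W.
Hypothesis d0 : (0 < d)%N.
Context (D I : R -> Omega -> R) (H H' : simple_process R Omega d).
Context (K : nat) (s : nat -> R) (beta gam M delta : R).
Local Notation Fil := (augmented_filtration P W).
Hypothesis mD : forall t, 0 <= t <= T -> meas_wrt (Fil t) (D t).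
Hypothesis mI : forall t, 0 <= t <= T -> meas_wrt (Fil t) (I t).
Hypothesis sH : is_simple_process P T W H.
Hypothesis sH' : is_simple_process P T W H'.
Hypothesis s0 : 0 <= s 0.
Hypothesis sK : s K = T.
Hypothesis sS : forall k, (k < K)%N -> s k < s k.+1 <= s k + delta.
Hypothesis cH : forall k j, (k < K)%N -> (j <= sp_size H)%N ->
  s k < sp_time H j -> s k.+1 <= sp_time H j.
Hypothesis cH' : forall k j, (k < K)%N -> (j <= sp_size H')%N ->
  s k < sp_time H' j -> s k.+1 <= sp_time H' j.
Hypothesis HM : forall t w i, `|sp_process H t w ord0 i - sp_process H' t w ord0 i| <= M.
Hypothesis beta0 : 0 <= beta.
Hypothesis gam0 : 0 <= gam.
Hypothesis delta0 : 0 < delta.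
Hypothesis gdelta : 4 * gam * Num.sqrt delta * d%:R <= 1.
Hypothesis bdelta : 4 * beta * delta <= 1.

Definition gdt k : R := s k.+1 - s k.
Definition gU k (i : 'I_d) w : R := W (s k.+1) w ord0 i - W (s k) w ord0 i.
Definition geta k (i : 'I_d) w : R :=
  sp_process H (s k.+1) w ord0 i - sp_process H' (s k.+1) w ord0 i.
Definition ga k w : R := D (s k.+1) w - D (s k) w - (I (s k.+1) w - I (s k) w).
Definition gchi (dl : R) w : R :=
  wchi gdt gU geta (fun k => D (s k)) ga beta gam dl K w.

Lemma grid_bounds k : (k <= K)%N -> 0 <= s k <= T.
Proof.
have sS' j : (j < K)%N -> s j <= s j.+1 by move=> /sS/andP[/ltW].
by move=> /(grid_range sS')/andP[h1 h2]; rewrite (le_trans s0 h1) -sK.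
Qed.

Let gFF k := Fil (s k).

Let subF k : (k <= K)%N -> <<s gFF k>> `<=` measurable.
Proof. by move=> /grid_bounds/andP[_]; exact: Fil_measurable. Qed.

Let incF k : (k < K)%N -> <<s gFF k>> `<=` <<s gFF k.+1>>.
Proof.
by move=> kK; rewrite !FilE; apply: Fil_mono; case/andP: (sS kK) => /ltW.
Qed.

Let mU k i : (k < K)%N -> meas_wrt (gFF k.+1) (gU k i).
Proof.
move=> kK; have /andP[h1 _] := grid_bounds (ltnW kK).
have /andP[h2 _] := grid_bounds kK.
apply: meas_wrtB; first exact: meas_wrt_W.
apply: (meas_wrt_Fil_mono _ (meas_wrt_W (W := W) i h1)).
by case/andP: (sS kK) => /ltW.
Qed.

Let meta k i : (k < K)%N -> meas_wrt (gFF k) (geta k i).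
Proof.
move=> kK; apply: meas_wrtB.
- by apply: (meas_sp_process_cell sH) => j jK; exact: cH.
- by apply: (meas_sp_process_cell sH') => j jK; exact: cH'.
Qed.

Let mgD k : (k <= K)%N -> meas_wrt (gFF k) (D (s k)).
Proof. by move=> /grid_bounds; exact: mD. Qed.

Let mga k : (k < K)%N -> meas_wrt (gFF k.+1) (ga k).
Proof.
move=> kK; have b1 := grid_bounds (ltnW kK); have b2 := grid_bounds kK.
have [h _] := andP (sS kK).
apply: meas_wrtB; apply: meas_wrtB.
- exact: mD.
- by apply: (meas_wrt_Fil_mono _ (mD b1)); exact: ltW.
- exact: mI.
- by apply: (meas_wrt_Fil_mono _ (mI b1)); exact: ltW.
Qed.

Let sum_dt : \sum_(j < K) gdt j = T - s 0.
Proof.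
by rewrite -sK /gdt -(big_mkord predT (fun j => s j.+1 - s j)) telescope_sumr.
Qed.

Let gdt0 k : (k < K)%N -> 0 < gdt k.
Proof. by move=> kK; rewrite subr_gt0; case/andP: (sS kK). Qed.

Let gdt_delta k : (k < K)%N -> gdt k <= delta.
Proof. by move=> kK; rewrite lerBlDl; case/andP: (sS kK). Qed.

Lemma measurable_gchi dl : measurable_fun [set: Omega] (gchi dl).
Proof.
have [_ _ h] := meas_path gdt incF mU meta beta gam dl mgD mga (leqnn K).
exact: (meas_wrt_sub (subF (leqnn K)) h).
Qed.

Lemma grho_bound k : (k <= K)%N -> 0 <= rho gdt beta k <= expR (4 * beta * T).
Proof.
move=> kK; apply/andP; split.
  by apply: prodr_ge0 => j _; rewrite addr_ge0// mulr_ge0// ?mulr_ge0//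
     ltW// gdt0// (leq_trans (ltn_ord j)).
apply: (le_trans (rho_mono gdt0 beta0 kK)).
apply: (le_trans (rho_expR gdt0 beta0 (leqnn K))).
rewrite ler_expR ler_wpM2l// ?mulr_ge0// sum_dt.
by have := s0; lra.
Qed.

Lemma grid_estimate (B : Omega -> R) (p e dl : R) (m : nat) :
  P.-integrable setT (EFin \o D (s 0)) ->
  0 < dl <= 1 -> 0 < e <= 1 -> 1 <= M -> 1 <= m%:R * (p - 1) ->
  (forall w, 5 <= B w) -> P.-integrable setT (EFin \o (fun w => B w `^ p)) ->
  {ae P, forall w, D T w <= 0 /\ forall t, 0 <= t <= T -> D t w + 5 <= B w} ->
  \int[P]_w hub (D (s 0) w) <= expR (4 * beta * T) * (3 * dl +
    e * expR (tilt_cst R m.+1 * (4 * gam) ^+ 2 * d%:R ^+ 2 * T) +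
    e^-1 * \int[P]_w (B w `^ p * (1 - gchi dl w)) +
    overshoot_cst d M dl * (1024 * d%:R * (delta * T))).
Proof.
move=> iD0 dl01 e01 M1 mp B5 iBp DB.
have [dlp dl1] := andP dl01; have [ep e1] := andP e01.
have g4 : 0 <= 4 * gam by rewrite mulr_ge0.
have indU k : (k < K)%N -> forall (A : set Omega) (C : 'I_d -> set R),
    <<s gFF k>> A -> (forall i, measurable (C i)) ->
    P (A `&` [set w | forall i, C i (gU k i w)]) =
    (P A * \prod_(i < d) normal_prob 0%R (Num.sqrt (gdt k)) (C i))%E.
  move=> kK; have /andP[h1 _] := grid_bounds (ltnW kK).
  have /andP[_ h2] := grid_bounds kK; have /andP[h3 _] := sS kK.
  exact: (increment_indep completeP bm h1 h3 h2).
have cdt k : (k < K)%N -> 4 * gam * Num.sqrt (gdt k) * d%:R <= 1.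
  move=> kK; apply: le_trans gdelta; rewrite ler_wpM2r// ler_wpM2l//.
  by rewrite ler_wsqrtr// gdt_delta.
have bdt k : (k < K)%N -> 4 * beta * gdt k <= 1.
  move=> kK; apply: le_trans bdelta; rewrite ler_wpM2l ?mulr_ge0//.
  exact: gdt_delta.
have DB' : {ae P, forall w, D (s K) w <= 0 /\
    forall k, (k <= K)%N -> D (s k) w + 5 <= B w}.
  apply: filterS DB => w [h1 h2]; rewrite sK; split=> // k kK; apply: h2.
  exact: grid_bounds.
have := discrete_estimate subF incF gdt0 mU indU meta (fun k i w _ => HM (s k.+1) w i)
  g4 cdt mgD iD0 mga beta0 gam0 erefl bdt dl01 e01 M1 d0 mp B5 iBp DB'.
move=> h; apply: (le_trans h) => {h}.
have sT : \sum_(j < K) gdt j <= T by rewrite sum_dt; have := s0; lra.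
have chi0 w : 0 <= 1 - gchi dl w.
  have /andP[_ h] : 0 <= gchi dl w <= 1 by exact: pchi_ge0.
  by rewrite subr_ge0.
have iB0 : 0 <= \int[P]_w (B w `^ p * (1 - gchi dl w)).
  by apply: Rintegral_ge0 => w _; rewrite mulr_ge0// powR_ge0.
have k0 : 0 <= overshoot_cst d M dl by apply: overshoot_cst_ge0 => //.
have sdt0 : 0 <= \sum_(j < K) gdt j ^+ 2 by apply: sumr_ge0 => j _; exact: sqr_ge0.
apply: (tilted_bound_mono (grho_bound (leqnn K)) (ltW dlp) (ltW ep) _ sT iB0 k0).
- by rewrite mulr_ge0 ?sqr_ge0// mulr_ge0 ?sqr_ge0// tilt_cst_ge0.
- by apply: mulr_ge0; apply: ler0n.
(* The sum of squared cell lengths is at most the mesh times the total length. *)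
rewrite sdt0/=; apply: (@le_trans _ _ (\sum_(j < K) delta * gdt j)).
  apply: ler_sum => j _; rewrite expr2 ler_wpM2r//.
    by rewrite ltW// gdt0.
  exact: gdt_delta.
by rewrite -mulr_sumr ler_wpM2l// ltW.
Qed.

Lemma gchi_good (g : R -> R) (V : R -> 'I_d -> R) (q dl : R) w :
  lebesgue_measure.-integrable `[0, T] (EFin \o g) ->
  (forall i, lebesgue_measure.-integrable `[0, T] (EFin \o V^~ i)) ->
  (forall u v, 0 <= u -> u <= v -> v <= T ->
    D v w - D u w - (I v w - I u w) = - \int[lebesgue_measure]_(s in `[u, v]) g s) ->
  (forall s, 0 <= s <= T -> 0 < D s w ->
    g s <= beta * D s w + gam * \sum_(i < d) `|V s i|) ->
  0 <= q -> q <= dl -> dl <= 1 ->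
  (forall u v, 0 <= u <= T -> 0 <= v <= T -> `|u - v| <= delta ->
    `|D u w - D v w| <= q / 2 /\ `|I u w - I v w| <= q / 2) ->
  (forall t, 0 <= t <= T -> `|sp_integral W H t w - sp_integral W H' t w - I t w| <= q / 2) ->
  expR (4 * beta * T) * \int[lebesgue_measure]_(t in `[0, T]) defect g V
    (fun t i => sp_process H t w ord0 i - sp_process H' t w ord0 i) beta gam q t <= dl ->
  gchi dl w = 1.
Proof.
move=> ig iV eqD dom q0 qdl dl1 osc JI small.
have osc' k t : (k < K)%N -> s k <= t <= s k.+1 ->
    `|D t w - D (s k) w| <= q / 2 /\ `|I t w - I (s k) w| <= q / 2.
  move=> kK /andP[h1 h2]; have [/andP[k0 _] /andP[_ kT]] := (grid_bounds (ltnW kK), grid_bounds kK).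
  apply: osc.
  - by rewrite (le_trans k0 h1) (le_trans h2 kT).
  - exact: grid_bounds (ltnW kK).
  - have := gdt_delta kK; rewrite /gdt ger0_norm ?subr_ge0//; lra.
rewrite /gchi /wchi.
have iHs i : lebesgue_measure.-integrable `[0, T] (EFin \o (fun t =>
    sp_process H t w ord0 i - sp_process H' t w ord0 i)).
  apply: (integrableB _ (integrable_sp_process T H w i) (integrable_sp_process T H' w i)).
  exact: measurable_itv.
have sKT : s K <= T by rewrite sK.
apply: (pchi_grid (D := D ^~ w) (I := I ^~ w) ig iV iHs eqD dom beta0 gam0 q0
  (J := fun t => sp_integral W H t w - sp_integral W H' t w)
  (e := fun k i => geta k i w) (r := expR (4 * beta * T))) => //.
- by move=> k kK; case/andP: (sS kK).
- by move=> k t kK st; case: (osc' k t kK st).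
- by move=> k t kK st; case: (osc' k t kK st).
- move=> k t i kK st; rewrite /geta.
  have [ss _] := andP (sS kK).
  rewrite (sp_process_cell ss (fun j jK => cH kK jK))//.
  by rewrite (sp_process_cell ss (fun j jK => cH' kK jK)).
- move=> k kK; have [ss _] := andP (sS kK).
  rewrite /walk_step.
  have -> : sp_integral W H (s k.+1) w - sp_integral W H' (s k.+1) w -
     (sp_integral W H (s k) w - sp_integral W H' (s k) w) =
     (sp_integral W H (s k.+1) w - sp_integral W H (s k) w) -
     (sp_integral W H' (s k.+1) w - sp_integral W H' (s k) w) by ring.
  rewrite (sp_integral_cell sH ss (fun j jK => cH kK jK)).
  rewrite (sp_integral_cell sH' ss (fun j jK => cH' kK jK)).
  rewrite /dotp -sumrB; apply: eq_bigr => i _.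
  by rewrite /geta /gU !mxE mulrBl.
- by move=> j jK; exact: grho_bound.
Qed.

End grid.

(** The form in which the small parameters are chosen below; the 1 added to y covers the case y =
    0. *)
Lemma exists_fraction (R : realType) (x y : R) : 0 < x -> 0 <= y ->
  exists2 z : R, 0 < z <= 1 & y * z <= x.
Proof.
move=> x0 y0; exists (Num.min 1 (x / (y + 1))).
  by rewrite lt_min ltr01 divr_gt0 ?ge_min ?lexx//; lra.
have y1 : 0 < y + 1 by lra.
apply: (@le_trans _ _ (y * (x / (y + 1)))).
  by rewrite ler_wpM2l// ge_min lexx orbT.
by rewrite mulrA ler_pdivrMr// mulrC ler_wpM2l; lra.
Qed.

(** Unlike the set of good paths, the set where chi is 1 is measurable, so its complement has a
    genuine probability, below eps, and the absolute continuity of the integral applies to it. *)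
Lemma small_complement (disp : measure_display) (Omega : measurableType disp)
    (R : realType) (P : probability Omega R) (f chi : Omega -> R) (eps ei c : R) :
  (forall A, measurable A -> (P A < eps%:E)%E -> \int[P]_(x in A) `|f x| < ei) ->
  (forall w, 0 <= f w) -> measurable_fun setT chi ->
  (forall w, chi w = 0 \/ chi w = 1) ->
  (forall A, measurable A -> [set w | chi w = 1] = A -> (c%:E < P A)%E) ->
  1 - c <= eps ->
  \int[P]_w (f w * (1 - chi w)) <= ei.
Proof.
move=> H f0 mchi chi01 Hc ce.
have m1 : measurable [set w | chi w = 1].
  by rewrite -[X in measurable X]setTI; exact: (mchi measurableT [set 1]).
have PA : (P (~` [set w | chi w = 1%R]) < eps%:E)%E.
  rewrite probability_setC// (_ : P _ = (fine (P [set w | chi w = 1]))%:E); last first.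
    by rewrite fineK// fin_num_measure.
  rewrite -EFinB lte_fin; have := Hc _ m1 erefl.
  rewrite -[P _]fineK ?fin_num_measure// lte_fin; lra.
apply/ltW; apply: le_lt_trans (H _ (measurableC m1) PA).
rewrite [leRHS]Rintegral_mkcond le_eqVlt; apply/orP; left; apply/eqP; apply: eq_Rintegral => w _.
rewrite /patch; case: (chi01 w) => cw; rewrite cw.
  rewrite mem_set/= ?cw; last by move/eqP; rewrite eq_sym oner_eq0.
  by rewrite subr0 mulr1 ger0_norm.
by rewrite memNset//= ?subrr ?mulr0.
Qed.

Lemma three_quarters (R : realType) (x : R) : 0 < x -> 1 - (1 - x / 2 - x / 4) <= x.
Proof. lra. Qed.

Lemma four_quarters (R : realType) (r dl e C ei J Q nu : R) :
  r * 3 * dl <= nu / 4 -> r * C * e <= nu / 4 -> r * e^-1 * ei <= nu / 4 ->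
  r * e^-1 * J <= r * e^-1 * ei -> r * Q <= nu / 4 ->
  r * (3 * dl + e * C + e^-1 * J + Q) <= nu.
Proof. lra. Qed.

Lemma defect_budget (R : realType) (beta T gam N q' q : R) :
  0 <= beta -> 0 <= T -> 0 <= gam -> 0 <= N -> 0 <= q' -> q' <= q ->
  4 * beta * q' * T + gam * (q' / 2) + 2 * q' * (gam * N + N) <=
  (4 * beta * T + gam + 2 * (gam * N + N)) * q.
Proof.
move=> beta0 T0 gam0 N0 q'0 q'q.
have c0 : 0 <= 4 * beta * T + gam + 2 * (gam * N + N).
  by have := mulr_ge0 gam0 N0; have := mulr_ge0 beta0 T0; lra.
by have := ler_wpM2l c0 q'q; have := mulr_ge0 gam0 q'0; lra.
Qed.

(** * Choice of the parameters, comparison at a fixed time *)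

Section comparison.
Context (R : realType) (disp : measure_display) (Omega : measurableType disp).
Context (P : probability Omega R) (d : nat) (T : R).
Context (W : R -> Omega -> 'rV[R]_d).
Hypothesis completeP : measure_is_complete P.
Hypothesis bm : brownian_motion P T W.
Hypothesis d0 : (0 < d)%N.
Hypothesis T0 : 0 < T.
Context (D I g : R -> Omega -> R) (V : R -> Omega -> 'I_d -> R) (B : Omega -> R).
Context (beta gam p : R).
Local Notation Fil := (augmented_filtration P W).
Local Notation mu := (@lebesgue_measure R).
Hypothesis mD : forall t, 0 <= t <= T -> meas_wrt (Fil t) (D t).
Hypothesis mI : forall t, 0 <= t <= T -> meas_wrt (Fil t) (I t).
Hypothesis iD : forall t, 0 <= t <= T -> P.-integrable setT (EFin \o D t).
Hypothesis beta0 : 0 <= beta.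
Hypothesis gam0 : 0 <= gam.
Hypothesis p1 : 1 < p.
Hypothesis B5 : forall w, 5 <= B w.
Hypothesis iBp : P.-integrable setT (EFin \o (fun w => B w `^ p)).

Definition path_integrable w : Prop :=
  mu.-integrable `[0, T] (EFin \o g ^~ w) /\
  forall i, mu.-integrable `[0, T] (EFin \o (fun t => V t w i)).

Definition path_dynamics w : Prop :=
  (forall u v, 0 <= u -> u <= v -> v <= T ->
    D v w - D u w - (I v w - I u w) = - \int[mu]_(s in `[u, v]) g s w) /\
  (forall s, 0 <= s <= T -> 0 < D s w ->
    g s w <= beta * D s w + gam * \sum_(i < d) `|V s w i|).

Hypothesis good_integrable : {ae P, forall w, path_integrable w}.
Hypothesis good_dynamics : {ae P, forall w, path_dynamics w}.
Hypothesis good_D : {ae P, forall w, {within `[0, T], continuous (D ^~ w)}}.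
Hypothesis good_I : {ae P, forall w, {within `[0, T], continuous (I ^~ w)}}.
Hypothesis DB : {ae P, forall w, D T w <= 0 /\ forall t, 0 <= t <= T -> D t w + 5 <= B w}.
Hypothesis approx : forall e eps : R, 0 < e -> 0 < eps -> exists H H' : simple_process R Omega d,
  exists E, [/\ is_simple_process P T W H, is_simple_process P T W H', measurable E,
    (P E <= eps%:E)%E & forall w, ~ E w ->
    (forall t, 0 <= t <= T ->
       `|sp_integral W H t w - sp_integral W H' t w - I t w| <= e) /\
    \int[mu]_(t in `[0, T]) (\sum_(i < d)
       `|V t w i - (sp_process H t w ord0 i - sp_process H' t w ord0 i)|) <= e].

Let good w := [/\ path_integrable w, path_dynamics w,
  {within `[0, T], continuous (D ^~ w)} & {within `[0, T], continuous (I ^~ w)}].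

Let ae_good : {ae P, forall w, good w}.
Proof.
apply: filterS2 (filterI good_integrable good_dynamics) (filterI good_D good_I).
by move=> w [h1 h2] [h3 h4].
Qed.

Let bounded n w := [/\ good w, \int[mu]_(t in `[0, T]) `|g t w| <= n%:R &
  \int[mu]_(t in `[0, T]) (\sum_(i < d) `|V t w i|) <= n%:R].

Let thick_bounded (c c' : R) : c < c' -> c' < 1 -> exists n, thick P c [set w | bounded n w].
Proof.
move=> cc' c1.
apply: (thick_bigcup _ cc').
  move=> n m nm w [h1 h2 h3]; have nmR : n%:R <= m%:R :> R by rewrite ler_nat.
  by split=> //; [exact: le_trans h2 nmR|exact: le_trans h3 nmR].
apply: (thick_sub _ (thick_ae c1 completeP ae_good)) => w gw.
set x := \int[mu]_(t in `[0, T]) `|g t w|.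
set y := \int[mu]_(t in `[0, T]) (\sum_(i < d) `|V t w i|).
exists (Num.truncn (Num.max x y)).+1 => //.
have h : Num.max x y <= (Num.truncn (Num.max x y)).+1%:R by apply/ltW/truncnS_gt.
by move: h; rewrite ge_max => /andP[hx hy]; split.
Qed.

Let regular q n k w := bounded n w /\ forall u v, 0 <= u <= T -> 0 <= v <= T ->
  `|u - v| <= k.+1%:R^-1 -> `|D u w - D v w| <= q /\ `|I u w - I v w| <= q.

Let thick_regular (c c' q : R) n : 0 < q -> c < c' -> thick P c' [set w | bounded n w] ->
  exists k, thick P c [set w | regular q n k w].
Proof.
move=> q0 cc' tn.
apply: (thick_bigcup _ cc').
  move=> k l kl w [h1 h2]; split=> // u v uT vT uv; apply: h2 => //.
  by apply: (le_trans uv); rewrite lef_pV2 ?posrE ?ltr0n// ler_nat.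
apply: (thick_sub _ tn) => w bw.
have [[_ _ cD cI] _ _] := bw.
have [e1 e10 H1] := within_itv_unif_cont cD q0.
have [e2 e20 H2] := within_itv_unif_cont cI q0.
exists (Num.truncn (Num.max e1^-1 e2^-1)) => //; split=> // u v uT vT uv.
have : Num.max e1^-1 e2^-1 <= (Num.truncn (Num.max e1^-1 e2^-1)).+1%:R by apply/ltW/truncnS_gt.
rewrite ge_max => /andP[h1 h2]; split; [apply: H1 => //|apply: H2 => //].
- by apply: (le_trans uv); rewrite invf_ple ?posrE ?ltr0n.
- by apply: (le_trans uv); rewrite invf_ple ?posrE ?ltr0n.
Qed.

Lemma expected_hub_small t0 nu : 0 <= t0 < T -> 0 < nu ->
  \int[P]_w hub (D t0 w) <= nu.
Proof.
move=> /andP[t00 t0T] nu0.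
(* Each of the four terms of [grid_estimate] receives a quarter of nu, through [dl], [e], [ei] and
   [delta] in turn. *)
have nu4 : 0 < nu / 4 by rewrite divr_gt0.
have [m mp] : exists m : nat, 1 <= m%:R * (p - 1).
  have p10 : 0 < p - 1 by rewrite subr_gt0.
  exists (Num.truncn (p - 1)^-1).+1.
  by rewrite -ler_pdivrMr// mul1r; apply/ltW/truncnS_gt.
set r := expR (4 * beta * T).
have r0 : 0 <= r by exact: expR_ge0.
set C := expR (tilt_cst R m.+1 * (4 * gam) ^+ 2 * d%:R ^+ 2 * T).
have [dl dl01 dlnu] : exists2 z, 0 < z <= 1 & r * 3 * z <= nu / 4.
  by apply: exists_fraction => //; rewrite mulr_ge0.
have [e e01 enu] : exists2 z, 0 < z <= 1 & r * C * z <= nu / 4.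
  by apply: exists_fraction => //; rewrite mulr_ge0// expR_ge0.
have [dlp dl1] := andP dl01; have [ep e1] := andP e01.
have [ei ei01 einu] : exists2 z, 0 < z <= 1 & r * e^-1 * z <= nu / 4.
  by apply: exists_fraction => //; rewrite mulr_ge0// invr_ge0 ltW.
have [ei0 _] := andP ei01.
(* Scenarios of total probability below [eps] contribute less than [ei] to the integral of B ^ p. Of
   this [eps], 1/2 is spent on unbounded or irregular paths and 1/4 on the approximation of the Ito
   integrals. *)
have [eps [eps0 Heps]] := integral_normr_continuous iBp ei0.
have [n tn] : exists n, thick P (1 - eps / 4) [set w | bounded n w].
  by apply: (@thick_bounded _ (1 - eps / 8)); lra.
(* The coefficient is that of [defect_budget]: it keeps r times the integrated defect below [dl]. *)
have [q q01 qdl] : exists2 z, 0 < z <= 1 &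
    r * (4 * beta * T + gam + 2 * (gam * n%:R + n%:R)) * z <= dl.
  apply: exists_fraction => //; apply: mulr_ge0 => //.
  have := mulr_ge0 gam0 (ler0n R n); have := mulr_ge0 beta0 (ltW T0).
  by have := ler0n R n; have := gam0; lra.
pose q' := Num.min q dl.
have q'0 : 0 < q' by rewrite lt_min dlp; case/andP: q01 => ->.
have q2 : 0 < q' / 2 by rewrite divr_gt0.
have [H [H' [E [sH sH' mE PE HE]]]] := approx q2 (ltac:(lra) : 0 < eps / 4).
have [k tk] : exists k, thick P (1 - eps / 2) [set w | regular (q' / 2) n k w].
  by apply: (@thick_regular _ (1 - eps / 4)) => //; lra.
have tG := thick_setD tk mE PE.
have [MH MH0 HMH] := sp_process_bound sH.
have [MH' MH'0 HMH'] := sp_process_bound sH'.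
pose M := 1 + MH + MH'.
have HM t w i : `|sp_process H t w ord0 i - sp_process H' t w ord0 i| <= M.
  apply: (le_trans (ler_normB _ _)); have := HMH t w i; have := HMH' t w i.
  by rewrite /M; lra.
(* The mesh comes last: it must beat the modulus k of the paths and [overshoot_cst], which depends
   on the bound M of the simple processes. The square of z0 answers the condition on the root of
   delta. *)
have [delta [delta0 dk dg db dnu]] : exists delta : R, [/\ 0 < delta,
    delta <= k.+1%:R^-1, 4 * gam * Num.sqrt delta * d%:R <= 1, 4 * beta * delta <= 1 &
    r * (overshoot_cst d M dl * (1024 * d%:R * (delta * T))) <= nu / 4].
  have dT0 : 0 <= 1024 * d%:R * T :> R by apply: mulr_ge0 (ltW T0); apply: mulr_ge0; apply: ler0n.
  have k0 : 0 <= overshoot_cst d M dl by apply: overshoot_cst_ge0 => //; rewrite /M; lra.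
  have [z0 /andP[z00 z01] hz0] := exists_fraction ltr01 (mulr_ge0 (mulr_ge0 (ler0n R 4) gam0) (ler0n R d)).
  have [z1 /andP[z10 z11] hz1] := exists_fraction ltr01 (mulr_ge0 (ler0n R 4) beta0).
  have [z2 /andP[z20 z21] hz2] := exists_fraction nu4 (mulr_ge0 r0 (mulr_ge0 k0 dT0)).
  pose delta := Num.min (Num.min k.+1%:R^-1 (z0 ^+ 2)) (Num.min z1 z2).
  have [h1 h2 h3 h4] : [/\ delta <= k.+1%:R^-1, delta <= z0 ^+ 2, delta <= z1 & delta <= z2].
    by split; rewrite /delta !ge_min lexx ?orbT.
  have delta0 : 0 < delta by rewrite /delta !lt_min z10 z20 exprn_gt0// invr_gt0 ltr0n.
  exists delta; split=> //.
  - apply: le_trans hz0; rewrite -mulrA [_ * d%:R]mulrC mulrA ler_wpM2l//.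
      by rewrite mulr_ge0// mulr_ge0.
    by rewrite -(gtr0_norm z00) -sqrtr_sqr ler_wsqrtr.
  - by apply: le_trans hz1; rewrite ler_wpM2l// mulr_ge0.
  - apply: le_trans hz2; move: dT0 k0; move: (overshoot_cst _ _ _) (1024 * _) => Q dd dT0 k0.
    have -> : r * (Q * (dd * (delta * T))) = r * (Q * (dd * T)) * delta by ring.
    by rewrite ler_wpM2l//; apply: mulr_ge0 => //; exact: mulr_ge0.
pose L := [seq sp_time H j | j <- iota 0 (sp_size H).+1] ++
          [seq sp_time H' j | j <- iota 0 (sp_size H').+1].
have [K [s [s0 sK sS sL]]] := fine_grid_through L t0T delta0.
have cH k' j : (k' < K)%N -> (j <= sp_size H)%N ->
    s k' < sp_time H j -> s k'.+1 <= sp_time H j.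
  move=> kK jH; apply: sL => //; rewrite mem_cat; apply/orP; left.
  by apply: map_f; rewrite mem_iota.
have cH' k' j : (k' < K)%N -> (j <= sp_size H')%N ->
    s k' < sp_time H' j -> s k'.+1 <= sp_time H' j.
  move=> kK jH; apply: sL => //; rewrite mem_cat; apply/orP; right.
  by apply: map_f; rewrite mem_iota.
have s00 : 0 <= s 0 by rewrite s0.
have M1 : 1 <= M by rewrite /M; lra.
have iD0 : P.-integrable setT (EFin \o D (s 0)).
  by apply: iD; rewrite s0 t00 ltW.
have := grid_estimate completeP bm d0 mD mI sH sH' s00 sK sS cH cH' HM beta0 gam0
  delta0 dg db iD0 dl01 e01 M1 mp B5 iBp DB.
rewrite s0 => h; apply: (le_trans h) => {h}.
set chi := gchi W D I H H' K s beta gam dl.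
have hB : \int[P]_w (B w `^ p * (1 - chi w)) <= ei.
  apply: (small_complement (eps := eps) (c := 1 - eps / 2 - eps / 4) Heps _ _ _ _ (three_quarters eps0)).
  - by move=> w; exact: powR_ge0.
  - exact: (measurable_gchi completeP bm beta gam mD mI sH sH' s00 sK sS cH cH' dl).
  - by move=> w; exact: pchi01.
  (* Every regular path outside E satisfies chi = 1, so a measurable set equal to {chi = 1} covers a
     thick set. *)
  - move=> A mA EA; apply: tG => // w [[[gw gn Vn] osc] Ew]; rewrite -EA /=.
    have [[ig iV] [eqD dom] _ _] := gw.
    have [JI VH] := HE w Ew.
    have q'q : q' <= q by rewrite /q' ge_min lexx.
    have q'dl : q' <= dl by rewrite /q' ge_min lexx orbT.
    apply: (gchi_good sH sH' s00 sK sS cH cH' beta0 gam0 ig iV eqD dom (ltW q'0) q'dl dl1 _ JI).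
      by move=> u v uT vT uv; apply: osc => //; exact: le_trans uv dk.
    have iHs i : mu.-integrable `[0, T] (EFin \o (fun t =>
        sp_process H t w ord0 i - sp_process H' t w ord0 i)).
      apply: (integrableB _ (integrable_sp_process T H w i) (integrable_sp_process T H' w i)).
      exact: measurable_itv.
    have := integral_defect beta ig iV iHs gam0 (ltW q'0) (ltW T0) gn Vn VH.
    move=> h; apply: (le_trans (ler_wpM2l r0 h)).
    apply: (le_trans _ qdl); rewrite -[leRHS]mulrA ler_wpM2l//.
    exact: (defect_budget beta0 (ltW T0) gam0 (ler0n R n) (ltW q'0) q'q).
have e'0 : 0 <= r * e^-1 by apply: (mulr_ge0 r0); rewrite invr_ge0 (ltW ep).
exact: (four_quarters dlnu enu einu (ler_wpM2l e'0 hB) dnu).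
Qed.

(** A nonnegative function of null integral vanishes almost everywhere, and [hub] is positive on
    positive arguments. *)
Lemma comparison_at t0 : 0 <= t0 < T -> {ae P, forall w, D t0 w <= 0}.
Proof.
move=> t0T; have t0T' : 0 <= t0 <= T by case/andP: t0T => -> /ltW.
have mDt : measurable_fun setT (D t0).
  by apply: (meas_wrt_sub (Fil_measurable completeP bm _) (mD t0T')); case/andP: t0T'.
have mh : measurable_fun setT (fun w => hub (D t0 w)).
  exact: (measurableT_comp (@measurable_hub R) mDt).
have ih : P.-integrable setT (EFin \o (fun w => hub (D t0 w))).
  apply: (le_integrableR mh _ (integrable_abse (iD t0T'))) => w.
  rewrite (ger0_norm (hub_ge0 _)); exact: (hub_le (normr_ge0 _) (ler_norm _)).
have h0 : \int[P]_w hub (D t0 w) = 0.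
  apply/eqP; rewrite eq_le; apply/andP; split; last by apply: Rintegral_ge0 => w _; exact: hub_ge0.
  by apply/ler_addgt0Pr => nu nu0; rewrite add0r; exact: expected_hub_small.
have /ae_eq_integral_abs : measurable_fun setT (EFin \o (fun w => hub (D t0 w))).
  exact/measurable_EFinP.
move=> /(_ P measurableT) [+ _].
rewrite (_ : (\int[P]_(x in _) _)%E = (\int[P]_w hub (D t0 w))%:E); last first.
  rewrite /Rintegral fineK; last exact: (integrable_fin_num measurableT ih).
  by apply: eq_integral => w _ /=; rewrite ger0_norm ?hub_ge0.
rewrite h0 => /(_ erefl); apply: filterS => w /(_ Logic.I) /= [hw].
by rewrite leNgt; apply/negP => /hub_gt0; rewrite hw ltxx.
Qed.

End comparison.

(** * Ito integrals and BSDEs *)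

Lemma powR_sum3 (R : realType) (p a b c : R) : 0 <= p -> 0 <= a -> 0 <= b -> 0 <= c ->
  (a + b + c) `^ p <= 3 `^ p * (a `^ p + b `^ p + c `^ p).
Proof.
move=> p0 a0 b0 c0.
have H x y z : 0 <= x -> 0 <= y -> 0 <= z -> y <= x -> z <= x ->
    (x + y + z) `^ p <= 3 `^ p * x `^ p.
  move=> x0 y0 z0 yx zx; rewrite -powRM//; apply: ge0_ler_powR => //; rewrite ?nnegrE; lra.
have [ha hb hc] := And3 (powR_ge0 a p) (powR_ge0 b p) (powR_ge0 c p).
have h3 : 0 <= 3 `^ p :> R by exact: powR_ge0.
have [ab|ba] := leP b a; [have [ac|ca] := leP c a|have [bc|cb] := leP c b].
- by apply: le_trans (H a b c _ _ _ _ _) _ => //; rewrite ler_wpM2l//; lra.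
- rewrite addrC addrA; apply: le_trans (H c a b _ _ _ _ _) _ => //; try lra.
  by rewrite ler_wpM2l//; lra.
- rewrite [a + b]addrC; apply: le_trans (H b a c _ _ _ _ _) _ => //; try lra.
  by rewrite ler_wpM2l//; lra.
- rewrite addrC addrA; apply: le_trans (H c a b _ _ _ _ _) _ => //; try lra.
  by rewrite ler_wpM2l//; lra.
Qed.

Section Lp.
Context (R : realType) (disp : measure_display) (Omega : measurableType disp).
Context (P : probability Omega R).

Lemma in_Lp_integrable (p : R) (X : Omega -> \bar R) : 0 < p -> in_Lp P p X ->
  P.-integrable setT (fun w => (`|X w| `^ p)%E).
Proof.
move=> p0 [mX NX].
have mp : measurable_fun setT (fun w => (`|X w| `^ p)%E).
  exact: (measurableT_comp (measurable_poweR p) (measurableT_comp (@abse_measurable R setT) mX)).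
apply/integrableP; split=> //.
under eq_integral do rewrite gee0_abs ?poweR_ge0//.
rewrite -powR_Lnorm ?gt_eqF//; move: NX (Lnorm_ge0 P p%:E X); case: ('N[P]_(p%:E)[X])%E => [x||] // _ _.
by rewrite poweR_EFin ltry.
Qed.

Lemma in_Lp_integrable_fine (p : R) (X : Omega -> \bar R) : 0 < p -> in_Lp P p X ->
  P.-integrable setT (EFin \o (fun w => `|fine (X w)| `^ p)).
Proof.
move=> p0 pX; have [mX _] := pX.
apply: (le_integrable measurableT _ _ (in_Lp_integrable p0 pX)).
  apply/measurable_EFinP; apply: (measurableT_comp (measurable_powR p)).
  apply: measurableT_comp => //.
  exact: (measurableT_comp (fine_measurable measurableT) mX).
move=> w _; rewrite (gee0_abs (poweR_ge0 _ _)) /= ger0_norm ?powR_ge0//.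
have h0 : (0 : R) `^ p = 0 by rewrite powR0// gt_eqF.
by case: (X w) => [x||]; rewrite [fine _]/= ?normr0 ?h0//; exact: poweR_ge0.
Qed.

Lemma in_Lp_fin_num (p : R) (X : Omega -> \bar R) : 0 < p -> in_Lp P p X ->
  {ae P, forall w, X w \is a fin_num}.
Proof.
move=> p0 pX.
have := integrable_ae measurableT (in_Lp_integrable p0 pX).
apply: filterS => w /(_ Logic.I); have pn0 : p != 0 by rewrite gt_eqF.
by case: (X w) => [x||] //; rewrite [abse _]/= poweRyr.
Qed.

End Lp.

Lemma cvg_prob_small (R : realType) (disp : measure_display) (Omega : measurableType disp)
    (P : probability Omega R) (X : nat -> Omega -> \bar R) (e eps : R) :
  cvg_probability0 P X -> 0 < e -> 0 < eps ->
  \forall n \near \oo, (P [set w | (e%:E <= X n w)%E] <= eps%:E)%E.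
Proof.
move=> cX e0 eps0.
have /fine_cvgP[] := cX e e0.
move=> f1 /cvgr0_norm_le/(_ eps eps0) f2.
near=> n; rewrite -[P _]fineK; last by near: n; exact: f1.
rewrite lee_fin; apply: (le_trans (ler_norm _)); near: n; exact: f2.
Unshelve. all: by end_near.
Qed.

Lemma within_continuous_comp (R : realType) (A : set R) (f h : R -> R) :
  (forall x, A x -> A (h x)) -> continuous h ->
  {within A, continuous f} -> {within A, continuous (f \o h)}.
Proof.
move=> Ah ch /subspace_continuousP cf; apply/subspace_continuousP => x Ax.
have key : h y @[y --> within A (nbhs x)] --> within A (nbhs (h x)).
  move=> B HB; change (\forall y \near x, A y -> B (h y)).
  have HB' : \forall y \near x, A (h y) -> B (h y) := ch x _ HB.
  by apply: filterS HB' => y hB Ay; apply: hB; exact: Ah.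
exact: (cvg_comp h f key (cf (h x) (Ah x Ax))).
Qed.

Lemma within_continuous_sum (R : realType) (A : set R) (n : nat) (f : 'I_n -> R -> R) :
  (forall i, {within A, continuous (f i)}) ->
  {within A, continuous (fun t => \sum_(i < n) f i t)}.
Proof.
move=> cf; elim: (index_enum _) => [|i r IH].
  by under eq_fun do rewrite big_nil; move=> x; exact: cvg_cst.
by under eq_fun do rewrite big_cons; move=> x; apply: continuousD; [exact: cf|exact: IH].
Qed.

Lemma within_continuous_sp_integral (R : realType) (disp : measure_display)
    (Omega : measurableType disp) (P : probability Omega R) (d : nat) (T : R)
    (W : R -> Omega -> 'rV[R]_d) (H : simple_process R Omega d) w :
  is_simple_process P T W H ->
  {within `[0, T], continuous (fun t => W t w)} ->
  {within `[0, T], continuous (fun t => sp_integral W H t w)}.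
Proof.
move=> sH cW.
have cWi i : {within `[0, T], continuous (fun t => W t w ord0 i)}.
  move=> x; apply: (@cvg_comp _ _ _ _ (fun z : 'rV[R]_d => z ord0 i) _ _ _ (cW x)).
  exact: coord_continuous.
have cWm i a : 0 <= a <= T ->
    {within `[0, T], continuous (fun t => W (Num.min a t) w ord0 i)}.
  move=> /andP[a0 aT]; apply: (within_continuous_comp (h := Num.min a)) (cWi i).
    move=> x; rewrite /= !in_itv/= => /andP[x0 xT].
    by rewrite le_min a0 x0 ge_min aT.
  move=> x; apply: continuous_min; [exact: cvg_cst|exact: cvg_id].
have E : (fun t => sp_integral W H t w) = fun t => \sum_(k < sp_size H) \sum_(i < d)
    (sp_val H k w ord0 i * (W (Num.min (sp_time H k.+1) t) w ord0 i -
       W (Num.min (sp_time H k) t) w ord0 i)).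
  apply/funext => t; apply: eq_bigr => k _; apply: eq_bigr => i _.
  by rewrite !mxE.
rewrite E; apply: within_continuous_sum => k; apply: within_continuous_sum => i x.
apply: (@cvgM _ _ _ _ (fun _ => sp_val H k w ord0 i) _ _ _ (cvg_cst _)).
by apply: continuousB; apply: cWm; apply: (sp_time_bounds sH) => //; exact: ltnW.
Qed.

Lemma measureU_half (R : realType) (disp : measure_display) (Omega : measurableType disp)
    (P : probability Omega R) (A B : set Omega) (eps : R) :
  measurable A -> measurable B -> (P A <= (eps / 2)%:E)%E -> (P B <= (eps / 2)%:E)%E ->
  (P (A `|` B) <= eps%:E)%E.
Proof.
move=> mA mB PA PB; have hU : (P (A `|` B) <= P A + P B)%E by exact: measureU2.
by apply: (le_trans hU); rewrite [eps]splitr EFinD; exact: leeD.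
Qed.

Section ito_approximation.
Context (R : realType) (disp : measure_display) (Omega : measurableType disp).
Context (P : probability Omega R) (d : nat) (T : R).
Context (W : R -> Omega -> 'rV[R]_d).
Hypothesis completeP : measure_is_complete P.
Hypothesis bm : brownian_motion P T W.
Hypothesis T0 : 0 < T.
Local Notation Fil := (augmented_filtration P W).
Local Notation mu := (@lebesgue_measure R).

Let mT : measurable (`[0, T]%classic : set (measurableTypeR R)). Proof. exact: measurable_itv. Qed.

Let icst (c : R) := integrable_itv_cst 0 T c true false.

Lemma progressive_coord (Z : R -> Omega -> 'rV[R]_d) w i :
  progressive_meas T Fil (Z : R -> Omega -> rV_borel R d) ->
  measurable_fun (`[0, T] : set (measurableTypeR R)) (fun t => Z t w ord0 i).
Proof.
move=> pZ.
exact: (measurableT_comp (measurable_rV_coord i) (progressive_section completeP bm w (ltW T0) pZ)).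
Qed.

Lemma young_abs (x c : R) : 0 < c -> `|x| <= c + c^-1 * x ^+ 2.
Proof.
move=> c0; rewrite -real_normK ?num_real//; move: `|x| (normr_ge0 x) => y y0.
have [yc|cy] := leP y c.
  have : 0 <= c^-1 * y ^+ 2 by rewrite mulr_ge0 ?sqr_ge0// invr_ge0 ltW.
  lra.
have : y <= c^-1 * y ^+ 2 by rewrite mulrC ler_pdivlMr// expr2 ler_wpM2l// ltW.
lra.
Qed.

(** A linearised Cauchy-Schwarz inequality: the free parameter c makes the L1 norm small once the
    squared L2 norm e1 is small relative to c. *)
Lemma sum_abs_integrable (u : R -> 'rV[R]_d) (c e1 : R) : 0 < c ->
  (forall i, measurable_fun (`[0, T] : set (measurableTypeR R)) (fun t => u t ord0 i)) ->
  (\int[mu]_(t in `[0%R, T]) (enorm (u t) ^+ 2)%:E < e1%:E)%E ->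
  (forall i, mu.-integrable `[0, T] (EFin \o (fun t => u t ord0 i))) /\
  \int[mu]_(t in `[0, T]) (\sum_(i < d) `|u t ord0 i|) <= d%:R * (c * T + c^-1 * e1).
Proof.
move=> c0 mu_ ue1.
have me : measurable_fun (`[0, T] : set (measurableTypeR R)) (fun t => enorm (u t) ^+ 2).
  rewrite (_ : (fun _ => _) = fun t => \sum_(i < d) u t ord0 i ^+ 2); last first.
    by apply/funext => t; rewrite sqr_enorm.
  by apply: measurable_sum => i; apply: measurable_funX.
have ie : mu.-integrable `[0, T] (EFin \o (fun t => enorm (u t) ^+ 2)).
  apply/integrableP; split; first exact/measurable_EFinP.
  under eq_integral do rewrite /= ger0_norm ?sqr_ge0//.
  exact: lt_trans ue1 (ltry _).
have iy : mu.-integrable `[0, T] (EFin \o (fun t => c + c^-1 * enorm (u t) ^+ 2)).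
  exact: (integrableD mT (icst c) (integrableZl mT c^-1 ie)).
have hb t i : `|u t ord0 i| <= c + c^-1 * enorm (u t) ^+ 2.
  apply: (le_trans (normr_le_enorm _ _)); apply: (le_trans (ler_norm _)).
  exact: young_abs.
have iu i : mu.-integrable `[0, T] (EFin \o (fun t => u t ord0 i)).
  apply: (le_integrable mT _ _ iy); first exact/measurable_EFinP.
  move=> t _; rewrite /= lee_fin; apply: (le_trans (hb t i)); exact: ler_norm.
split=> //.
have isum := integrable_itv_sum_norm iu.
apply: (@le_trans _ _ (\int[mu]_(t in `[0, T]) (d%:R * (c + c^-1 * enorm (u t) ^+ 2)))).
  apply: le_Rintegral => //; first exact: (integrableZl mT d%:R iy).
  move=> t _; rewrite mulr_natl -[X in _ *+ X]card_ord -sumr_const.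
  by apply: ler_sum => i _; exact: hb.
rewrite (RintegralZl d%:R mT iy) ler_wpM2l//.
have iy2 := integrableZl mT c^-1 ie.
rewrite (RintegralD mT (icst c) iy2) (RintegralZl c^-1 mT ie).
rewrite Rintegral_cst//= lebesgue_measure_itv/= lte_fin T0 /= oppr0 addr0.
rewrite lerD2l ler_wpM2l ?invr_ge0 ?(ltW c0)//.
have h := integrable_fin_num mT ie.
by rewrite -lee_fin /Rintegral fineK// ltW.
Qed.

Lemma ito_approx (Z : R -> Omega -> 'rV[R]_d) (I : R -> Omega -> R) (e eps : R) :
  class_M P T W Z -> is_ito_integral P T W Z I -> 0 < e -> 0 < eps ->
  exists H E, [/\ is_simple_process P T W H, measurable E,
    (P E <= eps%:E)%E & forall w, ~ E w ->
    (forall t, 0 <= t <= T -> `|sp_integral W H t w - I t w| <= e) /\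
    (forall i, mu.-integrable `[0, T]
      (EFin \o (fun t => (sp_process H t w - Z t w) ord0 i))) /\
    \int[mu]_(t in `[0, T])
      (\sum_(i < d) `|(sp_process H t w - Z t w) ord0 i|) <= e].
Proof.
move=> [pZ _] [[aI cI] [H [sH cH1 cH2]]] e0 eps0.
(* First c is chosen so that d c T <= e / 2, then e1, given c, so that d c^-1 e1 <= e / 2. *)
have [c /andP[c0 _] hc] := exists_fraction (divr_gt0 e0 (ltr0n R 2))
  (mulr_ge0 (ler0n R d) (ltW T0)).
have [e1 /andP[e10 _] he1] := exists_fraction (divr_gt0 e0 (ltr0n R 2))
  (mulr_ge0 (ler0n R d) (ltW (etrans (invr_gt0 c) c0))).
have eps2 : 0 < eps / 2 by rewrite divr_gt0.
have [N1 _ H1] := cvg_prob_small cH1 e10 eps2.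
have [N2 _ H2] := cvg_prob_small cH2 e0 eps2.
pose n := maxn N1 N2.
have {}H1 := H1 n (leq_maxl _ _); have {}H2 := H2 n (leq_maxr _ _).
set A1 := [set w | _] in H1; set A2 := [set w | _] in H2.
have m1 : measurable A1.
  have := measurable_sp_process_dist completeP bm (ltW T0) (sH n) pZ.
  move=> /emeasurable_fun_c_infty/(_ e1%:E).
  by rewrite setTI; exact.
have m2 : measurable A2.
  apply: (measurable_sup_process completeP) => //; first exact: ltW.
    move=> t tT; apply: measurable_funB.
      exact: (measurable_sp_integral completeP bm (sH n)).
    apply: (meas_wrt_sub (Fil_measurable completeP bm _) (aI _ tT)).
    by case/andP: tT.
  have [_ _ cW _] := bm.
  apply: filterS2 cW cI => w cWw cIw.
  by move=> x; apply: continuousB; [exact: (within_continuous_sp_integral (sH n) cWw)|exact: cIw].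
exists (H n), (A1 `|` A2); split => //.
- exact: measurableU.
- exact: measureU_half.
move=> w /not_orP[n1 n2]; split.
  move=> t tT; move/negP: n2; rewrite -ltNge => n2.
  rewrite -lee_fin; apply: le_trans (ltW n2); apply: ereal_sup_ubound.
  by exists t => //; rewrite /= in_itv.
move/negP: n1; rewrite -ltNge => n1.
have mc i : measurable_fun (`[0, T] : set (measurableTypeR R))
    (fun t => (sp_process (H n) t w - Z t w) ord0 i).
  rewrite (_ : (fun _ => _) = fun t => sp_process (H n) t w ord0 i - Z t w ord0 i); last first.
    by apply/funext => t; rewrite !mxE.
  apply: measurable_funB; last exact: progressive_coord.
  by have /integrableP[/measurable_EFinP] := integrable_sp_process T (H n) w i.
have [h1 h2] := sum_abs_integrable c0 mc n1.
split=> //; apply: (le_trans h2).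
by move: hc he1; rewrite mulrDr [d%:R * (c * T)]mulrCA [c * _]mulrC mulrA; lra.
Qed.

Lemma class_M_integrable (Z : R -> Omega -> 'rV[R]_d) : class_M P T W Z ->
  {ae P, forall w, forall i, mu.-integrable `[0, T] (EFin \o (fun t => Z t w ord0 i))}.
Proof.
move=> [pZ]; apply: filterS => w Zw.
set X := (\int[_]_(s in _) _)%E in Zw.
have X0 : (0 <= X)%E by apply: integral_ge0 => t _; rewrite lee_fin sqr_ge0.
have Xf : X \is a fin_num by rewrite ge0_fin_numE.
have Xe : (X < (fine X + 1)%:E)%E.
  by rewrite -[X in (X < _)%E]fineK// lte_fin ltrDl.
have mZ i := progressive_coord w i pZ.
by have [] := sum_abs_integrable ltr01 mZ Xe.
Qed.

Lemma driver_integrable (F : Omega -> R -> R -> 'rV[R]_d -> R) Y Z xi :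
  generator P T W F -> bsde_solution P T W F xi Y Z ->
  {ae P, forall w, mu.-integrable `[0, T] (EFin \o (fun t => F w t (Y t w) (Z t w)))}.
Proof.
move=> gF [[_ cY] [pZ _] iF _]; apply: filterS2 cY iF => w cYw iFw.
apply/integrableP; split => //; apply/measurable_EFinP.
apply: (generator_section completeP bm w (ltW T0) gF).
  exact: subspace_continuous_measurable_fun.
exact: (progressive_section completeP bm w (ltW T0) pZ).
Qed.

Lemma bsde_increment (f y i : R -> R) (x : R) :
  mu.-integrable `[0, T] (EFin \o f) ->
  (forall t, 0 <= t <= T -> y t = x + \int[mu]_(s in `[t, T]) f s - (i T - i t)) ->
  forall u v, 0 <= u -> u <= v -> v <= T ->
  y v - y u - (i v - i u) = - \int[mu]_(s in `[u, v]) f s.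
Proof.
move=> fi eqy u v u0 uv vT.
rewrite eqy ?(le_trans u0 uv)// eqy ?u0 ?(le_trans uv vT)//.
have fuT : mu.-integrable `[u, T] (EFin \o f) by exact: integrable_itv_sub fi.
have -> : \int[mu]_(s in `[u, T]) f s =
    \int[mu]_(s in `[u, v]) f s + \int[mu]_(s in `[v, T]) f s.
  rewrite -(Rintegral_itv_obnd_cbnd (r := v)); last first.
    by apply: integrable_itv_sub fi => //; exact: le_trans u0 uv.
  rewrite -Rintegral_setU//.
  - by rewrite -itv_bndbnd_setU ?bnd_simp.
  - by rewrite -itv_bndbnd_setU ?bnd_simp.
  - apply/disj_setPS => t /= -[]; rewrite !in_itv/= => /andP[_ h1] /andP[h2 _].
    by move: (lt_le_trans h2 h1); rewrite ltxx.
ring.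
Qed.

Lemma ito_difference_approx (Z Z' : R -> Omega -> 'rV[R]_d) (I I' : R -> Omega -> R)
    (e eps : R) :
  class_M P T W Z -> is_ito_integral P T W Z I ->
  class_M P T W Z' -> is_ito_integral P T W Z' I' -> 0 < e -> 0 < eps ->
  exists H H' E, [/\ is_simple_process P T W H, is_simple_process P T W H',
    measurable E, (P E <= eps%:E)%E & forall w, ~ E w ->
    (forall t, 0 <= t <= T ->
       `|sp_integral W H t w - sp_integral W H' t w - (I t w - I' t w)| <= e) /\
    \int[mu]_(t in `[0, T]) (\sum_(i < d) `|Z t w ord0 i - Z' t w ord0 i
       - (sp_process H t w ord0 i - sp_process H' t w ord0 i)|) <= e].
Proof.
move=> cZ iZ cZ' iZ' e0 eps0.
have e2 : 0 < e / 2 by rewrite divr_gt0.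
have eps2 : 0 < eps / 2 by rewrite divr_gt0.
have [H [E [sH mE PE HE]]] := ito_approx cZ iZ e2 eps2.
have [H' [E' [sH' mE' PE' HE']]] := ito_approx cZ' iZ' e2 eps2.
exists H, H', (E `|` E'); split=> //.
- exact: measurableU.
- exact: measureU_half.
move=> w /not_orP[/HE [h1 [h2 h3]] /HE' [h1' [h2' h3']]]; split.
  move=> t tT; have := h1 t tT; have := h1' t tT.
  rewrite (_ : _ - _ - (_ - _) = (sp_integral W H t w - I t w) -
    (sp_integral W H' t w - I' t w)); last by ring.
  by move=> k1 k2; apply: (le_trans (ler_normB _ _)); lra.
have is1 := integrable_itv_sum_norm h2; have is2 := integrable_itv_sum_norm h2'.
apply: (@le_trans _ _ (\int[mu]_(t in `[0, T])
    (\sum_(i < d) `|(sp_process H t w - Z t w) ord0 i| +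
     \sum_(i < d) `|(sp_process H' t w - Z' t w) ord0 i|))); last first.
  by rewrite (RintegralD mT is1 is2); lra.
apply: le_Rintegral => //.
- have := integrable_itv_sum_norm (fun i => integrableB mT (h2' i) (h2 i)).
  apply: eq_integrable => // t _; congr EFin; apply: eq_bigr => i _.
  by rewrite /= !mxE; congr `| _ |; ring.
- exact: (integrableD mT is1 is2).
- move=> t _; rewrite -big_split/=; apply: ler_sum => i _; rewrite !mxE.
  rewrite (_ : _ - _ - (_ - _) = (sp_process H' t w ord0 i - Z' t w ord0 i) -
    (sp_process H t w ord0 i - Z t w ord0 i)); last by ring.
  by rewrite addrC; exact: ler_normB.
Qed.

(** F' is replaced by F at the point (y', z'). What is left is an increment of F: the F1 part moves
    first in y by monotonicity and then in z by the Lipschitz bound, the F2 part in both at once by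
    [convex_slope_bound]. *)
Lemma driver_domination (p : R) (F F' : Omega -> R -> R -> 'rV[R]_d -> R)
    (xi : Omega -> R) :
  assumption_B P T W p F xi ->
  {ae P, forall w t y z, 0 <= t <= T -> F w t y z <= F' w t y z} ->
  exists beta gam, [/\ 0 <= beta, 0 <= gam &
    {ae P, forall w t y y' z z', 0 <= t <= T -> y' < y ->
      F w t y z - F' w t y' z' <=
        beta * (y - y') + gam * \sum_(i < d) `|z ord0 i - z' ord0 i|}].
Proof.
move=> [b1 [b2 [g1 [g2 [alpha [phi [f [F1 [F2]]]]]]]]].
move=> [[g10 g20] _ _ [fi _] [_ FE _ HB]] FF'.
(* The rates b1 and b2 may be negative, whereas the discount factor of the walk asks for a
   nonnegative one. *)
exists `|b1 + b2|, (g1 + g2); split => //; first exact: addr_ge0.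
apply: filterS2 HB FF' => w HBw FFw t y y' z z' tT yy'.
have [_ [mono lip growth] cvx _] := HBw t tT.
have h0 := FFw t y' z' tT.
have sg1 : Num.sg (y - y') = 1 by rewrite gtr0_sg// subr_gt0.
have h1 : F1 w t y z - F1 w t y' z <= b1 * (y - y').
  by have := mono y y' z; rewrite sg1 mul1r gtr0_norm ?subr_gt0.
have h2 : F1 w t y' z - F1 w t y' z' <= g1 * enorm (z - z').
  exact: le_trans (ler_norm _) (lip _ _ _).
have h3 : F2 w t y z - F2 w t y' z' <= b2 * (y - y') + g2 * enorm (z - z').
  apply: (convex_slope_bound cvx fi g20) => // y0 z0 y00.
  by have := growth y0 z0; rewrite gtr0_sg// mul1r gtr0_norm.
have h4 : (b1 + b2) * (y - y') <= `|b1 + b2| * (y - y').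
  by rewrite ler_wpM2r ?ler_norm// subr_ge0 ltW.
(* The tilt acts coordinate by coordinate, so the Euclidean norm gives way to the sum of absolute
   values. *)
have h5 : (g1 + g2) * enorm (z - z') <= (g1 + g2) * \sum_(i < d) `|z ord0 i - z' ord0 i|.
  rewrite ler_wpM2l ?addr_ge0//; apply: (le_trans (enorm_le_sum _)).
  by apply: ler_sum => i _; rewrite !mxE.
have := FE w t y z tT; have := FE w t y' z' tT => e1 e2.
rewrite e1 in h0; rewrite e2.
lra.
Qed.

End ito_approximation.

(** * From fixed times to all times, and the comparison theorem *)

(** Countably many rational times share one exceptional set. A positive value at some t < T persists
    at a rational time of ]t, T[ by continuity; the time T is covered by its own hypothesis. *)
Lemma ae_le0_all_times (R : realType) (disp : measure_display)
    (Omega : measurableType disp) (P : probability Omega R) (T : R)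
    (D : R -> Omega -> R) :
  {ae P, forall w, {within `[0, T], continuous (D ^~ w)}} ->
  {ae P, forall w, D T w <= 0} ->
  (forall t, 0 <= t < T -> {ae P, forall w, D t w <= 0}) ->
  {ae P, forall w, forall t, 0 <= t <= T -> D t w <= 0}.
Proof.
move=> cD DT Dt.
have all_rat : {ae P, forall w, forall n : nat, forall q : rat,
    unpickle n = Some q -> 0 <= (ratr q : R) < T -> D (ratr q : R) w <= (0 : R)}.
  apply/ae_foralln => n; case E : (unpickle n) => [q|]; last first.
    by apply: filterE => w q.
  have [qT|qT] := boolP (0 <= (ratr q : R) < T); last first.
    by apply: filterE => w q' [<-]; rewrite (negbTE qT).
  by apply: filterS (Dt _ qT) => w h q' [<-].
apply: filterS2 cD (filterI all_rat DT) => w cw [hq hT] t tT.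
have [t0 tT'] := andP tT.
rewrite leNgt; apply/negP => Dpos.
have tltT : t < T.
  by rewrite lt_neqAle tT' andbT; apply/negP => /eqP tE; move: Dpos; rewrite tE ltNge hT.
have [dd dd0 H] := within_itv_cont cw tT Dpos.
have tm : t < Num.min (t + dd) T by rewrite lt_min tltT ltrDl dd0.
have [q] := rat_in_itvoo tm; rewrite in_itv/= lt_min => /andP[tq /andP[qd qT]].
have q0 : 0 <= ratr q :> R by exact: le_trans t0 (ltW tq).
have h1 := hq (pickle q) q (pickleK q).
have {}h1 : D (ratr q) w <= 0 by apply: h1; rewrite q0 qT.
have : `|D t w - D (ratr q) w| < D t w.
  apply: H; first by rewrite q0 ltW.
  by rewrite ltr0_norm ?subr_lt0//; lra.
by rewrite ltr_norml => /andP[_]; lra.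
Qed.

Theorem theorem9 (R : realType) (disp : measure_display)
    (Omega : measurableType disp) (P : probability Omega R)
    (d : nat) (T : R) (W : R -> Omega -> 'rV[R]_d) (p : R)
    (F F' : Omega -> R -> R -> 'rV[R]_d -> R) (xi xi' : Omega -> R)
    (Y Y' : R -> Omega -> R) (Z Z' : R -> Omega -> 'rV[R]_d) :
  (0 < d)%N -> 0 < T ->
  measure_is_complete P ->
  brownian_motion P T W ->
  generator P T W F -> generator P T W F' ->
  terminal_value P T W xi -> terminal_value P T W xi' ->
  1 < p ->
  class_S P T W p Y -> class_M P T W Z ->
  class_S P T W p Y' -> class_M P T W Z' ->
  bsde_solution P T W F xi Y Z ->
  bsde_solution P T W F' xi' Y' Z' ->
  {ae P, forall w,
    (forall t y z, 0 <= t <= T -> F w t y z <= F' w t y z) /\ xi w <= xi' w} ->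
  assumption_B P T W p F xi ->
  {ae P, forall w, forall t, 0 <= t <= T -> Y t w <= Y' t w}.
Proof.
move=> d0 T0 cP bm gF gF' _ _ p1 [[aY cY] LY] cZ [[aY' cY'] LY'] cZ' sY sY' FF' HB.
have p0 : 0 < p by exact: lt_trans p1.
have iF := driver_integrable cP bm T0 gF sY.
have iF' := driver_integrable cP bm T0 gF' sY'.
have [_ _ _ [I [iI eqY]]] := sY; have [_ _ _ [I' [iI' eqY']]] := sY'.
have [[aI cI] _] := iI; have [[aI' cI'] _] := iI'.
have FF'1 : {ae P, forall w t y z, 0 <= t <= T -> F w t y z <= F' w t y z}.
  by apply: filterS FF' => w [].
have [beta [gam [beta0 gam0 dom]]] := driver_domination HB FF'1.
pose D t w := Y t w - Y' t w.
pose J t w := I t w - I' t w.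
pose g t w := F w t (Y t w) (Z t w) - F' w t (Y' t w) (Z' t w).
pose V t w i := Z t w ord0 i - Z' t w ord0 i.
(* The margin 5 is the one spent in [path_bound]. [fine] would turn an infinite supremum into 0, but
   both suprema are almost surely finite. *)
pose B w := `|fine (sup_process T Y w)| + `|fine (sup_process T Y' w)| + 5.
have mTT : measurable (`[0, T]%classic : set (measurableTypeR R)) by exact: measurable_itv.
have mD t : 0 <= t <= T -> meas_wrt (augmented_filtration P W t) (D t).
  by move=> tT; apply: meas_wrtB; [exact: aY|exact: aY'].
have mJ t : 0 <= t <= T -> meas_wrt (augmented_filtration P W t) (J t).
  by move=> tT; apply: meas_wrtB; [exact: aI|exact: aI'].
have B5 w : 5 <= B w by rewrite /B lerDr addr_ge0.
have mB : measurable_fun setT B.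
  have [mY _] := LY; have [mY' _] := LY'.
  apply: measurable_funD => //; apply: measurable_funD; apply: measurableT_comp => //.
  - exact: (measurableT_comp (fine_measurable measurableT) mY).
  - exact: (measurableT_comp (fine_measurable measurableT) mY').
have iBp : P.-integrable setT (EFin \o (fun w => B w `^ p)).
  have i1 := in_Lp_integrable_fine p0 LY; have i2 := in_Lp_integrable_fine p0 LY'.
  have i3 : P.-integrable setT (EFin \o (fun _ : Omega => (5 : R) `^ p)).
    exact: integrable_cstR.
  apply: (le_integrableR _ _ (integrableZR (3 `^ p) (integrableDR (integrableDR i1 i2) i3))).
    exact: (measurableT_comp (measurable_powR p) mB).
  move=> w; rewrite ger0_norm ?powR_ge0//.
  by apply: powR_sum3 => //; exact: ltW.
have DB : {ae P, forall w, D T w <= 0 /\ forall t, 0 <= t <= T -> `|D t w| + 5 <= B w}.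
  apply: filterS2 (filterI (filterI eqY eqY') FF')
    (filterI (in_Lp_fin_num p0 LY) (in_Lp_fin_num p0 LY')).
  move=> w [[eY eY'] [_ xx]] [fY fY']; split.
    (* At the terminal time the integrals are over a single point and the Ito terms cancel, so D T
       is xi - xi'. *)
    have TT : 0 <= T <= T by rewrite lexx ltW.
    by rewrite /D (eY T TT) (eY' T TT) set_itv1 !Rintegral_set1; lra.
  move=> t tT; have sup_le (X : R -> Omega -> R) : sup_process T X w \is a fin_num ->
      `|X t w| <= `|fine (sup_process T X w)|.
    move=> fX; apply: le_trans (ler_norm _); rewrite -lee_fin fineK//.
    by apply: ereal_sup_ubound; exists t => //; rewrite /= in_itv.
  rewrite /B lerD2r; apply: (le_trans (ler_normB _ _)).
  by apply: lerD; exact: sup_le.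
have iD t : 0 <= t <= T -> P.-integrable setT (EFin \o D t).
  move=> tT; have tT' : t <= T by case/andP: tT.
  have mDt : measurable_fun setT (D t).
    exact: (meas_wrt_sub (Fil_measurable cP bm tT') (mD t tT)).
  apply/integrableP; split; first exact/measurable_EFinP.
  have /integrableP[_] := iBp; apply: le_lt_trans.
  apply: ae_ge0_le_integral => //.
  - by apply: measurableT_comp => //; exact/measurable_EFinP.
  - apply: measurableT_comp => //; apply/measurable_EFinP.
    exact: (measurableT_comp (measurable_powR p) mB).
  - apply: filterS DB => w [_ h] _; rewrite /= lee_fin [leRHS]ger0_norm ?powR_ge0//.
    (* Since B >= 1 and p > 1, |D t| <= B <= B ^ p. *)
    apply: (@le_trans _ _ (B w)); first by have := h t tT; lra.
    rewrite -[leLHS]powRr1; last by have := B5 w; lra.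
    by apply: ler_powR; [have := B5 w; lra|exact: ltW].
have good_int : {ae P, forall w, path_integrable T g V w}.
  apply: filterS2 (filterI iF iF')
    (filterI (class_M_integrable cP bm T0 cZ) (class_M_integrable cP bm T0 cZ')).
  move=> w [i1 i2] [j1 j2]; split; first exact: (integrableB mTT i1 i2).
  by move=> i; exact: (integrableB mTT (j1 i) (j2 i)).
have good_dyn : {ae P, forall w, path_dynamics T D J g V beta gam w}.
  apply: filterS2 (filterI (filterI iF iF') dom) (filterI eqY eqY').
  move=> w [[i1 i2] domw] [eY eY']; split.
    move=> u v u0 uv vT.
    have h1 := bsde_increment i1 eY u0 uv vT.
    have h2 := bsde_increment i2 eY' u0 uv vT.
    have mI : measurable (`[u, v]%classic : set (measurableTypeR R)) by exact: measurable_itv.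
    have k1 := integrable_itv_sub true false u0 vT i1.
    have k2 := integrable_itv_sub true false u0 vT i2.
    rewrite /g (RintegralB mI k1 k2) /D /J; lra.
  by move=> s sT Ds; apply: domw => //; rewrite -subr_gt0.
have cD : {ae P, forall w, {within `[0, T], continuous (D ^~ w)}}.
  by apply: filterS2 cY cY' => w c1 c2 x; apply: continuousB; [exact: c1|exact: c2].
have cJ : {ae P, forall w, {within `[0, T], continuous (J ^~ w)}}.
  by apply: filterS2 cI cI' => w c1 c2 x; apply: continuousB; [exact: c1|exact: c2].
have DB' : {ae P, forall w, D T w <= 0 /\ forall t, 0 <= t <= T -> D t w + 5 <= B w}.
  apply: filterS DB => w [h1 h2]; split=> // t tT; apply: le_trans (h2 t tT).
  by rewrite lerD2r ler_norm.
have main t : 0 <= t < T -> {ae P, forall w, D t w <= 0}.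
  exact: (comparison_at cP bm d0 T0 mD mJ iD beta0 gam0 p1 B5 iBp good_int good_dyn
    cD cJ DB' (fun e eps => @ito_difference_approx _ _ _ _ _ _ _ cP bm T0 _ _ _ _ e eps
      cZ iI cZ' iI')).
have DT : {ae P, forall w, D T w <= 0} by apply: filterS DB => w [].
apply: filterS (ae_le0_all_times cD DT main) => w h t tT.
by rewrite -subr_le0; exact: h.
Qed.
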